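(* Let $k$ be a field, $n\ge1$, and let $G$ be a linearly reductive finite subgroup scheme of $\operatorname{SL}_n$ over $k$. Then the canonical action of $G$ on $k[x_1,\dots,x_n]$ is small. The action of $G$ on $k[[x_1,\dots,x_n]]$ is also small.
   Context: The canonical action is the one by linear substitutions of the variables $x_1,\dots,x_n$; the action on a ring $B$ is identified with the corresponding action on $X=\operatorname{Spec}B$. $G$ is linearly reductive if every $G$-module is completely reducible ($G$ need not be reduced). For a $k$-group scheme $G$ acting on a $k$-scheme $X$, the stabilizer is the $X$-group scheme obtained by pulling back $G\times X\to X\times X$, $(g,x)\mapsto(gx,x)$, along the diagonal; the action is free if the stabilizer is trivial. The action of $G$ on $X$ is small if there is a $G$-stable open subset $U\subset X$ on which the action is free and such that $\operatorname{codim}_X(X\setminus U)\ge2$. *)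

(* Defs.v *)
From HB Require Import structures.
From mathcomp Require Import all_boot all_order all_algebra.
From mathcomp Require Import sesquilinear boolp mpoly.

Set Implicit Arguments.
Unset Strict Implicit.
Unset Printing Implicit Defensive.

Import GRing.Theory.

Local Open Scope ring_scope.
Local Open Scope quotient_scope.

(* Extension of scalars V (x)_k R.  A list of pairs (v, r) stands for the     *)
(* formal sum of the v (x) r; two formal sums are identified when no          *)
(* k-bilinear map separates them.                                             *)

Section Tensor.
Variables (k : fieldType) (V : lmodType k) (R : comAlgType k).

Definition fsum (T : lmodType k) (b : {bilinear V -> R -> T})
    (s : seq (V * R)) : T :=
  \sum_(p <- s) b p.1 p.2.

Definition fsum_eq (s t : seq (V * R)) : bool :=
  `[< forall (T : lmodType k) (b : {bilinear V -> R -> T}),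
        fsum b s = fsum b t >].

Lemma fsum_eqP s t :
  reflect (forall (T : lmodType k) (b : {bilinear V -> R -> T}),
             fsum b s = fsum b t) (fsum_eq s t).
Proof. exact: asboolP. Qed.

Fact fsum_eq_refl : reflexive fsum_eq.
Proof. by move=> s; apply/fsum_eqP. Qed.

Fact fsum_eq_sym : ssrbool.symmetric fsum_eq.
Proof. by move=> s t; apply/fsum_eqP/fsum_eqP=> h T b; rewrite h. Qed.

Fact fsum_eq_trans : transitive fsum_eq.
Proof.
by move=> t s u /fsum_eqP st /fsum_eqP tu; apply/fsum_eqP=> T b; rewrite st tu.
Qed.

Canonical fsum_equiv :=
  EquivRel fsum_eq fsum_eq_refl fsum_eq_sym fsum_eq_trans.

Definition tens := {eq_quot fsum_eq}.
HB.instance Definition _ := Choice.on tens.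
HB.instance Definition _ := Quotient.on tens.
HB.instance Definition _ := EqQuotient.on tens.

Definition tens_sum (s : seq (V * R)) : tens := \pi_tens s.
Definition tens_pure (v : V) (r : R) : tens := tens_sum [:: (v, r)].

Lemma tens_sumP s t :
  tens_sum s = tens_sum t <->
  forall (T : lmodType k) (b : {bilinear V -> R -> T}), fsum b s = fsum b t.
Proof.
split=> [/eqquotP /fsum_eqP //|h].
by apply/eqquotP/fsum_eqP.
Qed.

Lemma tens_reprK (x : tens) : tens_sum (repr x) = x.
Proof. exact: reprK. Qed.

Lemma fsum_repr (T : lmodType k) (b : {bilinear V -> R -> T}) s :
  fsum b (repr (tens_sum s)) = fsum b s.
Proof. by apply: (tens_sumP _ _).1; rewrite tens_reprK. Qed.

Lemma fsum_cat (T : lmodType k) (b : {bilinear V -> R -> T}) s t :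
  fsum b (s ++ t) = fsum b s + fsum b t.
Proof. exact: big_cat. Qed.

Definition fsopp (s : seq (V * R)) := [seq (- p.1, p.2) | p <- s].
Definition fsscale (r : R) (s : seq (V * R)) := [seq (p.1, r * p.2) | p <- s].

Lemma fsum_opp (T : lmodType k) (b : {bilinear V -> R -> T}) s :
  fsum b (fsopp s) = - fsum b s.
Proof.
rewrite /fsum big_map -sumrN; apply: eq_bigr => p _ /=; exact: linearNl.
Qed.

Definition mulb (T : lmodType k) (b : {bilinear V -> R -> T}) (r : R)
  (v : V) (x : R) : T := b v (r * x).

Fact mulb_bilinear (T : lmodType k) (b : {bilinear V -> R -> T}) r :
  bilinear_for *:%R *:%R (mulb b r).
Proof.
split=> [u a v w|v a u w] /=; rewrite /mulb.
  exact: linearPl.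
by rewrite mulrDr -scalerAr linearPr.
Qed.

HB.instance Definition _ (T : lmodType k) (b : {bilinear V -> R -> T}) r :=
  bilinear_isBilinear.Build k V R T *:%R *:%R (mulb b r) (mulb_bilinear b r).

Lemma fsum_scale (T : lmodType k) (b : {bilinear V -> R -> T}) r s :
  fsum b (fsscale r s) = fsum (mulb b r : {bilinear V -> R -> T}) s.
Proof. by rewrite /fsum big_map. Qed.

Definition tens_add (x y : tens) := tens_sum (repr x ++ repr y).
Definition tens_opp (x : tens) := tens_sum (fsopp (repr x)).
Definition tens_scale (r : R) (x : tens) := tens_sum (fsscale r (repr x)).

Fact tens_addA : associative tens_add.
Proof.
by move=> x y z; apply/tens_sumP=> T b; rewrite !(fsum_cat, fsum_repr) addrA.
Qed.
Fact tens_addC : commutative tens_add.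
Proof. by move=> x y; apply/tens_sumP=> T b; rewrite !fsum_cat addrC. Qed.
Fact tens_add0 : left_id (tens_sum [::]) tens_add.
Proof.
move=> x; rewrite -[RHS]tens_reprK; apply/tens_sumP=> T b.
by rewrite fsum_cat fsum_repr {1}/fsum big_nil add0r.
Qed.
Fact tens_addN : left_inverse (tens_sum [::]) tens_opp tens_add.
Proof.
move=> x; apply/tens_sumP=> T b.
by rewrite fsum_cat fsum_repr fsum_opp addNr /fsum big_nil.
Qed.

HB.instance Definition _ :=
  GRing.isZmodule.Build tens tens_addA tens_addC tens_add0 tens_addN.

Fact tens_scaleA a b v :
  tens_scale a (tens_scale b v) = tens_scale (a * b) v.
Proof.
apply/tens_sumP=> T f; rewrite !fsum_scale fsum_repr fsum_scale.
by apply: eq_bigr => p _; rewrite /= /mulb /= /mulb mulrA.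
Qed.
Fact tens_scale1 : left_id 1 tens_scale.
Proof.
move=> x; rewrite -[RHS]tens_reprK; apply/tens_sumP=> T b.
by rewrite fsum_scale; apply: eq_bigr => p _; rewrite /= /mulb mul1r.
Qed.
Fact tens_scaleDr : right_distributive tens_scale +%R.
Proof.
move=> a x y; apply/tens_sumP=> T b.
by rewrite fsum_scale !(fsum_cat, fsum_repr) !fsum_scale.
Qed.
Fact tens_scaleDl v : {morph tens_scale^~ v : a b / a + b}.
Proof.
move=> a c; apply/tens_sumP=> T b.
rewrite !(fsum_cat, fsum_repr) !fsum_scale -big_split /=.
by apply: eq_bigr => p _; rewrite /= /mulb mulrDl linearDr.
Qed.

HB.instance Definition _ := GRing.Zmodule_isLmodule.Build R tens
  tens_scaleA tens_scale1 tens_scaleDr tens_scaleDl.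

End Tensor.

(* Change of the right-hand factor along f : v (x) r |-> v (x) f r.           *)
Definition tens_map (k : fieldType) (V : lmodType k) (R S : comAlgType k)
    (f : {lrmorphism R -> S}) (x : tens V R) : tens V S :=
  tens_sum [seq (p.1, f p.2) | p <- repr x].

Section TensMap.
Variables (k : fieldType) (V : lmodType k) (R S : comAlgType k).
Variable f : {lrmorphism R -> S}.

Definition mapb (T : lmodType k) (b : {bilinear V -> S -> T})
  (v : V) (x : R) : T := b v (f x).

Fact mapb_bilinear (T : lmodType k) (b : {bilinear V -> S -> T}) :
  bilinear_for *:%R *:%R (mapb b).
Proof.
by split=> [u a v w|v a u w] /=; rewrite /mapb ?linearPl // linearP linearPr.
Qed.

HB.instance Definition _ (T : lmodType k) (b : {bilinear V -> S -> T}) :=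
  bilinear_isBilinear.Build k V R T *:%R *:%R (mapb b) (mapb_bilinear b).

Lemma tens_map_sum s :
  tens_map f (tens_sum s : tens V R) = tens_sum [seq (p.1, f p.2) | p <- s].
Proof.
apply/tens_sumP=> T b; have /= := fsum_repr (mapb b : {bilinear V -> R -> T}) s.
by rewrite /fsum !big_map.
Qed.

End TensMap.

(* A finite subgroup scheme G of SL_n, presented by its coordinate ring and   *)
(* the point of SL_n(k[G]) corresponding to G -> SL_n, whose matrix entries   *)
(* are the images of the coordinate functions of SL_n.                        *)

Definition gpoint_of (k : fieldType) (n : nat) (H : comAlgType k) (g : 'M[H]_n)
    (R : comAlgType k) (A : 'M[R]_n) : Prop :=
  exists phi : {lrmorphism H -> R}, A = map_mx phi g.

Record finSubgroupSL (k : fieldType) (n : nat) := FinSubgroupSL {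
  coord_ring : comAlgType k;
  univ_point : 'M[coord_ring]_n;
  coord_ring_finite : exists s : seq coord_ring, forall h : coord_ring,
    exists c : 'I_(size s) -> k, h = \sum_(i < size s) c i *: s`_i;
  univ_point_det : \det univ_point = 1;
  (* k[SL_n] -> k[G] is surjective: G -> SL_n is a closed immersion. *)
  univ_point_gen : forall S : {pred coord_ring}, subalg_closed S ->
    (forall i j, univ_point i j \in S) -> forall h, h \in S;
  (* G(R) is a subgroup of SL_n(R); for a matrix of determinant 1 the inverse
     is the adjugate. *)
  gpoint_1 : forall R : comAlgType k, gpoint_of univ_point (1%:M : 'M[R]_n);
  gpoint_M : forall (R : comAlgType k) (A B : 'M[R]_n),
    gpoint_of univ_point A -> gpoint_of univ_point B ->
    gpoint_of univ_point (A *m B);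
  gpoint_V : forall (R : comAlgType k) (A : 'M[R]_n),
    gpoint_of univ_point A -> gpoint_of univ_point (\adj A)
}.

Definition gpoint (k : fieldType) (n : nat) (G : finSubgroupSL k n)
    (R : comAlgType k) (A : 'M[R]_n) : Prop :=
  gpoint_of (univ_point G) A.

(* A G-module: R-linear actions of G(R) on V (x)_k R, functorial in the       *)
(* k-algebra R.  The value of gact at a matrix outside G(R) is irrelevant.    *)
Record gmodule (k : fieldType) (n : nat) (G : finSubgroupSL k n)
    (V : lmodType k) := GModule {
  gact : forall R : comAlgType k, 'M[R]_n -> {linear tens V R -> tens V R};
  gact_1 : forall (R : comAlgType k) (x : tens V R), gact 1%:M x = x;
  gact_M : forall (R : comAlgType k) (A B : 'M[R]_n), gpoint G A ->
    gpoint G B -> forall x, gact (A *m B) x = gact A (gact B x);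
  gact_nat : forall (R S : comAlgType k) (f : {lrmorphism R -> S})
    (A : 'M[R]_n), gpoint G A ->
    forall x, gact (map_mx f A) (tens_map f x) = tens_map f (gact A x)
}.

(* The image of W (x)_k R in V (x)_k R.                                       *)
Definition tens_sub (k : fieldType) (V : lmodType k) (W : {pred V})
    (R : comAlgType k) (x : tens V R) : Prop :=
  exists2 s : seq (V * R), (forall p, p \in s -> p.1 \in W) & x = tens_sum s.

Definition gsubmodule (k : fieldType) (n : nat) (G : finSubgroupSL k n)
    (V : lmodType k) (M : gmodule G V) (W : {pred V}) : Prop :=
  submod_closed W /\
  forall (R : comAlgType k) (A : 'M[R]_n), gpoint G A ->
    forall x : tens V R, tens_sub W x -> tens_sub W (gact M A x).

Definition completely_reducible (k : fieldType) (n : nat)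
    (G : finSubgroupSL k n) (V : lmodType k) (M : gmodule G V) : Prop :=
  forall W : {pred V}, gsubmodule M W ->
  exists W' : {pred V}, [/\ gsubmodule M W',
    forall v, v \in W -> v \in W' -> v = 0
  & forall v, exists w w', [/\ w \in W, w' \in W' & v = w + w']].

Definition linearly_reductive (k : fieldType) (n : nat)
    (G : finSubgroupSL k n) : Prop :=
  forall (V : lmodType k) (M : gmodule G V), completely_reducible M.

Section Spec.
Variable B : comNzRingType.

Definition is_prime (P : {pred B}) : Prop :=
  idealr_closed P /\ prime_idealr_closed P.

(* U is the complement of the closed set V(E). *)
Definition spec_open (U : {pred B} -> Prop) : Prop :=
  exists E : {pred B}, forall P, is_prime P ->
    (U P <-> exists2 f, f \in E & f \notin P).

Definition height_ge (m : nat) (P : {pred B}) : Prop :=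
  exists c : nat -> {pred B}, [/\ forall i, (i <= m)%N -> is_prime (c i),
    forall i, (i < m)%N ->
      {subset c i <= c i.+1} /\ (exists2 f, f \in c i.+1 & f \notin c i)
  & c m =i P].

(* Codimension at least m for the complement of U. *)
Definition codim_compl_ge (m : nat) (U : {pred B} -> Prop) : Prop :=
  forall P, is_prime P -> ~ U P -> height_ge m P.

End Spec.

(* An action of G on X = Spec B, with G x X = Spec C, where act and pr are    *)
(* the comorphisms of (g, x) |-> gx and of (g, x) |-> x.                      *)
Section Small.
Variables (B C : comNzRingType) (act pr : {rmorphism B -> C}).

(* The ideal of C defining the stabilizer, i.e. the pull-back of
   G x X -> X x X, (g, x) |-> (gx, x), along the diagonal. *)
Definition stab_ideal (c : C) : Prop :=
  exists s : seq (C * B), c = \sum_(t <- s) t.1 * (act t.2 - pr t.2).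

(* The localization at P of B -> C / stab_ideal is bijective. *)
Definition stab_trivial_at (P : {pred B}) : Prop :=
  (forall c : C, exists b s : B,
     s \notin P /\ stab_ideal (pr s * c - pr b)) /\
  (forall b : B, stab_ideal (pr b) -> exists2 s, s \notin P & s * b = 0).

Definition free_on (U : {pred B} -> Prop) : Prop :=
  forall P, is_prime P -> U P -> stab_trivial_at P.

(* G x U is contained in the inverse image of U under the action. *)
Definition gstable (U : {pred B} -> Prop) : Prop :=
  forall Q : {pred C}, is_prime Q ->
    U [pred b | pr b \in Q] -> U [pred b | act b \in Q].

Definition small : Prop :=
  exists U : {pred B} -> Prop,
    [/\ spec_open U, gstable U, free_on U & codim_compl_ge 2 U].

End Small.

Record mseries (R : Type) (n : nat) :=
  MSeries { scoef : 'X_{1..n} -> R }.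

Section Series.
Variables (R : comNzRingType) (n : nat).
Implicit Types (f g h : mseries R n) (m : 'X_{1..n}).

Lemma mseriesP f g : scoef f =1 scoef g -> f = g.
Proof. by case: f g => f [g] /= /funext ->. Qed.

HB.instance Definition _ := gen_eqMixin (mseries R n).
HB.instance Definition _ := gen_choiceMixin (mseries R n).

Definition sadd f g := MSeries (fun m => scoef f m + scoef g m).
Definition sopp f := MSeries (fun m => - scoef f m).
Definition szero : mseries R n := MSeries (fun _ => 0).
Definition sone : mseries R n := MSeries (fun m => (m == 0%MM)%:R).
Definition smul f g := MSeries (fun m =>
  \sum_(p : 'X_{1..n < (mdeg m).+1, (mdeg m).+1} | m == (p.1 + p.2)%MM)
     scoef f p.1 * scoef g p.2).

Fact saddA : associative sadd.
Proof. by move=> f g h; apply: mseriesP => m /=; rewrite addrA. Qed.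
Fact saddC : commutative sadd.
Proof. by move=> f g; apply: mseriesP => m /=; rewrite addrC. Qed.
Fact sadd0 : left_id szero sadd.
Proof. by move=> f; apply: mseriesP => m /=; rewrite add0r. Qed.
Fact saddN : left_inverse szero sopp sadd.
Proof. by move=> f; apply: mseriesP => m /=; rewrite addNr. Qed.

HB.instance Definition _ :=
  GRing.isZmodule.Build (mseries R n) saddA saddC sadd0 saddN.

(* The terms of degree less than d. *)
Definition strunc d f : {mpoly R[n]} :=
  \sum_(m : 'X_{1..n < d}) scoef f m *: 'X_[m].

Lemma mcoeff_strunc d f m :
  (strunc d f)@_m = if (mdeg m < d)%N then scoef f m else 0.
Proof.
rewrite /strunc raddf_sum /=; case: ifP => [lt_md|/negbT ge_md].
  rewrite (bigD1 (BMultinom lt_md)) //= mcoeffZ mcoeffX eqxx mulr1 big1 ?addr0 //.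
  move=> i ne_i; rewrite mcoeffZ mcoeffX; case: eqP => [e|_]; last by rewrite mulr0.
  by case/eqP: ne_i; apply: val_inj.
rewrite big1 // => i _; rewrite mcoeffZ mcoeffX; case: eqP => [e|_].
  by move: (bmdeg i) ge_md; rewrite e => ->.
by rewrite mulr0.
Qed.

Lemma scoef_smul f g d m : (mdeg m < d)%N ->
  scoef (smul f g) m = (strunc d f * strunc d g)@_m.
Proof.
move=> lt_md; rewrite mcoeffM /=; apply: eq_bigr => -[p q] /= _.
by rewrite !mcoeff_strunc !(leq_trans (bmdeg _) lt_md).
Qed.

(* Congruence of polynomials modulo terms of degree at least d. *)
Definition eqtrunc d (p q : {mpoly R[n]}) :=
  forall m, (mdeg m < d)%N -> p@_m = q@_m.

Lemma eqtruncM d p p' q q' : eqtrunc d p p' -> eqtrunc d q q' ->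
  eqtrunc d (p * q) (p' * q').
Proof.
move=> ep eq m lt_md; rewrite !mcoeffM; apply: eq_bigr => -[a b] /= _.
by rewrite ep ?eq //; apply: leq_trans (bmdeg _) lt_md.
Qed.

Lemma strunc_smul d f g :
  eqtrunc d (strunc d (smul f g)) (strunc d f * strunc d g).
Proof.
by move=> m lt_md; rewrite mcoeff_strunc lt_md (scoef_smul f g lt_md).
Qed.

Fact smulA : associative smul.
Proof.
move=> f g h; apply: mseriesP => m; have lt_m := ltnSn (mdeg m).
rewrite !(scoef_smul _ _ lt_m).
rewrite (eqtruncM (fun _ _ => erefl) (strunc_smul g h) lt_m).
by rewrite mulrA (eqtruncM (strunc_smul f g) (fun _ _ => erefl) lt_m).
Qed.
Fact smulC : commutative smul.
Proof.
move=> f g; apply: mseriesP => m; have lt_m := ltnSn (mdeg m).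
by rewrite !(scoef_smul _ _ lt_m) mulrC.
Qed.
Fact smul1 : left_id sone smul.
Proof.
move=> f; apply: mseriesP => m; have lt_m := ltnSn (mdeg m).
have -> : scoef f m = (1 * strunc (mdeg m).+1 f)@_m.
  by rewrite mul1r mcoeff_strunc lt_m.
rewrite (scoef_smul _ _ lt_m); apply: eqtruncM lt_m => // i lt_i.
by rewrite mcoeff_strunc lt_i mcoeff1.
Qed.
Fact smulDl : left_distributive smul sadd.
Proof.
move=> f g h; apply: mseriesP => m /=; rewrite -big_split /=.
by apply: eq_bigr => p _; rewrite mulrDl.
Qed.
Fact sone_neq0 : sone != szero.
Proof.
apply/eqP => /(congr1 (fun f : mseries R n => scoef f 0%MM)) /eqP /=.
by rewrite eqxx oner_eq0.
Qed.

HB.instance Definition _ := GRing.Zmodule_isComNzRing.Build (mseries R n)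
  smulA smulC smul1 smulDl sone_neq0.

End Series.

Section SeriesMap.
Variables (R S : comNzRingType) (n : nat) (f : {rmorphism R -> S}).

Definition smap (u : mseries R n) : mseries S n :=
  MSeries (fun m => f (scoef u m)).

Fact smap_zmod_morphism : zmod_morphism smap.
Proof. by move=> u v; apply: mseriesP => m /=; rewrite rmorphB. Qed.
Fact smap_monoid_morphism : monoid_morphism smap.
Proof.
split=> [|u v]; apply: mseriesP => m /=; first by rewrite rmorph_nat.
by rewrite rmorph_sum; apply: eq_bigr => p _; rewrite rmorphM.
Qed.

HB.instance Definition _ := GRing.isZmodMorphism.Build
  (mseries R n) (mseries S n) smap smap_zmod_morphism.
HB.instance Definition _ := GRing.isMonoidMorphism.Build
  (mseries R n) (mseries S n) smap smap_monoid_morphism.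

End SeriesMap.

(* The linear substitution x |-> A x in polynomials and in power series.      *)

Section LinearSubst.
Variables (R : comNzRingType) (n : nat) (A : 'M[R]_n).

Definition lin_forms : n.-tuple {mpoly R[n]} :=
  [tuple \sum_(j < n) A i j *: 'X_j | i < n].

Definition lin_subst : {mpoly R[n]} -> {mpoly R[n]} := comp_mpoly lin_forms.

HB.instance Definition _ := GRing.RMorphism.copy lin_subst (comp_mpoly lin_forms).

(* The substitution being homogeneous, the coefficient at m of the result
   depends only on the terms of u of degree at most mdeg m. *)
Definition slin_subst (u : mseries R n) : mseries R n :=
  MSeries (fun m => (lin_subst (strunc (mdeg m).+1 u))@_m).

Lemma lin_subst_dhomog m : lin_subst 'X_[m] \is (mdeg m).-homog.
Proof.
rewrite /lin_subst comp_mpolyX mdegE.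
elim/big_rec2: _ => [|i d p _ hp]; first exact: dhomog1.
apply: dhomogM => //; rewrite -[X in X.-homog]mul1n; apply: dhomogMn.
rewrite tnth_mktuple; apply: rpred_sum => j _; apply: rpredZ.
by rewrite dhomogX /= mdeg1.
Qed.

Lemma eqtrunc_lin_subst d p q :
  eqtrunc d p q -> eqtrunc d (lin_subst p) (lin_subst q).
Proof.
move=> epq m lt_md; apply/eqP; rewrite -subr_eq0 -mcoeffB -rmorphB /=; apply/eqP.
rewrite [p - q]mpolyE rmorph_sum raddf_sum big_seq big1 // => i.
rewrite mcoeff_msupp => nz_i; rewrite /= /lin_subst comp_mpolyZ mcoeffZ.
have [lt_id|ge_id] := ltnP (mdeg i) d.
  by case/eqP: nz_i; rewrite mcoeffB epq ?subrr.
rewrite (dhomog_nemf_coeff (lin_subst_dhomog i)) ?mulr0 //=.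
by rewrite neq_ltn (leq_trans lt_md ge_id).
Qed.

Lemma strunc_slin_subst d u :
  eqtrunc d (strunc d (slin_subst u)) (lin_subst (strunc d u)).
Proof.
move=> m lt_md; rewrite mcoeff_strunc lt_md /=.
apply: (@eqtrunc_lin_subst (mdeg m).+1) => // i lt_i.
by rewrite !mcoeff_strunc lt_i (leq_trans lt_i lt_md).
Qed.

Fact slin_subst_zmod_morphism : zmod_morphism slin_subst.
Proof.
move=> u v; apply: mseriesP => m /=; rewrite -mcoeffB -rmorphB /=.
congr (lin_subst _)@_m; apply/mpolyP => i.
by rewrite mcoeffB !mcoeff_strunc /=; case: ifP => _ //; rewrite subr0.
Qed.
Fact slin_subst_monoid_morphism : monoid_morphism slin_subst.
Proof.
split=> [|u v]; apply: mseriesP => m; have lt_m := ltnSn (mdeg m).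
  rewrite /= -mcoeff1 -(rmorph1 lin_subst).
  apply: (eqtrunc_lin_subst _ lt_m) => i lt_i.
  by rewrite mcoeff_strunc lt_i mcoeff1.
rewrite (scoef_smul _ _ lt_m) /=.
rewrite (eqtruncM (strunc_slin_subst u) (strunc_slin_subst v) lt_m) -rmorphM /=.
exact: eqtrunc_lin_subst (strunc_smul u v) _ lt_m.
Qed.

HB.instance Definition _ := GRing.isZmodMorphism.Build
  (mseries R n) (mseries R n) slin_subst slin_subst_zmod_morphism.
HB.instance Definition _ := GRing.isMonoidMorphism.Build
  (mseries R n) (mseries R n) slin_subst slin_subst_monoid_morphism.

End LinearSubst.

(* The canonical actions: G x X has coordinate ring k[G][x_1,...,x_n], resp.  *)
(* k[G][[x_1,...,x_n]] (as k[G] is finite over k, this is the tensor product  *)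
(* of k[G] and k[[x_1,...,x_n]]), and f |-> f(gx), g the universal point.     *)

Section CanonicalAction.
Variables (k : fieldType) (n : nat) (G : finSubgroupSL k n).
Local Notation kG := (coord_ring G).

Definition poly_pr : {rmorphism {mpoly k[n]} -> {mpoly kG[n]}} :=
  map_mpoly (in_alg kG).
Definition poly_act : {rmorphism {mpoly k[n]} -> {mpoly kG[n]}} :=
  lin_subst (univ_point G) \o map_mpoly (in_alg kG).

Definition series_pr : {rmorphism mseries k n -> mseries kG n} :=
  smap (in_alg kG).
Definition series_act : {rmorphism mseries k n -> mseries kG n} :=
  slin_subst (univ_point G) \o smap (in_alg kG).

Lemma poly_actX i :
  poly_act 'X_i = \sum_(j < n) univ_point G i j *: 'X_j.
Proof.
by rewrite /= map_mpolyX /lin_subst comp_mpolyXU -tnth_nth tnth_mktuple.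
Qed.

Definition small_on_polynomials : Prop := small poly_act poly_pr.
Definition small_on_series : Prop := small series_act series_pr.

End CanonicalAction.

(* Main.v *)
(* A linearly reductive G carries an invariant integral on k[G].  Pairing it
   with polynomial functions shows that, over any field extension, neither a
   point of G nor an element of its Lie algebra can act by a nontrivial Jordan
   block, and that the Lie algebra is commutative and diagonalizable over an
   algebraic extension.
   Suppose that the stabilizer of a point xi is not trivial.  Over an extension
   it contains either a point h <> 1 or a tangent vector lam <> 0.  The rows of
   h - 1, or eigenforms for the Lie algebra with nonzero eigenvalue, are linear
   forms with algebraic coefficients that vanish at xi.  If they were all
   proportional, then det h = 1, or trace lam = 0, would make h unipotent, or
   lam nilpotent, which has just been excluded.  So two independent forms l1
   and l2 with algebraic coefficients vanish at xi.
   Such points have codimension at least 2: if T is a linear projection onto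
   the hyperplane l1 = 0, then 0, the kernel of f |-> f(Tx) and the prime of xi
   form a chain, whose strictness is witnessed by norms of l1 and l2.
   The points with trivial stabilizer form an open set by Nakayama's lemma. *)

From HB Require Import structures.
Require Import Defs.
From mathcomp Require Import all_boot all_order all_algebra.
From mathcomp Require Import perm sesquilinear boolp ring_quotient fieldext.
From mathcomp Require Import ssrcomplements mpoly ring.

Set Implicit Arguments.
Unset Strict Implicit.
Unset Printing Implicit Defensive.

Import GRing.Theory.

Local Open Scope ring_scope.

(** * Coordinates in finite bases *)

(** The residue field of a prime may be transcendental over [k], and over it many forms vanish at
    the point; only forms with coefficients algebraic over [k] bound the codimension. Hence a finite
    extension [K] of [k] is kept apart from the large field [F] throughout. Why Jordan blocks are
    impossible: let [e'] be the eigenvector of the block and [X] the generic matrix. Every monomial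
    of positive degree in the coordinates of [X e'] is a derivative, or the difference of a
    polynomial and its translate, so its integral is 0. But [X e'] vanishes nowhere on [G], so some
    polynomial in these coordinates with constant term 1 vanishes on [G], against [int 1 = 1].
    Stabilizers may be nonreduced, so they are studied through functionals on their algebra: a plane
    of functionals that contains the counit and is stable under [k[G]] yields the point or the
    tangent vector. Polynomials and power series are treated together through [linear_action]; for
    power series, its essential clause is that [f(gx) - f(x)] is a combination of the differences
    [(gx)_i - x_i]. *)

Record kbasis (k : fieldType) (V : lmodType k) := KBasis {
  bdim : nat;
  bvec : 'I_bdim -> V;
  bco : V -> 'I_bdim -> k;
  bcoP : forall v, v = \sum_l bco v l *: bvec l;
  bcoK : forall c l, bco (\sum_j c j *: bvec j) l = c l }.

Arguments bvec {k V} k0 l : rename.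
Arguments bco {k V} k0 v l : rename.
Arguments bcoP {k V} k0 v : rename.
Arguments bcoK {k V} k0 c l : rename.

Section KBasis.
Variables (k : fieldType) (V : lmodType k).

(** A spanning family with the least number of members is free: a nontrivial relation would express
    one member through the others. *)
Lemma free_family_exists (s : seq V) : exists m (y : 'I_m -> V),
  (forall c : 'I_m -> k, \sum_i c i *: y i = 0 -> forall i, c i = 0) /\
  (forall v, v \in s -> exists c : 'I_m -> k, v = \sum_i c i *: y i).
Proof.
pose spans m := `[< exists y : 'I_m -> V,
  forall v, v \in s -> exists c : 'I_m -> k, v = \sum_i c i *: y i >].
have ex_span : exists m, spans m.
  exists (size s); apply/asboolP; exists (fun i => s`_i) => v /nthP-/(_ 0)[i lt_i <-].
  exists (fun j => (j == Ordinal lt_i)%:R); rewrite (bigD1 (Ordinal lt_i)) //=.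
  by rewrite eqxx scale1r big1 ?addr0 // => j /negPf->; rewrite scale0r.
case: (ex_minnP ex_span) => m /asboolP[y span_y] min_m.
exists m, y; split=> // c c0.
case: m y span_y min_m c c0 => [|m] y span_y min_m c c0; first by case.
move=> i; apply/eqP/contraT => nz_ci.
suff /min_m : spans m by rewrite ltnn.
apply/asboolP; exists (fun j => y (lift i j)) => v /span_y[d ->].
have yi : y i = \sum_j (- (c i)^-1 * c (lift i j)) *: y (lift i j).
  apply: (scalerI nz_ci); rewrite scaler_sumr.
  move: c0; rewrite (bigD1_ord i) //= => /eqP; rewrite addr_eq0 => /eqP ->.
  rewrite -sumrN; apply: eq_bigr => j _.
  by rewrite scalerA mulNr mulrN mulrA divff // mul1r scaleNr.
exists (fun j => d (lift i j) + d i * (- (c i)^-1 * c (lift i j))).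
rewrite (bigD1_ord i) //= yi scaler_sumr -big_split /=.
by apply: eq_bigr => j _; rewrite scalerA addrC scalerDl.
Qed.

Lemma kbasis_exists (s : seq V) :
  (forall v, exists c : 'I_(size s) -> k, v = \sum_(i < size s) c i *: s`_i) ->
  inhabited (kbasis V).
Proof.
move=> span_s; have [m [y [free_y span_y]]] := free_family_exists s.
have {span_s} span_y' v : exists c : 'I_m -> k, v = \sum_i c i *: y i.
  have [c ->] := span_s v.
  have /choice[d dE] : forall i : 'I_(size s),
      exists d : 'I_m -> k, s`_i = \sum_j d j *: y j.
    by move=> i; apply: span_y; rewrite mem_nth.
  exists (fun j => \sum_i c i * d i j).
  under [RHS]eq_bigr do rewrite scaler_suml.
  rewrite exchange_big; apply: eq_bigr => i _ /=; rewrite dE scaler_sumr.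
  by apply: eq_bigr => j _; rewrite scalerA.
have [co coP] := choice span_y'.
constructor; apply: (@KBasis _ _ m y co coP) => c l.
have := coP (\sum_j c j *: y j).
move/eqP; rewrite eq_sym -subr_eq0 -sumrB => /eqP eq0.
apply/eqP; rewrite -subr_eq0; apply/eqP.
apply: (free_y (fun l => co (\sum_j c j *: y j) l - c l)) => {l}.
by rewrite -{}[RHS]eq0; apply: eq_bigr => l _; rewrite scalerBl.
Qed.

Variable b : kbasis V.

Lemma bco_uniq v c : v = \sum_j c j *: bvec b j -> bco b v =1 c.
Proof. by move=> -> l; rewrite bcoK. Qed.

Lemma bcoD u v l : bco b (u + v) l = bco b u l + bco b v l.
Proof.
apply: (@bco_uniq _ (fun l => bco b u l + bco b v l)).
rewrite {1}[u](bcoP b) {1}[v](bcoP b) -big_split /=.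
by apply: eq_bigr => j _; rewrite scalerDl.
Qed.

Lemma bcoZ a v l : bco b (a *: v) l = a * bco b v l.
Proof.
apply: (@bco_uniq _ (fun l => a * bco b v l)).
by rewrite {1}[v](bcoP b) scaler_sumr; apply: eq_bigr => j _; rewrite scalerA.
Qed.

End KBasis.

(** * Tensor products of algebras *)

Section TensLift.
Variables (k : fieldType) (V : lmodType k) (R : comAlgType k) (T : lmodType k).

Definition bilin_fun (b : V -> R -> T) of bilinear_for *:%R *:%R b := b.

HB.instance Definition _ b (hb : bilinear_for *:%R *:%R b) :=
  bilinear_isBilinear.Build k V R T *:%R *:%R (bilin_fun hb) hb.

Definition tens_lift b (hb : bilinear_for *:%R *:%R b) (x : tens V R) : T :=
  fsum (bilin_fun hb) (repr x).

Lemma tens_lift_pure b (hb : bilinear_for *:%R *:%R b) v r :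
  tens_lift hb (tens_pure v r) = b v r.
Proof. by rewrite /tens_lift fsum_repr /fsum big_seq1. Qed.

Fact tens_lift_zmod_morphism b (hb : bilinear_for *:%R *:%R b) :
  zmod_morphism (tens_lift hb).
Proof.
move=> x y; rewrite /tens_lift /GRing.add /GRing.opp /= /tens_add /tens_opp.
by rewrite fsum_repr fsum_cat fsum_repr fsum_opp.
Qed.

HB.instance Definition _ b (hb : bilinear_for *:%R *:%R b) :=
  GRing.isZmodMorphism.Build (tens V R) T (tens_lift hb)
    (tens_lift_zmod_morphism hb).

End TensLift.

Section TensTheory.
Variables (k : fieldType) (V : lmodType k) (R : comAlgType k).
Implicit Types (u v : V) (r s : R) (x y : tens V R).

Lemma tens_pureP (P : tens V R -> Prop) :
  P 0 -> (forall x y, P x -> P y -> P (x + y)) ->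
  (forall v r, P (tens_pure v r)) -> forall x, P x.
Proof.
move=> P0 PD Pp x; rewrite -(tens_reprK x); elim: (repr x) => [//|[v r] s IH].
suff -> : tens_sum ((v, r) :: s) = tens_pure v r + tens_sum s :> tens V R.
  exact: PD.
apply/tens_sumP=> T b; rewrite fsum_cat !fsum_repr /fsum big_cons big_seq1.
by [].
Qed.

Lemma tens_pureZ r v s : r *: tens_pure v s = tens_pure v (r * s) :> tens V R.
Proof.
apply/tens_sumP=> T b; rewrite fsum_scale fsum_repr.
by rewrite /fsum !big_seq1.
Qed.

Lemma tens_pureDl u v r :
  tens_pure (u + v) r = tens_pure u r + tens_pure v r :> tens V R.
Proof.
apply/tens_sumP=> T b; rewrite fsum_cat !fsum_repr /fsum !big_seq1 /=.
by rewrite linearDl.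
Qed.

Lemma tens_pureDr v r s :
  tens_pure v (r + s) = tens_pure v r + tens_pure v s :> tens V R.
Proof.
apply/tens_sumP=> T b; rewrite fsum_cat !fsum_repr /fsum !big_seq1 /=.
by rewrite linearDr.
Qed.

Lemma tens_pureZl a v r :
  tens_pure (a *: v) r = tens_pure v (a *: r) :> tens V R.
Proof.
apply/tens_sumP=> T b; rewrite /fsum !big_seq1 /=.
by rewrite linearZl_LR linearZr_LR.
Qed.

(* [tens V R] as a vector space over k, its canonical scalars being R.        *)
Definition ktens := tens V R.
HB.instance Definition _ := GRing.Zmodule.on ktens.

Definition kscale (a : k) (x : ktens) : ktens := (a%:A : R) *: (x : tens V R).

Fact kscaleA a b (x : ktens) : kscale a (kscale b x) = kscale (a * b) x.
Proof. by rewrite /kscale scalerA -in_algE -rmorphM. Qed.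
Fact kscale1 : left_id 1 kscale.
Proof. by move=> x; rewrite /kscale !scale1r. Qed.
Fact kscaleDr : right_distributive kscale +%R.
Proof. by move=> a x y; rewrite /kscale scalerDr. Qed.
Fact kscaleDl (x : ktens) : {morph kscale^~ x : a b / a + b}.
Proof. by move=> a b; rewrite /kscale -scalerDl -!in_algE -rmorphD. Qed.
HB.instance Definition _ := GRing.Zmodule_isLmodule.Build k ktens
  kscaleA kscale1 kscaleDr kscaleDl.

Lemma kscaleE a (x : ktens) : a *: x = (a%:A : R) *: (x : tens V R).
Proof. by []. Qed.

Fact tens_pure_bilinear :
  bilinear_for *:%R *:%R (fun v r => tens_pure v r : ktens).
Proof.
split=> [r a u w|v a r w] /=.
  by rewrite [LHS]tens_pureDl kscaleE tens_pureZ tens_pureZl mulr_algl.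
by rewrite [LHS]tens_pureDr kscaleE tens_pureZ mulr_algl.
Qed.

End TensTheory.

Section TensAlgebra.
Variables (k : fieldType) (V R : comAlgType k).
Local Notation T := (ktens V R).

Fact tens_mulr_bilinear v r : bilinear_for *:%R *:%R
  (fun u s => tens_pure (u * v) (s * r) : T).
Proof.
have [hl hr] := @tens_pure_bilinear k V R.
split=> [s a u w|u a s w]; rewrite mulrDl -scalerAl.
  exact: (hl (s * r) a (u * v) (w * v)).
exact: (hr (u * v) a (s * r) (w * r)).
Qed.

Definition tens_mulp v r : tens V R -> T := tens_lift (tens_mulr_bilinear v r).

Fact tens_mul_bilinear (x : tens V R) : bilinear_for *:%R *:%R
  (fun v r => tens_mulp v r x : T).
Proof.
have [hl hr] := @tens_pure_bilinear k V R.
rewrite /tens_mulp; split=> [r a u w|u a s w] /=;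
  elim/tens_pureP: x => [|x y IHx IHy|v t].
- by rewrite !raddf0 addr0.
- by rewrite !raddfD /= IHx IHy addrACA.
- by rewrite !tens_lift_pure mulrDr -scalerAr; apply: (hl (t * r)).
- by rewrite !raddf0 addr0.
- by rewrite !raddfD /= IHx IHy addrACA.
- by rewrite !tens_lift_pure mulrDr -scalerAr; apply: (hr (v * u)).
Qed.

Definition tens_mul (x y : T) : T := tens_lift (tens_mul_bilinear x) y.
Definition tens_one : T := tens_pure 1 1.

Lemma tens_mul_pure v r u s :
  tens_mul (tens_pure v r) (tens_pure u s) = tens_pure (v * u) (r * s).
Proof. by rewrite /tens_mul tens_lift_pure /tens_mulp tens_lift_pure. Qed.

Lemma tens_mulDr x y z : tens_mul x (y + z) = tens_mul x y + tens_mul x z.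
Proof. exact: raddfD. Qed.

Fact tens_mulDl : left_distributive tens_mul +%R.
Proof.
move=> x y z; elim/tens_pureP: z => [|z t IHz IHt|v r].
- by rewrite /tens_mul !raddf0 addr0.
- by rewrite !tens_mulDr IHz IHt addrACA.
- by rewrite /tens_mul !tens_lift_pure /tens_mulp raddfD.
Qed.

Lemma tens_mul0r x : tens_mul x 0 = 0.
Proof. exact: raddf0. Qed.

Lemma tens_mul0l x : tens_mul 0 x = 0.
Proof. by apply: (addIr (tens_mul 0 x)); rewrite -tens_mulDl !add0r. Qed.

Fact tens_mulC : commutative tens_mul.
Proof.
move=> x y; elim/tens_pureP: x => [|x z IHx IHz|v r].
- by rewrite tens_mul0l tens_mul0r.
- by rewrite tens_mulDl tens_mulDr IHx IHz.
elim/tens_pureP: y => [|y z IHy IHz|u s].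
- by rewrite tens_mul0l tens_mul0r.
- by rewrite tens_mulDl tens_mulDr IHy IHz.
by rewrite !tens_mul_pure mulrC [r * s]mulrC.
Qed.

Fact tens_mulA : associative tens_mul.
Proof.
move=> x y z; elim/tens_pureP: x => [|x t IHx IHt|v r].
- by rewrite !tens_mul0l.
- by rewrite !tens_mulDl IHx IHt.
elim/tens_pureP: y => [|y t IHy IHt|u s].
- by rewrite tens_mul0l !tens_mul0r tens_mul0l.
- by rewrite !(tens_mulDl, tens_mulDr) IHy IHt.
elim/tens_pureP: z => [|z t IHz IHt|w t].
- by rewrite !tens_mul0r.
- by rewrite !tens_mulDr IHz IHt.
by rewrite !tens_mul_pure !mulrA.
Qed.

Fact tens_mul1 : left_id tens_one tens_mul.
Proof.
move=> x; elim/tens_pureP: x => [|x t IHx IHt|v r].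
- by rewrite !tens_mul0r.
- by rewrite !tens_mulDr IHx IHt.
by rewrite tens_mul_pure !mul1r.
Qed.

Variable e : {linear V -> k^o}.
Hypothesis e1 : e 1 = 1.

Fact tens_one_neq0 : tens_one != 0.
Proof.
pose b (v : V) (r : R) := (e v : k) *: r.
have hb : bilinear_for *:%R *:%R b.
  split=> [s a u w|u a s w]; rewrite /b.
    by rewrite linearP /= scalerDl scalerA.
  by rewrite scalerDr scalerA mulrC -scalerA.
apply/eqP=> /(congr1 (tens_lift hb)); rewrite raddf0 tens_lift_pure /b e1 scale1r.
exact/eqP/oner_neq0.
Qed.

(** The form [e] is what proves [1 != 0], as the ring structure demands; its normalization is an
    argument of the type so that the instances can find it. For [k[G]] it is the counit. *)
Definition tensalg of e 1 = 1 := ktens V R.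
Local Notation TA := (tensalg e1).

HB.instance Definition _ := GRing.Lmodule.on TA.
HB.instance Definition _ := GRing.Zmodule_isComNzRing.Build TA
  tens_mulA tens_mulC tens_mul1 tens_mulDl tens_one_neq0.

Fact tensalg_scaleAl (a : k) (x y : TA) : a *: (x * y) = (a *: x) * y.
Proof.
rewrite /GRing.mul /=; elim/tens_pureP: y => [|y t IHy IHt|w t].
- by rewrite !tens_mul0r scaler0.
- by rewrite !tens_mulDr scalerDr IHy IHt.
elim/tens_pureP: x => [|y s IHy IHs|v r].
- by rewrite tens_mul0l scaler0 tens_mul0l.
- by rewrite tens_mulDl !scalerDr tens_mulDl IHy IHs.
rewrite tens_mul_pure !kscaleE /= tens_pureZ.
by rewrite [LHS]tens_pureZ tens_mul_pure mulrA.
Qed.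

HB.instance Definition _ := GRing.Lmodule_isLalgebra.Build k TA tensalg_scaleAl.
HB.instance Definition _ := GRing.Lalgebra_isComAlgebra.Build k TA.

Lemma tensalgM v r u s :
  (tens_pure v r : TA) * tens_pure u s = tens_pure (v * u) (r * s).
Proof. exact: tens_mul_pure. Qed.

Definition tens_inl (v : V) : TA := tens_pure v 1.
Definition tens_inr (r : R) : TA := tens_pure 1 r.

Fact tens_inl_zmod : zmod_morphism tens_inl.
Proof.
move=> u v; apply: (addIr (tens_inl v)).
by rewrite subrK /tens_inl -[LHS]tens_pureDl subrK.
Qed.
Fact tens_inl_monoid : monoid_morphism tens_inl.
Proof. by split=> // u v; rewrite tensalgM mulr1. Qed.
Fact tens_inl_scalable : scalable tens_inl.
Proof.
by move=> a v; rewrite /tens_inl kscaleE tens_pureZ tens_pureZl mulr1.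
Qed.
HB.instance Definition _ :=
  GRing.isZmodMorphism.Build V TA tens_inl tens_inl_zmod.
HB.instance Definition _ :=
  GRing.isMonoidMorphism.Build V TA tens_inl tens_inl_monoid.
HB.instance Definition _ :=
  GRing.isScalable.Build k V TA *:%R tens_inl tens_inl_scalable.

Fact tens_inr_zmod : zmod_morphism tens_inr.
Proof.
move=> u v; apply: (addIr (tens_inr v)).
by rewrite subrK /tens_inr -[LHS]tens_pureDr subrK.
Qed.
Fact tens_inr_monoid : monoid_morphism tens_inr.
Proof. by split=> // u v; rewrite tensalgM mulr1. Qed.
Fact tens_inr_scalable : scalable tens_inr.
Proof. by move=> a v; rewrite /tens_inr kscaleE tens_pureZ mulr_algl. Qed.
HB.instance Definition _ :=
  GRing.isZmodMorphism.Build R TA tens_inr tens_inr_zmod.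
HB.instance Definition _ :=
  GRing.isMonoidMorphism.Build R TA tens_inr tens_inr_monoid.
HB.instance Definition _ :=
  GRing.isScalable.Build k R TA *:%R tens_inr tens_inr_scalable.

Lemma tens_inlr v r : (tens_pure v r : TA) = tens_inl v * tens_inr r.
Proof. by rewrite tensalgM mulr1 mul1r. Qed.

End TensAlgebra.

(** Linearity along [iota], for targets such as residue fields that carry no declared [k]-algebra
    structure. *)
Definition klin (k : fieldType) (V : lmodType k) (S : comNzRingType)
    (iota : {rmorphism k -> S}) (f : V -> S) : Prop :=
  forall a u v, f (a *: u + v) = iota a * f u + f v.

Section Klin.
Variables (k : fieldType) (V : lmodType k) (S : comNzRingType).
Variables (iota : {rmorphism k -> S}) (f : V -> S).
Hypothesis klin_f : klin iota f.

Lemma klin0 : f 0 = 0.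
Proof.
have := klin_f 1 0 0; rewrite scale1r addr0 rmorph1 mul1r.
by move/(congr1 (+%R^~ (- f 0))); rewrite subrr addrK => <-.
Qed.

Lemma klinD u v : f (u + v) = f u + f v.
Proof. by rewrite -[u in LHS]scale1r klin_f rmorph1 mul1r. Qed.

Lemma klinZ a v : f (a *: v) = iota a * f v.
Proof. by rewrite -[_ *: _]addr0 klin_f klin0 addr0. Qed.

Lemma klin_sum I (r : seq I) (P : pred I) (F : I -> V) :
  f (\sum_(i <- r | P i) F i) = \sum_(i <- r | P i) f (F i).
Proof. exact: (big_morph f klinD klin0). Qed.

End Klin.

Lemma klin_rmorph (k : fieldType) (A : comAlgType k) (S : comNzRingType)
    (iota : {rmorphism k -> S}) (f : {rmorphism A -> S}) :
  (forall c, f c%:A = iota c) -> klin iota f.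
Proof. by move=> fE a u v; rewrite rmorphD -mulr_algl rmorphM fE. Qed.

Definition via (k : fieldType) (S : comNzRingType) of {rmorphism k -> S} : Type :=
  S.

Section Via.
Variables (k : fieldType) (S : comNzRingType) (iota : {rmorphism k -> S}).
Local Notation VS := (via iota).
HB.instance Definition _ := GRing.Zmodule.on VS.
Definition via_scale (a : k) (x : VS) : VS := (iota a : S) * (x : S).
Fact via_scaleA a b x : via_scale a (via_scale b x) = via_scale (a * b) x.
Proof. by rewrite /via_scale rmorphM mulrA. Qed.
Fact via_scale1 : left_id 1 via_scale.
Proof. by move=> x; rewrite /via_scale rmorph1 mul1r. Qed.
Fact via_scaleDr : right_distributive via_scale +%R.
Proof. by move=> a x y; apply: mulrDr. Qed.
Fact via_scaleDl x : {morph via_scale^~ x : a b / a + b}.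
Proof. by move=> a b; rewrite /via_scale rmorphD; apply: mulrDl. Qed.
HB.instance Definition _ := GRing.Zmodule_isLmodule.Build k VS
  via_scaleA via_scale1 via_scaleDr via_scaleDl.
End Via.

Section TensPair.
Variables (k : fieldType) (V : lmodType k) (R : comAlgType k).
Variables (S : comNzRingType) (iota : {rmorphism k -> S}).
Variables (f : V -> S) (h : R -> S).
Hypotheses (klin_f : klin iota f) (klin_h : klin iota h).

Fact tens_pair_bilinear :
  bilinear_for *:%R *:%R (fun v r => f v * h r : via iota).
Proof.
split=> [r a u w|v a r w] /=.
  by rewrite klin_f mulrDl -mulrA.
by rewrite klin_h mulrDr mulrCA.
Qed.

Definition tens_pair (x : tens V R) : S := tens_lift tens_pair_bilinear x.

Lemma tens_pair_pure v r : tens_pair (tens_pure v r) = f v * h r.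
Proof. by rewrite /tens_pair tens_lift_pure. Qed.

Fact tens_pair_zmod : zmod_morphism tens_pair.
Proof. by move=> x y; rewrite /tens_pair raddfB. Qed.
HB.instance Definition _ :=
  GRing.isZmodMorphism.Build (tens V R) S tens_pair tens_pair_zmod.

End TensPair.

Section TensHom.
Variables (k : fieldType) (V R : comAlgType k).
Variables (e : {linear V -> k^o}) (e1 : e 1 = 1).
Variables (S : comNzRingType) (iota : {rmorphism k -> S}).
Variables (f : {rmorphism V -> S}) (h : {rmorphism R -> S}).
Hypotheses (fE : forall c, f c%:A = iota c) (hE : forall c, h c%:A = iota c).

Definition tens_hom : tensalg R e1 -> S :=
  tens_pair (klin_rmorph fE) (klin_rmorph hE).

Lemma tens_hom_pure v r : tens_hom (tens_pure v r) = f v * h r.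
Proof. exact: tens_pair_pure. Qed.

Fact tens_hom_zmod : zmod_morphism tens_hom.
Proof. by move=> x y; apply: (raddfB (tens_pair _ _)). Qed.
HB.instance Definition _ :=
  GRing.isZmodMorphism.Build (tensalg R e1) S tens_hom tens_hom_zmod.

Fact tens_hom_monoid : monoid_morphism tens_hom.
Proof.
split=> [|x y]; first by rewrite tens_hom_pure !rmorph1 mulr1.
elim/tens_pureP: y => [|y t IHy IHt|w t].
- by rewrite mulr0 !raddf0 mulr0.
- by rewrite mulrDr !raddfD /= IHy IHt mulrDr.
elim/tens_pureP: x => [|y s IHy IHs|v r].
- by rewrite mul0r !raddf0 mul0r.
- by rewrite mulrDl !raddfD /= IHy IHs mulrDl.
by rewrite tensalgM !tens_hom_pure !rmorphM mulrACA.
Qed.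
HB.instance Definition _ :=
  GRing.isMonoidMorphism.Build (tensalg R e1) S tens_hom tens_hom_monoid.

End TensHom.

Lemma tens_sumE (k : fieldType) (V : lmodType k) (R : comAlgType k) s :
  tens_sum s = \sum_(p <- s) tens_pure p.1 p.2 :> tens V R.
Proof.
elim: s => [|[v r] s IH]; first by rewrite big_nil.
rewrite big_cons -IH; apply/tens_sumP=> T b.
by rewrite fsum_cat !fsum_repr /fsum big_cons big_seq1.
Qed.

(** * The right regular representation of G on k[G] *)

Section FinSubgroup.
Variables (k : fieldType) (n : nat) (G : finSubgroupSL k n).
Local Notation A := (coord_ring G).
Local Notation g := (univ_point G).

Lemma coord_hom_eq (S : nzRingType) (f f' : {rmorphism A -> S}) :
  (forall c : k, f c%:A = f' c%:A) -> map_mx f g = map_mx f' g -> f =1 f'.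
Proof.
move=> fc fg a; apply/eqP.
apply: (@univ_point_gen k n G [pred a | f a == f' a]) => [|i j]; last first.
  by have /matrixP/(_ i j) := fg; rewrite !mxE inE => ->.
split=> [|c u v|u v]; rewrite !inE ?rmorph1 // => /eqP eu /eqP ev.
  by rewrite -mulr_algl !rmorphD !rmorphM eu ev fc.
by rewrite !rmorphM eu ev.
Qed.

Lemma gpoint_univ : gpoint G g.
Proof. by exists idfun; apply/matrixP=> i j; rewrite mxE. Qed.

Lemma gpoint_map (R S : comAlgType k) (f : {lrmorphism R -> S}) (B : 'M[R]_n) :
  gpoint G B -> gpoint G (map_mx f B).
Proof.
by move=> [phi ->]; exists (f \o phi); apply/matrixP=> i j; rewrite !mxE.
Qed.

Fact counit_subproof :
  exists phi : {lrmorphism A -> k^o}, 1%:M = map_mx phi g.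
Proof. exact: (gpoint_1 G k^o). Qed.

Definition counit : {lrmorphism A -> k^o} := projT1 (cid counit_subproof).

Lemma map_counit : map_mx counit g = 1%:M.
Proof. by rewrite -(projT2 (cid counit_subproof)). Qed.

Lemma counit1 : counit 1 = 1. Proof. exact: rmorph1. Qed.

Lemma counitZ c : counit c%:A = c :> k.
Proof. by rewrite linearZ /= counit1 /GRing.scale /= mulr1. Qed.

Local Notation TA R := (tensalg R counit1).

Section Coaction.
Variable R : comAlgType k.
Local Notation inl := (@tens_inl k A R counit counit1).
Local Notation inr := (@tens_inr k A R counit counit1).

Lemma coact_subproof (B : 'M[R]_n) : gpoint G B ->
  exists psi : {lrmorphism A -> TA R},
    map_mx inl g *m map_mx inr B = map_mx psi g.
Proof.
move=> GB; apply: (gpoint_M (gpoint_map inl gpoint_univ) (gpoint_map inr GB)).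
Qed.

(** The comorphism of right translation by [B], obtained from the point [g B] of [G] over [k[G] (x)
    R]. Outside [G(R)] the default [inl] keeps it total, since [gmodule] wants a linear map for
    every matrix. *)
Definition coact (B : 'M[R]_n) : {lrmorphism A -> TA R} :=
  if pselect (gpoint G B) is left GB then projT1 (cid (coact_subproof GB))
  else inl.

Lemma map_coact (B : 'M[R]_n) : gpoint G B ->
  map_mx (coact B) g = map_mx inl g *m map_mx inr B.
Proof.
rewrite /coact => GB; case: pselect => // GB'.
by rewrite -(projT2 (cid (coact_subproof GB'))).
Qed.

Lemma coact_entry (B : 'M[R]_n) : gpoint G B -> forall i j,
  coact B (g i j) = \sum_l inl (g i l) * inr (B l j).
Proof.
move=> /map_coact/matrixP GB i j; have := GB i j; rewrite !mxE => ->.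
by apply: eq_bigr => l _; rewrite !mxE.
Qed.

Lemma coactZ B c : coact B c%:A = in_alg (TA R) c.
Proof. by rewrite linearZ /= rmorph1. Qed.

Lemma tens_inrZ c : inr c%:A = in_alg (TA R) c.
Proof. by rewrite linearZ /= rmorph1. Qed.

Lemma tens_inlZ c : inl c%:A = in_alg (TA R) c.
Proof. by rewrite linearZ /= rmorph1. Qed.

Definition gext (B : 'M[R]_n) : TA R -> TA R :=
  @tens_hom k A R counit counit1 _ _ _ _ (coactZ B) tens_inrZ.

Lemma scale_tens_inr (r : R) (x : TA R) :
  (r *: (x : tens A R) : TA R) = inr r * x.
Proof.
elim/tens_pureP: x => [|y t IHy IHt|w t].
- by rewrite mulr0 scaler0.
- by rewrite scalerDr mulrDr IHy IHt.
by rewrite tensalgM mul1r tens_pureZ.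
Qed.

Fact gext_zmod B : zmod_morphism (gext B : tens A R -> tens A R).
Proof. exact: (tens_hom_zmod (coactZ B) tens_inrZ). Qed.
Fact gext_scalable B : scalable (gext B : tens A R -> tens A R).
Proof.
move=> r x; rewrite [r *: x]scale_tens_inr [RHS]scale_tens_inr.
rewrite /gext rmorphM /=.
suff -> : tens_hom (coactZ B) tens_inrZ (inr r) = inr r by [].
by rewrite [LHS]tens_hom_pure rmorph1 mul1r.
Qed.

HB.instance Definition _ B := GRing.isZmodMorphism.Build
  (tens A R) (tens A R) (gext B) (gext_zmod B).
HB.instance Definition _ B := GRing.isScalable.Build
  R (tens A R) (tens A R) *:%R (gext B) (gext_scalable B).

Lemma gext_pure B a r : gext B (tens_pure a r) = coact B a * inr r.
Proof. exact: tens_hom_pure. Qed.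

Lemma gext_inr B r : gext B (inr r) = inr r.
Proof. by rewrite gext_pure rmorph1 mul1r. Qed.

Lemma gext_inl B a : gext B (inl a) = coact B a.
Proof. by rewrite gext_pure rmorph1 mulr1. Qed.

Lemma gextM B x y : gext B (x * y) = gext B x * gext B y.
Proof. exact: rmorphM. Qed.

Lemma gext_sum B I (r : seq I) (P : pred I) (F : I -> TA R) :
  gext B (\sum_(i <- r | P i) F i) = \sum_(i <- r | P i) gext B (F i).
Proof. by rewrite /gext rmorph_sum. Qed.

Lemma gextZ B c : gext B (in_alg (TA R) c) = in_alg (TA R) c.
Proof. by rewrite -tens_inrZ gext_inr. Qed.

Lemma gext1 (x : tens A R) : gext 1%:M x = x.
Proof.
have E : coact 1%:M =1 inl.
  apply: coord_hom_eq => [c|].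
    exact: etrans (coactZ _ _) (esym (tens_inlZ _)).
  by rewrite (map_coact (gpoint_1 G R)) map_mx1 mulmx1.
elim/tens_pureP: x => [|y t IHy IHt|w t].
- by rewrite raddf0.
- by rewrite raddfD /= IHy IHt.
by rewrite gext_pure E -tens_inlr.
Qed.

Lemma gext_mul (B C : 'M[R]_n) : gpoint G B -> gpoint G C ->
  forall x : tens A R, gext (B *m C) x = gext B (gext C x).
Proof.
move=> GB GC x.
(* Both homomorphisms send [g] to [g B C], and the entries of [g] generate [k[G]]. *)
have E : coact (B *m C) =1 (gext B : TA R -> TA R) \o coact C.
  apply: (@coord_hom_eq _ _ (tens_hom (coactZ B) tens_inrZ \o coact C)) => [c|].
    apply: etrans (coactZ _ _) _; apply: esym.
    exact: etrans (congr1 (gext B) (coactZ C c)) (gextZ B c).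
  apply/matrixP=> i j; rewrite !mxE.
  apply: etrans (coact_entry (gpoint_M GB GC) i j) _; apply: esym; apply: etrans (congr1 (gext B) (coact_entry GC i j)) _.
  rewrite gext_sum.
  under eq_bigr => l _ do rewrite gextM gext_inl gext_inr (coact_entry GB) mulr_suml.
  rewrite exchange_big; apply: eq_bigr => m _; rewrite /= mxE rmorph_sum mulr_sumr.
  by apply: eq_bigr => l _; rewrite rmorphM mulrA.
elim/tens_pureP: x => [|y t IHy IHt|w t].
- by rewrite !raddf0.
- by rewrite !raddfD /= IHy IHt.
by rewrite !gext_pure E gextM gext_inr.
Qed.

End Coaction.

Lemma tens_map_pure (R S : comAlgType k) (f : {lrmorphism R -> S}) a r :
  tens_map f (tens_pure a r : tens A R) = tens_pure a (f r).
Proof. exact: tens_map_sum. Qed.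

Lemma tens_mapD (R S : comAlgType k) (f : {lrmorphism R -> S}) (x y : tens A R) :
  tens_map f (x + y) = tens_map f x + tens_map f y.
Proof.
rewrite -[x]tens_reprK -[y]tens_reprK !tens_sumE -big_cat -tens_sumE.
by rewrite -!tens_sumE !tens_map_sum map_cat !tens_sumE big_cat.
Qed.

Lemma gext_nat (R S : comAlgType k) (f : {lrmorphism R -> S}) (B : 'M[R]_n) :
  gpoint G B -> forall x : tens A R,
  gext (map_mx f B) (tens_map f x) = tens_map f (gext B x).
Proof.
move=> GB x.
have fZ c : (@tens_inr k A S counit counit1 \o f) c%:A = in_alg (TA S) c.
  by rewrite /= !linearZ /= !rmorph1.
have lZ c : @tens_inl k A S counit counit1 c%:A = in_alg (TA S) c.
  by rewrite /= !linearZ /= !rmorph1.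
have mapE y : tens_map f y = tens_hom lZ fZ (y : TA R).
  elim/tens_pureP: y => [|y t IHy IHt|w t].
  - rewrite raddf0; apply: (addIr (tens_map f (0 : tens A R))).
    by rewrite -tens_mapD !add0r.
  - by rewrite tens_mapD raddfD /= IHy IHt.
  - by rewrite tens_map_pure tens_hom_pure -tens_inlr.
rewrite !mapE; have fhr r : tens_hom lZ fZ (tens_inr counit1 r) = tens_inr counit1 (f r).
  by rewrite tens_hom_pure rmorph1 mul1r.
have fhl a : tens_hom lZ fZ (tens_inl R counit1 a) = tens_inl S counit1 a.
  by rewrite tens_hom_pure rmorph1 mulr1.
have E : coact (map_mx f B) =1 tens_hom lZ fZ \o coact B.
  apply: coord_hom_eq => [c|].
    apply: etrans (coactZ _ _) _; apply: esym.
    apply: etrans (congr1 (tens_hom lZ fZ) (coactZ B c)) _.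
    by rewrite -tens_inlZ fhl tens_inlZ.
  apply/matrixP=> i j; rewrite !mxE.
  apply: etrans (coact_entry (gpoint_map f GB) i j) _; apply: esym; apply: etrans (congr1 (tens_hom lZ fZ) (coact_entry GB i j)) _.
  rewrite rmorph_sum; apply: eq_bigr => l _.
  by rewrite rmorphM /= fhl fhr mxE.
elim/tens_pureP: x => [|y t IHy IHt|w t].
- by rewrite !raddf0.
- by rewrite !raddfD /= IHy IHt.
by rewrite gext_pure rmorphM /= fhr -[tens_hom _ _ (coact _ _)]E tens_hom_pure /=
  gextM gext_inr gext_inl.
Qed.

Definition gext_lin (R : comAlgType k) B : tens A R -> tens A R := @gext R B.
HB.instance Definition _ (R : comAlgType k) B := GRing.isZmodMorphism.Build
  (tens A R) (tens A R) (@gext_lin R B) (@gext_zmod R B).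
HB.instance Definition _ (R : comAlgType k) B := GRing.isScalable.Build
  R (tens A R) (tens A R) *:%R (@gext_lin R B) (@gext_scalable R B).

Definition regular_module : gmodule G A :=
  @GModule k n G A (fun R B => @gext_lin R B) gext1 gext_mul gext_nat.

End FinSubgroup.

(** * The invariant integral *)

Section Haar.
Variables (k : fieldType) (n : nat) (G : finSubgroupSL k n).
Local Notation A := (coord_ring G).
Local Notation g := (univ_point G).
Local Notation TA R := (tensalg R (counit1 G)).

Fact klin_iota (S : comNzRingType) (iota : {rmorphism k -> S}) (int : A -> k) :
  klin (idfun : {rmorphism k -> k}) int -> klin iota (fun a => iota (int a)).
Proof. by move=> h a u v; rewrite h rmorphD rmorphM. Qed.

(* The projection of the regular module to its invariants; translation
   invariance is tested against an arbitrary functional mu. *)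
Lemma haar_exists : linearly_reductive G ->
  exists2 int : A -> k, int 1 = 1 &
    exists hint : klin (idfun : {rmorphism k -> k}) int,
    forall (S : comNzRingType) (iota : {rmorphism k -> S}) (mu : A -> S)
      (hmu : klin iota mu) a,
    tens_pair (klin_iota iota hint) hmu (coact G g a) = iota (int a) * mu 1.
Proof.
move=> redG; pose W := [pred v : A | `[< exists c : k, v = c%:A >]].
have subW : gsubmodule (regular_module G) W.
  split.
    split=> [|a u v]; rewrite !inE.
      by apply/asboolP; exists 0; rewrite scale0r.
    move=> /asboolP[c ->] /asboolP[d ->]; apply/asboolP.
    by exists (a * c + d); rewrite scalerA scalerDl.
  move=> R B _ x [s sW ->]; exists s => //=.
  rewrite /gext_lin tens_sumE raddf_sum /=; apply: eq_big_seq => p /sW.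
  rewrite inE => /asboolP[c ->]; rewrite gext_pure coactZ.
  by rewrite [RHS](tens_inlr (counit1 G)) tens_inlZ.
have [W' [[[W'0 W'L] W'G] WW' spanW]] := redG _ _ _ subW.
have int_ex a : exists c : k, a - c%:A \in W'.
  have [w [w' [+ w'W ->]]] := spanW a; rewrite inE => /asboolP[c ->].
  by exists c; rewrite addrC addKr.
have [int intP] := choice int_ex.
have int_uniq a c : a - c%:A \in W' -> int a = c.
  move=> ac; have : (int a - c)%:A \in W'.
    have := W'L (-1) _ _ (intP a) ac.
    by rewrite scaleN1r opprB addrA subrK -scalerBl.
  move=> h; have /WW'/(_ h) : (int a - c)%:A \in W.
    by rewrite inE; apply/asboolP; exists (int a - c).
  move=> /(congr1 (counit G)); rewrite counitZ raddf0 => /eqP.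
  by rewrite subr_eq0 => /eqP.
have hint : klin (idfun : {rmorphism k -> k}) int.
  move=> a u v; apply: int_uniq.
  rewrite -[idfun a * _]/(a * int u) scalerDl -scalerA opprD addrACA -scalerBr.
  exact: W'L.
have int1 : int 1 = 1 by apply: int_uniq; rewrite scale1r subrr.
exists int => //; exists hint => S iota mu hmu a.
have intW' w : w \in W' -> int w = 0.
  by move=> wW; apply: int_uniq; rewrite scale0r subr0.
set w := a - (int a)%:A.
have [wW' ea] : w \in W' /\ a = (int a)%:A + w.
  by split; [exact: intP | rewrite addrC subrK].
rewrite {1}ea rmorphD raddfD /=.
(* The coaction of [w] lies in the image of [W' (x) k[G]], and [int] kills every left factor
   there. *)
have [s sW'] : tens_sub W' (gext g (tens_pure w 1 : tens A A)).
  apply: (W'G A g (gpoint_univ G)).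
  by exists [:: (w, 1)] => // p; rewrite inE => /eqP ->.
rewrite gext_pure rmorph1 mulr1 => ->.
rewrite tens_sumE raddf_sum /= [X in _ + X]big_seq big1 => [|p /sW' pW]; last first.
  by rewrite tens_pair_pure intW' ?rmorph0 ?mul0r.
rewrite addr0 coactZ -tens_inlZ /= tens_pair_pure (klinZ hint) int1.
by rewrite mulr1.
Qed.

End Haar.

(** * Polynomial functions on matrices and their integrals *)

Section MPolyExtra.
Variables (R : comNzRingType) (N : nat).

Lemma mpoly_alg_ind (P : {mpoly R[N]} -> Prop) :
  (forall c, P c%:MP) -> (forall i, P 'X_i) ->
  (forall p q, P p -> P q -> P (p + q)) ->
  (forall p q, P p -> P q -> P (p * q)) -> forall p, P p.
Proof.
move=> PC PX PD PM; elim/mpolyind => [|c m p _ _ Pp]; first exact: (PC 0).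
apply: PD => //; rewrite -mul_mpolyC; apply: (PM) => //.
rewrite mpolyXE_id; apply: (big_ind P); [exact: (PC 1) | exact: PM | move=> i _].
by elim: (m i) => [|e IH]; rewrite ?expr0 ?exprS; [exact: (PC 1) | exact: PM].
Qed.

Lemma mpoly_hom_eq (S : nzRingType) (f f' : {rmorphism {mpoly R[N]} -> S}) :
  (forall c, f c%:MP = f' c%:MP) -> (forall i, f 'X_i = f' 'X_i) -> f =1 f'.
Proof.
move=> fC fX; elim/mpoly_alg_ind => // p q ep eq; first by rewrite !rmorphD ep eq.
by rewrite !rmorphM ep eq.
Qed.

Fact mlin_key : unit. Proof. exact: tt. Qed.

Definition mlin (c : 'X_{1..N} -> R) (p : {mpoly R[N]}) : R :=
  locked_with mlin_key (\sum_(m <- msupp p) p@_m * c m).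

Lemma mlinE c p : mlin c p = \sum_(m <- msupp p) p@_m * c m.
Proof. by rewrite /mlin locked_withE. Qed.

Lemma mlinwE c d p : (msize p <= d)%N ->
  mlin c p = \sum_(m : 'X_{1..N < d}) p@_m * c m.
Proof.
move=> le_pd; rewrite mlinE (big_mksub 'X_{1..N < d}) ?msupp_uniq //=; last first.
  by move=> x /msize_mdeg_lt /leq_trans; apply.
rewrite big_rmcond //= => j /memN_msupp_eq0 ->.
by rewrite mul0r.
Qed.

Lemma mlinP c a p q : mlin c (a *: p + q) = a * mlin c p + mlin c q.
Proof.
pose d := maxn (msize (a *: p + q)) (maxn (msize p) (msize q)).
have [d1 [d2 d3]] : (msize (a *: p + q) <= d)%N /\ (msize p <= d)%N /\ (msize q <= d)%N.
  by rewrite !leq_max !leqnn !orbT.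
rewrite !(@mlinwE c d) // mulr_sumr -big_split /=; apply: eq_bigr => m _.
by rewrite mcoeffD mcoeffZ mulrDl mulrA.
Qed.

Lemma mlinX c m : mlin c 'X_[m] = c m.
Proof. by rewrite mlinE msuppX big_seq1 mcoeffX eqxx mul1r. Qed.

End MPolyExtra.

Section GenericMatrix.
Variable n : nat.

Definition genx (R : nzRingType) : 'M[{mpoly R[n * n]}]_n :=
  \matrix_(i, j) 'X_(mxvec_index i j).

Definition evm (R : nzRingType) (S : nzRingType) (f : R -> S) (B : 'M[S]_n) :
  {mpoly R[n * n]} -> S := mmap f (fun t => mxvec B 0 t).

HB.instance Definition _ (R : nzRingType) (S : comNzRingType)
  (f : {rmorphism R -> S}) B := GRing.RMorphism.on (evm f B).

Lemma evmC (R S : comNzRingType) (f : {rmorphism R -> S}) B c :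
  evm f B c%:MP = f c.
Proof. exact: mmapC. Qed.

Lemma evmX (R S : comNzRingType) (f : {rmorphism R -> S}) B i j :
  evm f B (genx R i j) = B i j.
Proof. by rewrite mxE /evm mmapX mmap1U mxvecE. Qed.

Lemma map_evm (R S : comNzRingType) (f : {rmorphism R -> S}) B :
  map_mx (evm f B) (genx R) = B.
Proof. by apply/matrixP=> i j; rewrite mxE evmX. Qed.

Lemma genx_ind (R : comNzRingType) (P : {mpoly R[n * n]} -> Prop) :
  (forall c, P c%:MP) -> (forall i j, P (genx R i j)) ->
  (forall p q, P p -> P q -> P (p + q)) ->
  (forall p q, P p -> P q -> P (p * q)) -> forall p, P p.
Proof.
move=> PC PX; apply: mpoly_alg_ind => // t.
by case/mxvec_indexP: t => i j; have := PX i j; rewrite mxE.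
Qed.

Lemma evm_eq (R : comNzRingType) (S : comNzRingType)
    (f f' : {rmorphism {mpoly R[n * n]} -> S}) :
  (forall c, f c%:MP = f' c%:MP) ->
  (forall i j, f (genx R i j) = f' (genx R i j)) -> f =1 f'.
Proof.
move=> fC fX; elim/genx_ind => // p q ep eq; first by rewrite !rmorphD ep eq.
by rewrite !rmorphM ep eq.
Qed.

Lemma map_genx (R S : comNzRingType) (f : {rmorphism R -> S}) :
  map_mx (map_mpoly f) (genx R) = genx S.
Proof. by apply/matrixP=> i j; rewrite !mxE map_mpolyX. Qed.

End GenericMatrix.
Arguments genx n R : clear implicits.

Section Functional.
Variables (k : fieldType) (n : nat) (A : comAlgType k) (g : 'M[A]_n).
Variables (b : kbasis A).
Hypothesis det_g : \det g = 1.
Hypothesis gen_g : forall a, exists f : {mpoly k[n * n]},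
  evm (in_alg A) g f = a.
Variable int : A -> k.
Hypothesis hint : klin (idfun : {rmorphism k -> k}) int.
Hypothesis int1 : int 1 = 1.

Variables (F : fieldType) (iota : {rmorphism k -> F}).
Local Notation FX := {mpoly F[n * n]}.
Local Notation X := (genx n F).
Local Notation ev := (evm (in_alg A) g).

(** The integral pulled back to [F[X]], with scalars extended along [iota]. Working with polynomials
    avoids forming [k[G] (x) F]. *)
Definition extint (p : FX) : F := mlin (fun m => iota (int (ev 'X_[m]))) p.

Lemma extintP : klin (idfun : {rmorphism F -> F}) extint.
Proof. by move=> a u v; rewrite /extint mlinP. Qed.

Lemma extint_map f : extint (map_mpoly iota f) = iota (int (ev f)).
Proof.
rewrite [f in RHS]mpolyE rmorph_sum (klin_sum hint) rmorph_sum /=.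
rewrite {1}[f]mpolyE rmorph_sum (klin_sum extintP) /=.
apply: eq_bigr => m _; rewrite map_mpolyZ map_mpolyX (klinZ extintP) /=.
rewrite /extint mlinX -mul_mpolyC rmorphM /= evmC /= mulr_algl (klinZ hint).
by rewrite rmorphM.
Qed.

Lemma extint1 : extint 1 = 1.
Proof. by rewrite -(rmorph1 (map_mpoly iota)) extint_map rmorph1 int1 rmorph1. Qed.

(** The largest ideal on which the integral vanishes. It contains the equations of [G]
    ([extker_map]), so an identity in [k[G] (x) F] becomes membership of a difference in it. *)
Definition extker (q : FX) : Prop := forall p, extint (q * p) = 0.

Lemma extkerD p q : extker p -> extker q -> extker (p + q).
Proof.
by move=> hp hq r; rewrite mulrDl (klinD extintP) hp hq addr0.
Qed.

Lemma extkerMr p q : extker p -> extker (p * q).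
Proof. by move=> hp r; rewrite -mulrA hp. Qed.

Lemma extkerMl p q : extker q -> extker (p * q).
Proof. by rewrite mulrC; apply: extkerMr. Qed.

Lemma extker0 : extker 0.
Proof. by move=> p; rewrite mul0r (klin0 extintP). Qed.

Lemma extker_sum I (r : seq I) (P : pred I) (E : I -> FX) :
  (forall i, P i -> extker (E i)) -> extker (\sum_(i <- r | P i) E i).
Proof. exact: (big_ind extker extker0 extkerD). Qed.

Lemma extker_map f : ev f = 0 -> extker (map_mpoly iota f).
Proof.
move=> f0 p; rewrite [p]mpolyE mulr_sumr (klin_sum extintP) big1 // => m _.
rewrite -scalerAr (klinZ extintP) -(map_mpolyX iota) -(rmorphM (map_mpoly iota)).
rewrite extint_map.
by rewrite rmorphM /= f0 mul0r (klin0 hint) rmorph0 mulr0.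
Qed.

(** The orbit map [X e] misses 0: if [u e = 1], then [u (\adj X) (X e) = \det X = 1] on [G], so the
    coordinates [beta] of [X e] generate the unit ideal. By the determinant trick in the finite
    algebra [k[G]], a polynomial in [beta] with constant term 1 vanishes on [G]. Under the
    hypothesis its integral is that constant term, a contradiction. *)
Lemma extint_vec_neq0 (e : 'cV[F]_n) :
  (forall m : 'X_{1..n}, m != 0%MM ->
     extint (mmap1 (fun i => (X *m map_mx (@mpolyC (n * n) F) e) i 0) m) = 0) ->
  e = 0.
Proof.
set beta := fun i => _ => beta0; apply/eqP/contraT => /eqP nz_e.
have {nz_e} [u ue] : exists u : 'rV[F]_n, u *m e = 1%:M.
  have [i nz_ei] : exists i, e i 0 != 0.
    apply: contra_notP nz_e => /forallNP e0; apply/matrixP=> i j.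
    by rewrite ord1 mxE; apply/eqP/negPn/negP/e0.
  exists ((e i 0)^-1 *: delta_mx 0 i); rewrite -scalemxAl -rowE.
  by apply/matrixP=> r s; rewrite !ord1 !mxE mulVf.
have [ly lyP] := choice gen_g.
pose y l := ly (bvec b l).
(* [C t i] is the matrix of multiplication by an entry of [\adj g], hence [CF i] that of the [i]-th
   coordinate of [u \adj g]. These coordinates combine with [beta] to 1, so [ZT], evaluated at
   [beta], kills the basis. *)
pose C t i : 'M[k]_(bdim b) :=
  \matrix_(l, l') bco b ((\adj g) t i * bvec b l) l'.
pose CF i : 'M[F]_(bdim b) := \sum_t u 0 t *: map_mx iota (C t i).
pose ZT : 'M[{mpoly F[n]}]_(bdim b) :=
  1%:M - \sum_i 'X_i *: map_mx (@mpolyC n F) (CF i).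
pose sigma : {rmorphism {mpoly F[n]} -> FX} := mmap (@mpolyC (n * n) F) beta.
pose yF : 'cV[FX]_(bdim b) := \col_l map_mpoly iota (y l).
have yFE l : yF l 0 = map_mpoly iota (y l) by rewrite mxE.
have sigmaC c : sigma c%:MP = c%:MP by exact: mmapC.
have sigmaX i : sigma 'X_i = beta i by rewrite /= mmapX mmap1U.
have adjX t i : (\adj X) t i = map_mpoly iota ((\adj (genx n k)) t i).
  by rewrite -(map_genx n iota) -map_mx_adj [LHS]mxE.
have detX : \det X = map_mpoly iota (\det (genx n k)).
  by rewrite -det_map_mx map_genx.
have evdet : ev (\det (genx n k)) = 1 by rewrite -det_map_mx map_evm.
have evadj t i : ev ((\adj (genx n k)) t i) = (\adj g) t i.
  by rewrite -[in RHS](map_evm (in_alg A) g) -map_mx_adj [RHS]mxE.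
have sum_adj : \sum_i beta i * \sum_t (u 0 t)%:MP * (\adj X) t i = \det X.
  have : (map_mx (@mpolyC (n * n) F) u *m \adj X) *m (X *m map_mx (@mpolyC (n * n) F) e)
           = (\det X)%:M.
    rewrite -mulmxA [\adj X *m _]mulmxA mul_adj_mx mul_scalar_mx -scalemxAr.
    by rewrite -map_mxM ue map_scalar_mx rmorph1 scale_scalar_mx mulr1.
  move/matrixP/(_ 0 0); rewrite [in RHS]mxE eqxx mulr1n => <-; rewrite mxE.
  apply: eq_bigr => i _; rewrite [LHS]mulrC [X in _ = X * _]mxE; congr (_ * _).
  apply: eq_bigr => t _; congr (_ * _); by rewrite mxE.
have ker_Zy l : extker ((map_mx sigma ZT *m yF) l 0).
  suff -> : (map_mx sigma ZT *m yF) l 0 = (1 - \det X) * yF l 0 +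
    \sum_i beta i * \sum_t (u 0 t)%:MP *
      ((\adj X) t i * yF l 0 - \sum_l' (iota (C t i l l'))%:MP * yF l' 0).
    apply: extkerD.
      apply: extkerMr; rewrite detX -(rmorph1 (map_mpoly iota)) -rmorphB.
      by apply: extker_map; rewrite rmorphB rmorph1 /= evdet subrr.
    apply: extker_sum => i _; apply: extkerMl; apply: extker_sum => t _.
    apply: extkerMl; rewrite adjX yFE -(rmorphM (map_mpoly iota)).
    under eq_bigr => l' _ do
      rewrite yFE -(map_mpolyC _ iota) -(rmorphM (map_mpoly iota)).
    rewrite -rmorph_sum -(rmorphB (map_mpoly iota)); apply: extker_map.
    rewrite rmorphB rmorphM /= evadj lyP rmorph_sum {1}[_ * bvec b l](bcoP b) -sumrB.
    by apply: big1 => l' _; rewrite rmorphM /= evmC lyP [C t i l l']mxE mulr_algl subrr.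
  rewrite /ZT map_mxB map_mx1 mulmxBl mul1mx mxE mulrBl mul1r -addrA.
  congr (_ + _).
  under [in RHS]eq_bigr => i _ do
    (under eq_bigr => t _ do rewrite mulrBr mulrA; rewrite sumrB mulrBr -mulr_suml mulrA).
  rewrite sumrB -mulr_suml sum_adj addKr mxE; congr (- _).
  rewrite raddf_sum mulmx_suml summxE; apply: eq_bigr => i _.
  rewrite /= map_mxZ sigmaX -scalemxAl mxE; congr (_ * _).
  rewrite mxE; under [in RHS]eq_bigr => t _ do rewrite mulr_sumr.
  rewrite exchange_big; apply: eq_bigr => l' _; rewrite !mxE sigmaC.
  rewrite /CF summxE rmorph_sum mulr_suml; apply: eq_bigr => t _.
  by rewrite !mxE rmorphM mulrA.
have det_ker l : extker (\det (map_mx sigma ZT) * yF l 0).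
  have -> : \det (map_mx sigma ZT) * yF l 0 =
      (\adj (map_mx sigma ZT) *m (map_mx sigma ZT *m yF)) l 0.
    by rewrite mulmxA mul_adj_mx mul_scalar_mx [RHS]mxE.
  by rewrite mxE; apply: extker_sum => j _; apply/extkerMl/ker_Zy.
have : extint (sigma (\det ZT)) = 0.
  rewrite -det_map_mx; set D := \det _.
  suff : extker D by move=> /(_ 1); rewrite mulr1.
  pose s := \sum_l (iota (bco b 1 l))%:MP * yF l 0.
  have -> : D = D * (1 - s) + D * s by rewrite -mulrDr subrK mulr1.
  apply: extkerD; last first.
    rewrite mulr_sumr; apply: extker_sum => l _.
    by rewrite mulrCA; apply/extkerMl/det_ker.
  apply: extkerMl; rewrite /s -(rmorph1 (map_mpoly iota)).
  under eq_bigr => l _ do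
    rewrite yFE -(map_mpolyC _ iota) -(rmorphM (map_mpoly iota)).
  rewrite -rmorph_sum -(rmorphB (map_mpoly iota)); apply: extker_map.
  rewrite rmorphB rmorph1 rmorph_sum /= {1}[1](bcoP b) -sumrB.
  by apply: big1 => l _; rewrite rmorphM /= evmC lyP mulr_algl subrr.
have extsigma q : extint (sigma q) = q@_0%MM.
  rewrite {1}[q]mpolyE rmorph_sum (klin_sum extintP) /=.
  have [q0|q0] := boolP (0%MM \in msupp q).
    rewrite (bigD1_seq 0%MM) ?msupp_uniq //= big1 => [|m m0].
      by rewrite mmapZ mmapX mmap11 mul_mpolyC (klinZ extintP) extint1 mulr1 addr0.
    by rewrite mmapZ mmapX mul_mpolyC (klinZ extintP) beta0 ?mulr0.
  rewrite (memN_msupp_eq0 q0) big_seq big1 // => m mq.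
  rewrite mmapZ mmapX mul_mpolyC (klinZ extintP) beta0 ?mulr0 //.
  by apply: contraNneq q0 => <-.
rewrite extsigma -(det_map_mx (mcoeff 0%MM)) => /eqP.
suff -> : map_mx (mcoeff 0%MM) ZT = 1%:M by rewrite det1 oner_eq0.
rewrite /ZT map_mxB map_mx1 raddf_sum big1 ?subr0 // => i _.
apply/matrixP=> r s; rewrite !mxE mulrC /= mcoeffCM mcoeffX.
by rewrite mnm1_eq0 mulr0.
Qed.

End Functional.

(** The left invariant derivation with [X |-> X D], the infinitesimal form of the translation
    [p(X) |-> p(X (1 + t D))]. It is locked so that only its rules are used. *)
HB.lock Definition dmx (n : nat) (R : comNzRingType) (D : 'M[R]_n)
    (p : {mpoly R[n * n]}) : {mpoly R[n * n]} :=
  \sum_i \sum_j (genx n R *m map_mx (@mpolyC (n * n) R) D) i j *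
    p^`M(mxvec_index i j).

Section GenericDerivation.
Variables (n : nat) (R : comNzRingType).
Local Notation RX := {mpoly R[n * n]}.
Local Notation X := (genx n R).
Implicit Types (D : 'M[R]_n) (p q : RX).

Definition cmx (m1 m2 : nat) (D : 'M[R]_(m1, m2)) : 'M[RX]_(m1, m2) :=
  map_mx (@mpolyC (n * n) R) D.

Lemma cmxM m1 m2 m3 (D : 'M[R]_(m1, m2)) (E : 'M[R]_(m2, m3)) :
  cmx (D *m E) = cmx D *m cmx E.
Proof. exact: map_mxM. Qed.

Lemma mul_cmxP m1 m2 (M : 'M[RX]_(m1, n)) a (D E : 'M[R]_(n, m2)) i j :
  (M *m cmx (a *: D + E)) i j = a *: (M *m cmx D) i j + (M *m cmx E) i j.
Proof.
by rewrite /cmx map_mxD map_mxZ mulmxDr -scalemxAr !mxE /= mul_mpolyC.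
Qed.

Lemma dmxE D p :
  dmx D p = \sum_i \sum_j (X *m cmx D) i j * p^`M(mxvec_index i j).
Proof. by rewrite dmx.unlock. Qed.

Lemma dmxP D a p q : dmx D (a *: p + q) = a *: dmx D p + dmx D q.
Proof.
rewrite !dmxE scaler_sumr -big_split; apply: eq_bigr => i _ /=.
rewrite scaler_sumr -big_split; apply: eq_bigr => j _ /=.
by rewrite mderivD mderivZ mulrDr scalerAr.
Qed.

Lemma dmxD D p q : dmx D (p + q) = dmx D p + dmx D q.
Proof. by rewrite -[p in LHS]scale1r dmxP scale1r. Qed.

Lemma dmx0 D : dmx D 0 = 0.
Proof. by rewrite !dmxE big1 // => i _; rewrite big1 // => j _; rewrite mderiv0 mulr0. Qed.

Lemma dmxZ D a p : dmx D (a *: p) = a *: dmx D p.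
Proof. by rewrite -[_ *: _ in LHS]addr0 dmxP dmx0 addr0. Qed.

Lemma dmx_sum D I (r : seq I) (P : pred I) (E : I -> RX) :
  dmx D (\sum_(i <- r | P i) E i) = \sum_(i <- r | P i) dmx D (E i).
Proof. exact: (big_morph _ (dmxD D) (dmx0 D)). Qed.

Lemma dmxC D c : dmx D c%:MP = 0.
Proof. by rewrite !dmxE big1 // => i _; rewrite big1 // => j _; rewrite mderivC mulr0. Qed.

Lemma dmxM D p q : dmx D (p * q) = dmx D p * q + p * dmx D q.
Proof.
rewrite !dmxE mulr_suml mulr_sumr -big_split; apply: eq_bigr => i _ /=.
rewrite mulr_suml mulr_sumr -big_split; apply: eq_bigr => j _ /=.
by rewrite mderivM mulrDr; congr (_ + _); [rewrite mulrA | rewrite mulrCA].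
Qed.

Lemma dmxX D i j : dmx D (X i j) = (X *m cmx D) i j.
Proof.
have dX r s : (X i j)^`M(mxvec_index r s) = ((r == i) && (s == j))%:R.
  rewrite mxE mderivX mnm1E.
  have -> : (mxvec_index i j == mxvec_index r s) = (r == i) && (s == j).
    apply/eqP/andP => [|[/eqP -> /eqP ->] //].
    by move=> /cast_ord_inj/enum_rank_inj [-> ->].
  case: andP => [[/eqP -> /eqP ->]|_]; last by rewrite scale0r.
  by rewrite -{1}[U_(_)%MM]add0m addmK mpolyX0 scale1r.
rewrite !dmxE (bigD1 i) //= [X in _ + X]big1 ?addr0 => [|r nri]; last first.
  by apply: big1 => s _; rewrite dX (negPf nri) mulr0.
rewrite (bigD1 j) //= big1 ?addr0 => [|s nsj]; last by rewrite dX (negPf nsj) andbF mulr0.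
by rewrite dX !eqxx mulr1.
Qed.

(** Derivations are determined on generators; this lets the bracket of two of them be computed on
    the entries of [X], without second derivatives. *)
Lemma dmx_eq D (delta : RX -> RX) :
  (forall p q, delta (p + q) = delta p + delta q) ->
  (forall p q, delta (p * q) = delta p * q + p * delta q) ->
  (forall c, delta c%:MP = 0) ->
  (forall i j, delta (X i j) = (X *m cmx D) i j) -> delta =1 dmx D.
Proof.
move=> dD dM dC dX; elim/genx_ind=> [c|i j|p q ep eq|p q ep eq].
- by rewrite dC dmxC.
- by rewrite dX dmxX.
- by rewrite dD dmxD ep eq.
- by rewrite dM dmxM ep eq.
Qed.

Lemma dmx_mulmx m (B : 'M[R]_(n, m)) D i j :
  dmx D ((X *m cmx B) i j) = (X *m cmx (D *m B)) i j.
Proof.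
rewrite cmxM mulmxA !mxE dmx_sum; apply: eq_bigr => l _.
by rewrite dmxM dmxX [cmx B l j]mxE dmxC mulr0 addr0.
Qed.

Lemma dmx_bracket D E p :
  dmx D (dmx E p) - dmx E (dmx D p) = dmx (D *m E - E *m D) p.
Proof.
move: p; apply: (@dmx_eq _ (fun p => dmx D (dmx E p) - dmx E (dmx D p)))
  => [p q|p q|c|i j].
- by rewrite !dmxD opprD addrACA.
- rewrite !dmxM !dmxD !dmxM.
  move: (dmx D (dmx E p)) (dmx D (dmx E q)) (dmx E (dmx D p)) (dmx E (dmx D q))
    (dmx D p) (dmx D q) (dmx E p) (dmx E q) => p1 p2 p3 p4 p5 p6 p7 p8.
  ring.
- by rewrite !dmxC ?dmx0 subrr.
- by rewrite !dmxX !dmx_mulmx /cmx map_mxB mulmxBr !mxE.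
Qed.

Lemma dmx_linl D E a p : dmx (a *: D + E) p = a *: dmx D p + dmx E p.
Proof.
rewrite !dmxE scaler_sumr -big_split; apply: eq_bigr => i _ /=.
rewrite scaler_sumr -big_split; apply: eq_bigr => j _ /=.
by rewrite scalerAl -mulrDl -mul_cmxP.
Qed.

Lemma dmx_suml m (t : 'I_m -> R) (E : 'I_m -> 'M[R]_n) p :
  dmx (\sum_s t s *: E s) p = \sum_s t s *: dmx (E s) p.
Proof.
elim/big_rec2: _ => [|s q D _ <-]; last by rewrite dmx_linl.
rewrite dmxE big1 // => i _; rewrite big1 // => j _.
by rewrite /cmx map_mx0 mulmx0 mxE mul0r.
Qed.

End GenericDerivation.

(** * The Lie algebra and unipotent points *)

Lemma coord_ring_gen (k : fieldType) (n : nat) (G : finSubgroupSL k n)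
    (a : coord_ring G) : exists f, evm (in_alg (coord_ring G)) (univ_point G) f = a.
Proof.
set ev := evm _ _.
pose S := [pred a | `[< exists f, ev f = a >]].
suff : a \in S by rewrite inE => /asboolP.
apply: (@univ_point_gen k n G S) => [|i j]; last first.
  by rewrite inE; apply/asboolP; exists (genx n k i j); apply: evmX.
split=> [|c u v|u v]; rewrite !inE.
- by apply/asboolP; exists 1; apply: rmorph1.
- move=> /asboolP[p <-] /asboolP[q <-]; apply/asboolP; exists (c%:MP * p + q).
  by rewrite /ev rmorphD rmorphM /= evmC mulr_algl.
- move=> /asboolP[p <-] /asboolP[q <-]; apply/asboolP; exists (p * q).
  by rewrite /ev rmorphM.
Qed.

Definition klin_fun (k : fieldType) (V : lmodType k) (S : comNzRingType)
  (iota : {rmorphism k -> S}) (f : V -> S) of klin iota f := f.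

Section KlinFun.
Variables (k : fieldType) (V : lmodType k) (S : comNzRingType)
  (iota : {rmorphism k -> S}) (f : V -> S) (hf : klin iota f).
Fact klin_fun_zmod : zmod_morphism (klin_fun hf).
Proof.
by move=> u v; rewrite /klin_fun addrC -scaleN1r hf rmorphN1 mulN1r addrC.
Qed.
HB.instance Definition _ := GRing.isZmodMorphism.Build V S (klin_fun hf) klin_fun_zmod.
End KlinFun.

Lemma mnm_ind n (P : 'X_{1..n} -> Prop) :
  P 0%MM -> (forall i m, P m -> P (U_(i) + m)%MM) -> forall m, P m.
Proof.
move=> P0 PS m; have [d] := ubnP (mdeg m); elim: d m => // d IH m lt_md.
have [-> //|nz_m] := eqVneq m 0%MM.
have [i nz_mi] : exists i, m i != 0%N.
  apply: contra_notP (negP nz_m) => /forallNP m0; apply/eqP/mnmP => i.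
  by rewrite mnm0E; apply/eqP/negPn/negP/m0.
have em : m = (U_(i) + (m - U_(i)))%MM by rewrite addmC submK // lep1mP.
rewrite em; apply/PS/IH; move: lt_md; rewrite {1}em mdegD mdeg1.
by rewrite ltnS.
Qed.

Lemma mmap1D n (R : comNzRingType) (h : 'I_n -> R) m1 m2 :
  mmap1 h (m1 + m2)%MM = mmap1 h m1 * mmap1 h m2.
Proof. by apply: commr_mmap1_M => i x; apply: mulrC. Qed.

Section Invariance.
Variables (k : fieldType) (n : nat) (G : finSubgroupSL k n).
Local Notation A := (coord_ring G).
Local Notation g := (univ_point G).
Local Notation ev := (evm (in_alg A) g).
Variable int : A -> k.
Hypothesis hint : klin (idfun : {rmorphism k -> k}) int.
Hypothesis hinv : forall (S : comNzRingType) (iota : {rmorphism k -> S})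
  (mu : A -> S) (hmu : klin iota mu) a,
  tens_pair (klin_iota iota hint) hmu (coact G g a) = iota (int a) * mu 1.

Variables (F : fieldType) (iota : {rmorphism k -> F}).
Local Notation X := (genx n F).
Local Notation extint := (extint g int iota).

Definition transl : {mpoly k[n * n]} -> {mpoly A[n * n]} :=
  evm (@mpolyC (n * n) A \o in_alg A) (genx n A *m cmx n g).

HB.instance Definition _ := GRing.RMorphism.on transl.

Lemma translC c : transl c%:MP = (c%:A)%:MP.
Proof. exact: evmC. Qed.

Lemma translX i j : transl (genx n k i j) = (genx n A *m cmx n g) i j.
Proof. exact: evmX. Qed.

(** The evaluation [E] puts [X] at the left copy of [g] and the coefficients into the right copy of
    [k[G]]. It turns [transl f], that is [f(X g)], into the coaction of [f(g)], to which [hinv]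
    applies. *)
Lemma extint_inv (mu : A -> F) (hmu : klin iota mu) f :
  extint (map_mpoly (klin_fun hmu) (transl f)) = mu 1 * iota (int (ev f)).
Proof.
pose TA := tensalg A (counit1 G).
pose inl : {lrmorphism A -> TA} := tens_inl A (counit1 G).
pose inr : {lrmorphism A -> TA} := @tens_inr _ A A _ (counit1 G).
pose E : {rmorphism {mpoly A[n * n]} -> TA} := evm inr (map_mx inl g).
have pairE P : tens_pair (klin_iota iota hint) hmu (E P)
    = extint (map_mpoly (klin_fun hmu) P).
  rewrite [P]mpolyE !rmorph_sum !raddf_sum (klin_sum (extintP _ _ _)).
  apply: eq_bigr => m _; rewrite -mul_mpolyC rmorphM /= evmC.
  have -> : map_mpoly (klin_fun hmu) ((P@_m)%:MP * 'X_[m]) = mu (P@_m) *: 'X_[m].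
    apply/mpolyP => m'; rewrite mcoeff_map_mpoly mcoeffCM mcoeffZ !mcoeffX.
    by case: eqP; rewrite ?mulr1 ?mulr0 // raddf0.
  rewrite (klinZ (extintP _ _ _)) /extint mlinX.
  have -> : evm inr (map_mx inl g) 'X_[m] = inl (ev 'X_[m]).
    rewrite /evm !mmapX /mmap1 rmorph_prod; apply: eq_bigr => t _.
    by case/mxvec_indexP: t => i j; rewrite !mxvecE mxE rmorphXn.
  by rewrite mulrC [inl _ * _]tensalgM mulr1 mul1r tens_pair_pure mulrC.
have ET : E (transl f) = coact G g (ev f).
  have : E \o transl =1 coact G g \o ev; last exact.
  apply: evm_eq => [c|i j].
    rewrite /= translC !evmC; exact: etrans (@tens_inrZ k n G A c) (esym (@coactZ k n G A g c)).
  apply: etrans (congr1 E (translX i j)) _.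
  apply: etrans (congr1 (coact G g) (esym (evmX _ _ i j))).
  rewrite (coact_entry (gpoint_univ G)) mxE rmorph_sum; apply: eq_bigr => l _.
  by rewrite rmorphM /= evmX !mxE evmC.
by rewrite -pairE ET hinv mulrC.
Qed.

Definition ptinv (H : 'M[F]_n) : Prop :=
  forall p, extint (evm (@mpolyC (n * n) F) (X *m cmx n H) p) = extint p.

(** This is [extint_inv] for [mu = h]: specializing the coefficients of [f(X g)] at the point gives
    [f(X H)]. *)
Lemma ptinv_point (h : {rmorphism A -> F}) : (forall c, h c%:A = iota c) ->
  ptinv (map_mx h g).
Proof.
move=> hZ p; set H := map_mx h g.
have main f : extint (evm (@mpolyC (n * n) F) (X *m cmx n H) (map_mpoly iota f))
    = extint (map_mpoly iota f).
  rewrite extint_map // -[RHS]mul1r -(rmorph1 h).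
  rewrite -(extint_inv (klin_rmorph hZ)); congr extint.
  have : evm (@mpolyC (n * n) F) (X *m cmx n H) \o map_mpoly iota =1
    map_mpoly h \o transl; last by apply.
  apply: evm_eq => [c|i j] /=.
    by rewrite translC !map_mpolyC evmC; congr (_%:MP); exact: esym (hZ c).
  rewrite translX -[map_mpoly iota _]/((map_mpoly iota) _).
  have -> : map_mpoly iota (genx n k i j) = X i j.
    by rewrite -(map_genx n iota) [RHS]mxE.
  rewrite evmX -(map_genx n h).
  have -> : cmx n H = map_mx (map_mpoly h) (cmx n g).
    by apply/matrixP=> r s; rewrite !mxE /= map_mpolyC.
  by rewrite -map_mxM [LHS]mxE.
rewrite [p]mpolyE rmorph_sum !(klin_sum (extintP _ _ _)).
apply: eq_bigr => m _; rewrite -mul_mpolyC rmorphM /= evmC !mul_mpolyC.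
rewrite !(klinZ (extintP _ _ _)); congr (_ * _).
by have := main 'X_[m]; rewrite map_mpolyX.
Qed.

(** Infinitesimal invariance of the integral stands in for membership in the Lie algebra of [G],
    which it contains by [lie_derivation]. It amounts to linear conditions on [D] with coefficients
    in [k], so it passes to extensions and descends to [k]. *)
Definition lie (D : 'M[F]_n) : Prop := forall p, extint (dmx D p) = 0.

Lemma lieE D : (forall f, extint (dmx D (map_mpoly iota f)) = 0) -> lie D.
Proof.
move=> h p; rewrite [p]mpolyE dmx_sum (klin_sum (extintP _ _ _)) big1 // => m _.
by rewrite dmxZ (klinZ (extintP _ _ _)) -(map_mpolyX iota) h mulr0.
Qed.

(** Take [mu = lam] in [extint_inv], where [lam 1 = 0]. Since [X g] becomes [X] under the counit,
    the twisted Leibniz rule makes [lam], applied to the coefficients of [f(X g)], equal to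
    [dmx D f]. *)
Lemma lie_derivation (lam : A -> F) (hlam : klin iota lam) :
  (forall a b, lam (a * b) = iota (counit G a) * lam b + lam a * iota (counit G b)) ->
  lie (map_mx lam g).
Proof.
move=> lamM; apply: lieE => f; set D := map_mx lam g.
have lam1 : lam 1 = 0.
  have := lamM 1 1; rewrite counit1 rmorph1 !mulr1 mul1r.
  by move/(congr1 (+%R^~ (- lam 1))); rewrite subrr addrK.
have := extint_inv hlam f; rewrite lam1 mul0r => <-; congr extint.
pose eF : {rmorphism A -> F} := iota \o (counit G : {rmorphism A -> k^o}).
have mulL (P Q : {mpoly A[n * n]}) :
    map_mpoly (klin_fun hlam) (P * Q) =
    map_mpoly (klin_fun hlam) P * map_mpoly eF Q +
    map_mpoly eF P * map_mpoly (klin_fun hlam) Q.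
  apply/mpolyP => m; rewrite mcoeffD !mcoeffM mcoeff_map_mpoly mcoeffM raddf_sum.
  rewrite -big_split /=; apply: eq_bigr => r _; rewrite !mcoeff_map_mpoly.
  by rewrite /klin_fun lamM addrC.
have eFE p : map_mpoly eF (transl p) = map_mpoly iota p.
  have : map_mpoly eF \o transl =1 map_mpoly iota; last exact.
  apply: evm_eq => [c|i j] /=.
    by rewrite translC !map_mpolyC /= counitZ.
  rewrite translX; apply/esym.
  have -> : map_mpoly iota (genx n k i j) = (map_mx (map_mpoly eF) (genx n A *m cmx n g)) i j.
    rewrite map_mxM map_genx.
    have -> : map_mx (map_mpoly eF) (cmx n g) = 1%:M.
      apply/matrixP=> r s; have /matrixP/(_ r s) := map_counit G.
      rewrite !mxE /= map_mpolyC => /= ->.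
      by rewrite rmorph_nat mpolyC_nat.
    by rewrite mulmx1 -(map_genx n iota) [RHS]mxE.
  by rewrite [LHS]mxE.
elim/genx_ind: f => [c|i j|p q ep eq|p q ep eq].
- rewrite translC !map_mpolyC dmxC /= /klin_fun (klinZ hlam) lam1 mulr0.
  by rewrite mpolyC0.
- have -> : map_mpoly iota (genx n k i j) = X i j.
    by rewrite -(map_genx n iota) [RHS]mxE.
  rewrite translX dmxX !mxE raddf_sum; apply: eq_bigr => l _ /=.
  rewrite mulL !mxE !map_mpolyC map_mpolyX /klin_fun.
  suff -> : map_mpoly (klin_fun hlam) 'X_(mxvec_index i l) = 0 by rewrite mul0r add0r.
  apply/mpolyP=> m; rewrite mcoeff_map_mpoly mcoeffX mcoeff0.
  by case: eqP => _; rewrite ?raddf0 // /klin_fun lam1.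
- by rewrite !rmorphD !raddfD /= dmxD ep eq.
- by rewrite !rmorphM /= mulL dmxM ep eq !eFE.
Qed.

Lemma lieP D E a : lie D -> lie E -> lie (a *: D + E).
Proof.
move=> hD hE p; rewrite dmx_linl.
apply: etrans (extintP g int iota a (dmx D p) (dmx E p)) _.
by rewrite hD hE mulr0 addr0.
Qed.

Lemma lie_bracket D E : lie D -> lie E -> lie (D *m E - E *m D).
Proof.
move=> hD hE p; rewrite -dmx_bracket.
have := extintP g int iota (-1) (dmx E (dmx D p)) (dmx D (dmx E p)).
by rewrite scaleN1r addrC hD hE mulr0 addr0.
Qed.

Hypothesis int1 : int 1 = 1.
Variable b : kbasis A.

Let vec_neq0 := @extint_vec_neq0 k n A g b (univ_point_det G)
  (@coord_ring_gen k n G) int hint int1 F iota.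

(** A monomial of degree [d] in the coordinates of [X e'] is an eigenvector of [dmx D] with
    eigenvalue [d al], so it integrates to 0 when [d al] is nonzero. If [d al = 0], as happens for
    [al = 0] or when the characteristic divides [d], replacing one factor by the same coordinate of
    [X e] gives a polynomial whose derivative is the monomial. *)
Lemma lie_no_jordan (D : 'M[F]_n) (e e' : 'cV[F]_n) al : lie D ->
  D *m e = al *: e + e' -> D *m e' = al *: e' -> e' = 0.
Proof.
move=> lieD De De'; apply: vec_neq0 => m nz_m.
set be := fun i => _.
have dbe i : dmx D (be i) = al *: be i.
  rewrite /be -/(cmx n e') dmx_mulmx De' -[al *: e']addr0 mul_cmxP.
  by rewrite /cmx map_mx0 mulmx0 [X in _ + X]mxE addr0.
have dm m' : dmx D (mmap1 be m') = (al *+ mdeg m') *: mmap1 be m'.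
  elim/mnm_ind: m' => [|i m' IH].
    by rewrite mmap11 mdeg0 scale0r -mpolyC1 dmxC.
  rewrite mmap1D mmap1U dmxM IH dbe mdegD mdeg1 mulrnDr mulr1n scalerDl.
  by rewrite -scalerAl -scalerAr.
have [/eqP alm|alm] := boolP (al *+ mdeg m == 0); last first.
  have := lieD (mmap1 be m); rewrite dm (klinZ (extintP _ _ _)) => /eqP.
  by rewrite mulf_eq0 (negPf alm) => /eqP.
elim/mnm_ind: m nz_m alm => [|i m' _ _]; first by rewrite eqxx.
rewrite mdegD mdeg1 mulrnDr mulr1n => alm.
pose al_i := (X *m cmx n e) i 0.
have := lieD (al_i * mmap1 be m'); rewrite dmxM dm /al_i dmx_mulmx De.
rewrite mul_cmxP -/al_i mulrDl -scalerAl -scalerAr addrAC -scalerDl alm.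
by rewrite scale0r add0r mmap1D mmap1U.
Qed.

(** Translation by [H] fixes the coordinates [be] of [X e'] and adds them to those of [X e]. Hence a
    monomial [be i * m'] is the difference between the translate of [al_i * m'] and [al_i * m']
    itself. *)
Lemma ptinv_no_jordan (H : 'M[F]_n) (e e' : 'cV[F]_n) : ptinv H ->
  H *m e = e + e' -> H *m e' = e' -> e' = 0.
Proof.
move=> invH He He'; apply: vec_neq0 => m nz_m.
set be := fun i => _.
pose s : {rmorphism {mpoly F[n * n]} -> {mpoly F[n * n]}} :=
  evm (@mpolyC (n * n) F) (X *m cmx n H).
have sv (u : 'cV[F]_n) i : s ((X *m cmx n u) i 0) = (X *m cmx n (H *m u)) i 0.
  rewrite cmxM mulmxA !mxE rmorph_sum; apply: eq_bigr => l _.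
  by rewrite rmorphM /= evmX !mxE evmC.
have sm m' : s (mmap1 be m') = mmap1 be m'.
  rewrite /mmap1 rmorph_prod; apply: eq_bigr => i _.
  by rewrite rmorphXn /be /= sv He'.
elim/mnm_ind: m nz_m => [|i m' _ _]; first by rewrite eqxx.
pose al_i := (X *m cmx n e) i 0.
have : extint (s (al_i * mmap1 be m')) = extint (al_i * mmap1 be m').
  exact: invH.
rewrite rmorphM sm /al_i sv He.
rewrite -{1}[e]scale1r mul_cmxP scale1r mulrDl (klinD (extintP _ _ _)).
move=> /(congr1 (+%R (- extint ((X *m cmx n e) i 0 * mmap1 be m')))).
by rewrite addKr addNr mmap1D mmap1U.
Qed.

End Invariance.

(** * Splitting fields and absence of Jordan blocks *)

Lemma irreducible_factor (F : fieldType) (p : {poly F}) : (1 < size p)%N ->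
  exists2 q, irreducible_poly q & q %| p.
Proof.
move=> p_gt1; pose P m := `[< exists q : {poly F}, [/\ (1 < size q)%N, size q = m & q %| p] >].
have exP : exists m, P m by exists (size p); apply/asboolP; exists p.
case: (ex_minnP exP) => m /asboolP[q [q_gt1 sz_q q_p]] min_m.
exists q => //; split=> // d d_n1 d_q.
have nz_q : q != 0 by rewrite -size_poly_gt0 ltnW.
have nz_d : d != 0 by apply: contraNneq nz_q => d0; rewrite -dvd0p -d0.
rewrite -dvdp_size_eqp // eqn_leq dvdp_leq //= sz_q.
apply: min_m; apply/asboolP; exists d; split=> //; last exact: dvdp_trans q_p.
by rewrite ltn_neqAle eq_sym d_n1 size_poly_gt0.
Qed.

Lemma root_ext (F : fieldType) (p : {poly F}) : (1 < size p)%N ->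
  exists (F' : fieldType) (j : {rmorphism F -> F'}) (z : F'),
    root (map_poly j p) z.
Proof.
move=> /irreducible_factor[q irr_q q_p].
have [L _ [z qz _]] := irredp_FAdjoin irr_q.
exists L, (in_alg L), z; rewrite root_factor_theorem.
apply: dvdp_trans (_ : map_poly (in_alg L) q %| _).
  by rewrite -root_factor_theorem.
by rewrite dvdp_map.
Qed.

(** Two towers grow together: [K] stays finite over [k], while [F] contains both [K] and [L]. A root
    [z] of an irreducible factor over [k] is adjoined to [L]; the induction continues from the
    subfield [k(z)] of the new field. *)
Lemma split_ext (k L : fieldType) (j : {rmorphism k -> L}) (q : {poly k}) :
  q != 0 -> exists (K : fieldExtType k) (F : fieldType)
    (jL : {rmorphism L -> F}) (jK : {rmorphism K -> F}) (rs : seq K),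
  (forall c : k, jK c%:A = jL (j c)) /\
  map_poly (in_alg K) q %= \prod_(x <- rs) ('X - x%:P).
Proof.
have [m] := ubnP (size q); elim: m => // m IH in k L j q *.
rewrite ltnS => le_qm nz_q.
have [q_gt1|q_le1] := ltnP 1 (size q); last first.
  exists k^o, L, idfun, j, [::]; split=> [c|]; first by rewrite /GRing.scale /= mulr1.
  rewrite big_nil -size_poly_eq1 size_map_poly eqn_leq q_le1.
  by rewrite size_poly_gt0.
have [p irr_p p_q] := irreducible_factor q_gt1.
have [|F1 [j1 [z pz]]] := @root_ext L (map_poly j p).
  by rewrite size_map_poly; case: irr_p.
pose iota : {rmorphism k -> F1} := j1 \o j.
have {}pz : root (map_poly iota p) z by rewrite -map_poly_comp in pz.
pose K1 : fieldExtType k := SubFieldExtType pz irr_p.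
pose inj : {rmorphism K1 -> F1} := @subfx_inj k F1 iota z p.
have nz_p := irredp_neq0 irr_p.
have injA (c : k) : inj c%:A = iota c by apply: subfx_inj_base.
pose z1 : K1 := subfx_root iota z p.
have qz1 : root (map_poly (in_alg K1) q) z1.
  rewrite root_factor_theorem.
  apply: dvdp_trans (_ : map_poly (in_alg K1) p %| _); last by rewrite dvdp_map.
  rewrite -root_factor_theorem -(fmorph_root inj) -map_poly_comp.
  rewrite (eq_map_poly injA).
  suff -> : inj z1 = z by [].
  exact: subfx_inj_root.
have /dvdpP[q1 eq1] : ('X - z1%:P) %| map_poly (in_alg K1) q.
  by rewrite -root_factor_theorem.
have nz_q1 : q1 != 0.
  by apply: contraNneq nz_q => q10; rewrite -(map_poly_eq0 (in_alg K1)) eq1 q10 mul0r.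
have lt_q1 : (size q1 < m)%N.
  apply: leq_trans le_qm; rewrite -(size_map_poly (in_alg K1)) eq1.
  by rewrite size_Mmonic ?monicXsubC // size_XsubC addn2.
have [K2 [F [jF [jK [rs [jKA eq_rs]]]]]] := IH K1 F1 inj q1 lt_q1 nz_q1.
exists (baseFieldType K2), F, (jF \o j1), jK, (z1%:A :: rs).
have A2 (c : k) : in_alg (baseFieldType K2) c = in_alg K2 (in_alg K1 c).
  by rewrite /= baseField_scaleE.
split=> [c|].
  by have := A2 c; rewrite /= => ->; rewrite jKA -in_algE injA.
have -> : map_poly (in_alg (baseFieldType K2)) q
    = map_poly (in_alg K2) (map_poly (in_alg K1) q).
  by rewrite -map_poly_comp; apply: eq_map_poly.
rewrite eq1 rmorphM /= big_cons mulrC.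
rewrite rmorphB /= map_polyX map_polyC /=.
exact: eqp_mull.
Qed.

Section Diag.
Variables (F : fieldType) (n : nat).
Implicit Types D Y : 'M[F]_n.+1.

(** Without Jordan blocks, a repeated factor [D - x] can be cancelled in a product that kills a
    vector. So the product over the distinct roots already annihilates the space, and the minimal
    polynomial has simple roots. *)
Lemma diagonalizable_no_jordan D (rs : seq F) :
  char_poly D %= \prod_(x <- rs) ('X - x%:P) ->
  (forall (x : F) (v : 'cV_n.+1),
     (D - x%:M) *m ((D - x%:M) *m v) = 0 -> (D - x%:M) *m v = 0) ->
  diagonalizable D.
Proof.
move=> char_rs ss.
pose Q s := horner_mx D (\prod_(x <- s) ('X - x%:P)).
have QS x s : Q (x :: s) = (D - x%:M) * Q s.
  by rewrite /Q big_cons rmorphM rmorphB /= horner_mx_X horner_mx_C.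
have QC x s : Q (x :: s) = Q s * (D - x%:M).
  by rewrite /Q big_cons mulrC rmorphM rmorphB /= horner_mx_X horner_mx_C.
have Qundup s (v : 'cV_n.+1) : Q s *m v = 0 -> Q (undup s) *m v = 0.
  elim: s v => [//|x s IH] v /=.
  rewrite QC -mulmxA => /IH; case: ifP => [xs|_]; last first.
    by rewrite mulmxA -[_ *m _ *m v]/((_ * _) *m v) -QC.
  have /perm_to_rem pe : x \in undup s by rewrite mem_undup.
  have -> : Q (undup s) = Q (x :: rem x (undup s)).
    by congr (horner_mx D _); apply: perm_big.
  rewrite {1}QC {1}QS -!mulmxA => h.
  set w := Q (rem x (undup s)) *m v.
  have : (D - x%:M) *m ((D - x%:M) *m w) = 0.
    have eC : (D - x%:M) *m Q (rem x (undup s)) = Q (rem x (undup s)) *m (D - x%:M).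
      exact: etrans (esym (QS _ _)) (QC _ _).
    by rewrite /w [(D - _) *m (Q _ *m v)]mulmxA eC -mulmxA mulmxA eC -mulmxA.
  by move/ss.
apply/diagonalizableP; exists (undup rs); first exact: undup_uniq.
apply: mxminpoly_min; rewrite -/(Q _).
have Q0 : Q rs = 0.
  apply/mxminpoly_minP.
  rewrite -(eqp_dvdr _ char_rs); exact: mxminpoly_dvd_char.
apply/matrixP=> i j; rewrite [RHS]mxE.
have := Qundup rs (delta_mx j 0); rewrite Q0 mul0mx => /(_ erefl).
by rewrite -colE => /matrixP/(_ i 0); rewrite mxE [RHS]mxE.
Qed.

(** Write the characteristic polynomial as [q X^m] with [q(0)] nonzero. A root of [q] in an
    extension is a nonzero eigenvalue; if [q] is constant, [Y] is nilpotent and its last nonzero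
    power provides [v]. *)
Lemma eigenvector_or_nilpotent Y : Y != 0 ->
  (exists2 v : 'cV_n.+1, Y *m v != 0 & Y *m (Y *m v) = 0) \/
  exists (F' : fieldType) (j : {rmorphism F -> F'}) (y : F') (v : 'cV_n.+1),
    [/\ y != 0, v != 0 & map_mx j Y *m v = y *: v].
Proof.
move=> nz_Y; have [m [q nz_q eq_char]] := multiplicity_XsubC (char_poly Y) 0.
rewrite polyC0 subr0 in eq_char.
have nz_char : char_poly Y != 0 by rewrite monic_neq0 ?char_poly_monic.
rewrite nz_char /= in nz_q.
have [q_gt1|q_le1] := ltnP 1 (size q).
  right; have [F' [j [y qy]]] := root_ext q_gt1.
  have nz_y : y != 0.
    apply: contraNneq nz_q => y0; move: qy; rewrite y0 -(rmorph0 j).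
    by rewrite fmorph_root.
  have : eigenvalue (map_mx j Y)^T y.
    rewrite eigenvalue_root_char.
    have -> : char_poly (map_mx j Y)^T = map_poly j (char_poly Y).
      rewrite map_char_poly /char_poly -det_tr; congr (\det _).
      by apply/matrixP=> r s; rewrite !mxE eq_sym.
    by rewrite eq_char rmorphM rootM qy.
  case/eigenvalueP=> u Yu nz_u; exists F', j, y, u^T; split=> //.
    by rewrite trmx_eq0.
  by rewrite -[map_mx j Y]trmxK -trmx_mul Yu linearZ.
left.
have nilY : Y ^+ m = 0.
  have [c nz_c eq_c] : exists2 c, c != 0 & q = c%:P.
    by apply/size_poly1P; move: q_le1; rewrite leq_eqVlt ltnS leqn0 size_poly_eq0;
      case: eqP => //= _; case: eqP nz_q => // ->; rewrite root0.
  have := Cayley_Hamilton Y; rewrite eq_char eq_c rmorphM /= horner_mx_C.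
  rewrite rmorphXn /= horner_mx_X -[c%:M * _]/(_ *m _) mul_scalar_mx => /eqP.
  by rewrite scaler_eq0 (negPf nz_c) => /eqP.
have [d [nz_d d0]] : exists d, Y ^+ d.+1 != 0 /\ Y ^+ d.+2 = 0.
  elim: m nilY {eq_char} => [|[|m] IH].
  - by rewrite expr0 => /eqP; rewrite oner_eq0.
  - by rewrite expr1 => Y0; rewrite Y0 eqxx in nz_Y.
  - by move=> Y2; have [/IH //|nz] := eqVneq (Y ^+ m.+1) 0; exists m.
have [j nz_j] : exists j, col j (Y ^+ d.+1) != 0.
  apply: contra_notP (negP nz_d) => /forallNP h; apply/eqP/matrixP=> r s.
  have /negP/negPn/eqP/matrixP/(_ r 0) := h s.
  by rewrite !mxE.
have eY e : Y *m (Y ^+ e *m delta_mx j 0) = Y ^+ e.+1 *m delta_mx j (0 : 'I_1).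
  by rewrite mulmxA -[Y *m _]/(_ * _) -exprS.
exists (Y ^+ d *m delta_mx j 0); first by rewrite eY -colE.
by rewrite !eY d0 mul0mx.
Qed.

End Diag.

(** * Structure of the Lie algebra *)

Section LieTheory.
Variables (k : fieldType) (n : nat) (G : finSubgroupSL k n.+1).
Local Notation A := (coord_ring G).
Local Notation g := (univ_point G).
Local Notation ev := (evm (in_alg A) g).
Variable int : A -> k.
Hypothesis hint : klin (idfun : {rmorphism k -> k}) int.
Hypothesis int1 : int 1 = 1.
Variable b : kbasis A.

Lemma dmx_map (F F' : fieldType) (j : {rmorphism F -> F'}) (D : 'M[F]_n.+1) p :
  dmx (map_mx j D) (map_mpoly j p) = map_mpoly j (dmx D p).
Proof.
rewrite !dmxE rmorph_sum; apply: eq_bigr => r _.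
rewrite rmorph_sum; apply: eq_bigr => s _; rewrite rmorphM /=; congr (_ * _).
  rewrite !mxE rmorph_sum; apply: eq_bigr => l _.
  by rewrite rmorphM /= !mxE /= map_mpolyX map_mpolyC.
by apply/mpolyP=> m; rewrite [RHS]mcoeff_map_mpoly !mcoeff_mderiv mcoeff_map_mpoly raddfMn.
Qed.

Lemma lie_map (F F' : fieldType) (iota : {rmorphism k -> F})
    (j : {rmorphism F -> F'}) (D : 'M[F]_n.+1) :
  lie int iota D -> lie int (j \o iota) (map_mx j D).
Proof.
move=> lieD; apply: lieE => f.
have -> : map_mpoly (j \o iota) f = map_mpoly j (map_mpoly iota f).
  by apply/mpolyP=> m; rewrite !mcoeff_map_mpoly.
rewrite dmx_map.
have extj p : extint g int (j \o iota) (map_mpoly j p) = j (extint g int iota p).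
  rewrite [p]mpolyE rmorph_sum !(klin_sum (extintP _ _ _)) rmorph_sum.
  apply: eq_bigr => m _; rewrite /= map_mpolyZ map_mpolyX.
  by rewrite !(klinZ (extintP _ _ _)) rmorphM /extint !mlinX.
by rewrite extj lieD rmorph0.
Qed.

Lemma lie_scalars (F : fieldType) (iota : {rmorphism k -> F}) (E : 'M[k]_n.+1) :
  (forall f, int (ev (dmx E f)) = 0) -> lie int iota (map_mx iota E).
Proof. by move=> intE; apply: lieE => f; rewrite dmx_map extint_map // intE rmorph0. Qed.

(** Expand the entries of [D] in a basis [t] of the [k]-space that they span. Tested on polynomials
    over [k], the condition [lie] becomes a relation between the [t s] with coefficients in [k], so
    each coefficient vanishes. *)
Lemma lie_descent (F : fieldType) (iota : {rmorphism k -> F}) (D : 'M[F]_n.+1) :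
  lie int iota D -> exists m (t : 'I_m -> F) (E : 'I_m -> 'M[k]_n.+1),
    (forall s f, int (ev (dmx (E s) f)) = 0) /\
    D = \sum_s t s *: map_mx iota (E s).
Proof.
move=> lieD.
pose entries : seq (via iota) := [seq D p.1 p.2 | p : 'I_n.+1 * 'I_n.+1].
have [m [t [free_t span_t]]] := free_family_exists entries.
have /choice[c cE] : forall p : 'I_n.+1 * 'I_n.+1, exists c : 'I_m -> k,
    D p.1 p.2 = \sum_s iota (c s) * t s.
  move=> p; have [|c cE] := span_t (D p.1 p.2); first exact: image_f.
  by exists c.
exists m, t, (fun s => \matrix_(i, j) c (i, j) s).
have DE : D = \sum_s t s *: map_mx iota (\matrix_(i, j) c (i, j) s).
  apply/matrixP=> i j; rewrite summxE (cE (i, j)).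
  by apply: eq_bigr => s _; rewrite !mxE mulrC.
split=> // s f; move: s; apply: free_t.
rewrite -[RHS](lieD (map_mpoly iota f)).
have -> : dmx D (map_mpoly iota f) =
    \sum_s t s *: map_mpoly iota (dmx (\matrix_(i, j) c (i, j) s) f).
  rewrite {1}DE dmx_suml; apply: eq_bigr => s _.
  by rewrite dmx_map.
rewrite (klin_sum (extintP _ _ _)); apply: eq_bigr => s _.
by rewrite (klinZ (extintP _ _ _)) extint_map // mulrC.
Qed.

End LieTheory.

Section LieDiag.
Variables (k : fieldType) (n : nat) (G : finSubgroupSL k n.+1).
Local Notation A := (coord_ring G).
Variable int : A -> k.
Hypothesis hint : klin (idfun : {rmorphism k -> k}) int.
Hypothesis int1 : int 1 = 1.
Variable b : kbasis A.

Section OneField.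
Variables (F : fieldType) (iota : {rmorphism k -> F}).
Implicit Types D Y : 'M[F]_n.+1.

Lemma lie_semisimple D x (v : 'cV_n.+1) : lie int iota D ->
  (D - x%:M) *m ((D - x%:M) *m v) = 0 -> (D - x%:M) *m v = 0.
Proof.
move=> lieD DDv; apply: (lie_no_jordan hint int1 b lieD (e := v) (al := x)).
  by rewrite mulmxBl mul_scalar_mx addrC subrK.
apply/eqP; rewrite -subr_eq0; apply/eqP; move: DDv.
by rewrite [in X in X -> _]mulmxBl mul_scalar_mx.
Qed.

Lemma lie_diagonalizable D (rs : seq F) : lie int iota D ->
  char_poly D %| \prod_(x <- rs) ('X - x%:P) -> diagonalizable D.
Proof.
move=> lieD /dvdp_prod_XsubC[m eqD].
apply: diagonalizable_no_jordan eqD _ => x v; exact: lie_semisimple.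
Qed.

(** If [Y v = y v] with [y] nonzero, then [Y (D v) = y (D v) - al y v], so [D v] and [v] would span
    a Jordan block of [Y]. A nonzero [Y] with no such eigenvalue in any extension has a nilpotent
    block instead, which is excluded as well. *)
Lemma lie_eigen_bracket D Y al : lie int iota D -> lie int iota Y ->
  D *m Y - Y *m D = al *: Y -> al != 0 -> Y = 0.
Proof.
move=> lieD lieY DY nz_al; apply/eqP/contraT => nz_Y.
have [[v nz_Yv YYv]|[F' [j [y [v [nz_y nz_v Yv]]]]]] := eigenvector_or_nilpotent nz_Y.
  have := lie_semisimple (x := 0) (v := v) lieY.
  rewrite raddf0 subr0 => /(_ YYv) Yv.
  by rewrite Yv eqxx in nz_Yv.
have lieY' := lie_map j lieY.
set D' := map_mx j D; set Y' := map_mx j Y in lieY' Yv.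
have DY' : D' *m Y' - Y' *m D' = j al *: Y'.
  by rewrite -!map_mxM -map_mxB DY map_mxZ.
have YD : Y' *m D' = D' *m Y' - j al *: Y' by rewrite -DY' opprB addrC subrK.
have : - (j al * y) *: v = 0.
  apply: (lie_no_jordan hint int1 b lieY' (e := D' *m v) (al := y)).
    rewrite mulmxA YD mulmxBl -mulmxA Yv -scalemxAl Yv -scalemxAr.
    by rewrite scalerA scaleNr.
  by rewrite -scalemxAr Yv scalerA mulrC -scalerA.
by move/eqP; rewrite scaler_eq0 (negPf nz_v) oppr_eq0 mulf_eq0 fmorph_eq0
  (negPf nz_al) (negPf nz_y).
Qed.

(** In an eigenbasis of [D], the bracket with [D] multiplies the entry [(i, j)] by [d_i - d_j]. So
    [[D, Y]] has no entry where [d_i = d_j], and [main] shows that such an element of the Lie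
    algebra is 0. *)
Lemma lie_comm D Y : lie int iota D -> lie int iota Y -> diagonalizable D ->
  comm_mx D Y.
Proof.
move=> lieD lieY [P Pu /(similar_diagPex)[d /(similarP Pu) PD]].
pose hat Z := P *m Z *m invmx P.
have hatB Z al : hat (D *m Z - Z *m D - al *: Z) =
   \matrix_(i, j) ((d 0 i - d 0 j - al) * hat Z i j).
  have -> : hat (D *m Z - Z *m D - al *: Z) =
      diag_mx d *m hat Z - hat Z *m diag_mx d - al *: hat Z.
    rewrite /hat !mulmxBr !mulmxBl -scalemxAr -scalemxAl; congr (_ - _ - _).
      by rewrite mulmxA PD -!mulmxA.
    by rewrite -!mulmxA -[diag_mx d]mulmx1 -(mulmxV Pu) [diag_mx d *m _]mulmxA
      -PD -!mulmxA (mulmxA (invmx P)) mulVmx // mul1mx.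
  by apply/matrixP=> i j; rewrite mul_diag_mx mul_mx_diag !mxE; ring.
have hat_inj Z : hat Z = 0 -> Z = 0.
  move=> hZ; rewrite -[Z]mul1mx -(mulVmx Pu) -[Z]mulmx1 -(mulVmx Pu).
  by rewrite -!mulmxA (mulmxA P) [P *m _ *m (_ *m _)]mulmxA -/(hat Z) hZ mul0mx mulmx0.
pose supp Z := [set p : 'I_n.+1 * 'I_n.+1 | hat Z p.1 p.2 != 0].
have main m : forall Z, (#|supp Z| < m)%N -> lie int iota Z ->
    (forall i j, d 0 i = d 0 j -> hat Z i j = 0) -> Z = 0.
  elim: m => [//|m IH] Z; rewrite ltnS => le_m lieZ Zd.
  apply/eqP/contraT => nz_Z.
  have [[i j] nz_ij] : exists p : 'I_n.+1 * 'I_n.+1, hat Z p.1 p.2 != 0.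
    apply: contra_notP (negP nz_Z) => /forallNP h; apply/eqP/hat_inj/matrixP=> i j.
    by rewrite [RHS]mxE; apply/eqP/negPn/negP/(h (i, j)).
  have nz_al : d 0 i - d 0 j != 0.
    by rewrite subr_eq0; apply: contraNneq nz_ij => /Zd /= ->.
  (* Subtracting [(d_i - d_j) Z] erases the entry [(i, j)], so induction on the support applies.
     Then [Z] is an eigenvector of the bracket for a nonzero eigenvalue. *)
  have Z'0 : D *m Z - Z *m D - (d 0 i - d 0 j) *: Z = 0.
    apply: IH.
    - apply: leq_trans le_m; apply: proper_card; apply/properP; split.
        by apply/fintype.subsetP=> -[r s]; rewrite !inE hatB mxE mulf_eq0 negb_or => /andP[].
      by exists (i, j); rewrite !inE // hatB mxE subrr mul0r eqxx.
    - rewrite -scaleNr [_ + _ *: _]addrC.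
      exact: (lieP _ lieZ (lie_bracket lieD lieZ)).
    - by move=> r s drs; rewrite hatB mxE Zd // mulr0.
  rewrite -(negPf nz_Z); apply/eqP; apply: lie_eigen_bracket lieD lieZ _ nz_al.
  by apply/eqP; rewrite -subr_eq0; apply/eqP.
have : D *m Y - Y *m D = 0.
  apply: (main _ _ (ltnSn _)); first exact: lie_bracket.
  move=> i j dij; have := hatB Y 0; rewrite scale0r subr0 => ->.
  by rewrite mxE dij subrr subr0 mul0r.
by move/eqP; rewrite subr_eq0 => /eqP.
Qed.

End OneField.

(** By descent [D] is a combination over [F] of commuting matrices over [k] that diagonalize
    together over a finite extension. Hence the eigenforms live over [K], although the eigenvalues
    of [D] are only in [F']. Trace 0 forces a second nonzero eigenvalue. *)
Lemma lie_eigenforms (F : fieldType) (iota : {rmorphism k -> F}) (D : 'M[F]_n.+1) :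
  lie int iota D -> \tr D = 0 -> D != 0 ->
  exists (K : fieldExtType k) (F' : fieldType) (jF : {rmorphism F -> F'})
    (jK : {rmorphism K -> F'}) (l1 l2 : 'rV[K]_n.+1) (d1 d2 : F'),
  [/\ forall c : k, jK c%:A = jF (iota c),
      (l1 != 0) && ~~ (l2 <= l1)%MS, (d1 != 0) && (d2 != 0),
      map_mx jK l1 *m map_mx jF D = d1 *: map_mx jK l1 &
      map_mx jK l2 *m map_mx jF D = d2 *: map_mx jK l2].
Proof.
move=> lieD trD nz_D.
have [m [t [E [lieE DE]]]] := lie_descent hint lieD.
pose q := \prod_(s < m) char_poly (E s).
have nz_q : q != 0.
  by apply/prodf_neq0 => s _; rewrite monic_neq0 ?char_poly_monic.
have [K [F' [jF [jK [rs [jKA eq_rs]]]]]] := split_ext iota nz_q.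
pose EK s : 'M[K]_n.+1 := map_mx (in_alg K) (E s).
have lieK s : lie int (in_alg K) (EK s).
  exact (@lie_scalars k n G int hint K (in_alg K) (E s) (lieE s)).
have diagE s : diagonalizable (EK s).
  apply: (lie_diagonalizable (lieK s) (rs := rs)).
  rewrite -(eqp_dvdr _ eq_rs) -map_char_poly dvdp_map /q (bigD1 s) //=.
  exact: dvdp_mulr.
have [P Pu /allP EP] : codiagonalizable [seq EK s | s : 'I_m].
  apply/codiagonalizableP; split=> [_ _ /mapP[s _ ->] /mapP[r _ ->]|_ /mapP[s _ ->]] //.
  exact: lie_comm.
have /choice[d dE] : forall s, exists d, P *m EK s = diag_mx d *m P.
  move=> s; have /EP : EK s \in [seq EK s | s : 'I_m] by apply: map_f; rewrite mem_enum.
  by move=> /similar_diagPex[d /(similarP Pu)]; exists d.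
pose P' := map_mx jK P; have Pu' : P' \in unitmx by rewrite map_unitmx.
pose dl : 'rV[F']_n.+1 := \sum_s jF (t s) *: map_mx jK (d s).
have PD : P' *m map_mx jF D = diag_mx dl *m P'.
  rewrite DE raddf_sum mulmx_sumr /dl raddf_sum mulmx_suml; apply: eq_bigr => s _ /=.
  rewrite map_mxZ -scalemxAr linearZ -scalemxAl; congr (_ *: _).
  have -> : map_mx jF (map_mx iota (E s)) = map_mx jK (EK s).
    by apply/matrixP=> i j; rewrite !mxE jKA.
  by rewrite -map_mxM dE map_mxM map_diag_mx.
have rowPD i : map_mx jK (row i P) *m map_mx jF D = dl 0 i *: map_mx jK (row i P).
  by rewrite map_row -row_mul PD row_mul row_diag_mx -scalemxAl -rowE.
have tr_dl : \sum_i dl 0 i = 0.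
  have := mxtrace_mulC (P' *m map_mx jF D) (invmx P').
  rewrite mulmxA mulVmx // mul1mx PD mulmxK // mxtrace_diag => ->.
  by rewrite trace_map_mx trD rmorph0.
have [i nz_i] : exists i, dl 0 i != 0.
  apply: contra_notP (negP nz_D) => /forallNP dl0.
  rewrite -(map_mx_eq0 jF) -(mulKmx Pu' (map_mx jF D)) PD.
  suff -> : dl = 0 by rewrite linear0 mul0mx mulmx0.
  by apply/rowP=> i; rewrite mxE; apply/eqP/negPn/negP/dl0.
have [i' ne_i' nz_i'] : exists2 i', i' != i & dl 0 i' != 0.
  apply: contraPP tr_dl => /forall2NP dl0; rewrite (bigD1 i) //= big1 ?addr0 => [|r nri].
    exact/eqP.
  by have [|/negP/negPn/eqP] := dl0 r.
exists K, F', jF, jK, (row i P), (row i' P), (dl 0 i), (dl 0 i'); split=> //.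
  have delta_eq c : delta_mx 0 i' *m P = c *: (delta_mx 0 i *m P) -> False.
    rewrite scalemxAl => /(can_inj (mulmxK Pu))/matrixP/(_ 0 i').
    by rewrite !mxE !eqxx (negPf ne_i') mulr0 => /eqP; rewrite oner_eq0.
  apply/andP; split; last by apply/negP => /sub_rVP[c]; rewrite !rowE => /delta_eq.
  apply/eqP; rewrite rowE => /(congr1 (mulmx^~ (invmx P))).
  rewrite mulmxK // mul0mx => /matrixP/(_ 0 i); rewrite !mxE !eqxx => /eqP.
  by rewrite oner_eq0.
by rewrite nz_i nz_i'.
Qed.

End LieDiag.

(** * Stabilizers of points *)

Section PolyFunctional.
Variable F : fieldType.

(** The linear functional on polynomials with moments [f]. For [f i = phi (a ^+ i * b)] it plays the
    role of [phi (q(a) b)], where the coefficients of [q] lie in [F] and not in [k]. *)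
Definition polyfun (f : nat -> F) (q : {poly F}) : F :=
  \sum_(i < size q) q`_i * f i.

Lemma polyfunwE f (q : {poly F}) m : (size q <= m)%N -> polyfun f q = \sum_(i < m) q`_i * f i.
Proof.
move=> le_qm; rewrite /polyfun (big_ord_widen _ (fun i => q`_i * f i) le_qm).
rewrite big_mkcond; apply: eq_bigr => i _ /=; case: ltnP => // le_qi.
by rewrite nth_default ?mul0r.
Qed.

Lemma polyfunZ f c (q : {poly F}) : polyfun f (c *: q) = c * polyfun f q.
Proof.
rewrite (@polyfunwE f (c *: q) (size q)) ?size_scale_leq // mulr_sumr.
by apply: eq_bigr => i _; rewrite coefZ mulrA.
Qed.

Lemma polyfun_XsubC f x (q : {poly F}) :
  polyfun f (('X - x%:P) * q) = polyfun (fun i => f i.+1 - x * f i) q.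
Proof.
have sz : (size (('X - x%:P) * q)%R <= (size q).+1)%N.
  by rewrite (leq_trans (size_polyMleq _ _)) // size_XsubC.
rewrite (polyfunwE f sz) mulrBl.
have -> : \sum_(i < (size q).+1) ('X * q - x%:P * q)`_i * f i =
    \sum_(i < (size q).+1) ('X * q)`_i * f i - \sum_(i < (size q).+1) x * q`_i * f i.
  by rewrite -sumrB; apply: eq_bigr => i _; rewrite coefB coefCM mulrBl.
rewrite big_ord_recl coefXM eqxx mul0r add0r big_ord_recr /= [q`__]nth_default //.
rewrite mulr0 mul0r addr0 -sumrB; apply: eq_bigr => i _.
by rewrite coefXM mulrBr mulrCA mulrA.
Qed.

End PolyFunctional.

Section Stabilizer.
Variables (k : fieldType) (n : nat) (G : finSubgroupSL k n).
Local Notation A := (coord_ring G).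
Local Notation g := (univ_point G).
Variables (F : fieldType) (iota : {rmorphism k -> F}).
Local Notation eps := (fun a : A => iota (counit G a)).

(* The functionals on [A (x) F] killing the ideal of the stabilizer of [xi]. *)
Definition stabfun (xi : 'cV[F]_n) (phi : A -> F) : Prop :=
  klin iota phi /\
  forall a i, \sum_j phi (a * (g i j - (i == j)%:R)) * xi j 0 = 0.

(** The dual of the algebra of the stabilizer is the line of the counit, so this algebra is [F].
    Both points and nilpotents of the stabilizer are detected. *)
Definition trivstab (xi : 'cV[F]_n) : Prop :=
  forall phi, stabfun xi phi -> forall a, phi a = phi 1 * eps a.

Definition point (h : A -> F) : Prop :=
  klin iota h /\ h 1 = 1 /\ forall a b, h (a * b) = h a * h b.

Definition epsder (lam : A -> F) : Prop :=
  klin iota lam /\ forall a b, lam (a * b) = eps a * lam b + lam a * eps b.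

Lemma klin_eps : klin iota eps.
Proof. by move=> c a b; rewrite linearP rmorphD rmorphM. Qed.

Lemma epsM a b : eps (a * b) = eps a * eps b.
Proof. exact: etrans (congr1 iota (rmorphM (counit G) a b)) (rmorphM iota _ _). Qed.

Lemma eps1 : eps 1 = 1.
Proof. exact: etrans (congr1 iota (rmorph1 (counit G))) (rmorph1 iota). Qed.

Lemma eps_g i j : eps (g i j) = (i == j)%:R.
Proof.
have /matrixP/(_ i j) := map_counit G; rewrite !mxE => ->.
by rewrite rmorph_nat.
Qed.

Lemma stabfun_eps xi : stabfun xi eps.
Proof.
split=> [|a i]; first exact: klin_eps.
apply: big1 => j _; rewrite epsM rmorphB rmorph_nat rmorphB eps_g rmorph_nat subrr.
by rewrite mulr0 mul0r.
Qed.

Lemma klin_lin c (f f' : A -> F) : klin iota f -> klin iota f' ->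
  klin iota (fun a => f a + c * f' a).
Proof. by move=> hf hf' a u v; rewrite hf hf'; ring. Qed.

Lemma stabfun_lin xi c f f' : stabfun xi f -> stabfun xi f' ->
  stabfun xi (fun a => f a + c * f' a).
Proof.
move=> [lf f0] [lf' f'0]; split=> [|a i]; first exact: klin_lin.
under eq_bigr => j _ do rewrite mulrDl -mulrA.
by rewrite big_split /= -mulr_sumr f0 f'0 mulr0 addr0.
Qed.

Lemma stabfun_mul xi a f : stabfun xi f -> stabfun xi (fun b => f (a * b)).
Proof.
move=> [lf f0]; split=> [c u v|b i].
  by rewrite mulrDr -scalerAr lf.
by rewrite -[RHS](f0 (a * b) i); apply: eq_bigr => j _; rewrite mulrA.
Qed.

Definition epsmul (phi : A -> F) : Prop := exists c, forall a, phi a = c * eps a.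
(** Multiplication by [a] preserves the span of [phi] and the counit: modulo the counit, [phi] is an
    eigenvector with eigenvalue [r]. *)
Definition triang (phi : A -> F) (a : A) : Prop :=
  exists r c, forall b, phi (a * b) = r * phi b + c * eps b.

(** The product of the factors [a - x] kills [phi]. Applying them one by one, the last functional
    that is not a multiple of the counit is triangular for [a]. Triangularity for earlier elements
    survives because multiplications commute. *)
Lemma triang_step xi phi a (p : {poly k}) (rs : seq F) (T : seq A) :
  (map_poly (in_alg A) p).[a] = 0 ->
  map_poly iota p %= \prod_(x <- rs) ('X - x%:P) ->
  stabfun xi phi -> ~ epsmul phi -> (forall t, t \in T -> triang phi t) ->
  exists psi, [/\ stabfun xi psi, ~ epsmul psi &
    forall t, t \in a :: T -> triang psi t].
Proof.
move=> pa0 eq_p Sphi nphi Tphi.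
have {pa0 eq_p} : forall b, polyfun (fun i => phi (a ^+ i * b))
    (\prod_(x <- rs) ('X - x%:P)) = 0.
  move=> b; have /eqpP[[c1 c2] /andP[/= nz1 nz2] eqc] := eq_p.
  apply: (mulfI nz2); rewrite mulr0 -polyfunZ -eqc polyfunZ.
  have [lphi _] := Sphi.
  suff -> : polyfun (fun i => phi (a ^+ i * b)) (map_poly iota p) =
      phi ((map_poly (in_alg A) p).[a] * b).
    by rewrite pa0 mul0r (klin0 lphi) mulr0.
  rewrite (@polyfunwE _ _ _ (size p)) ?size_map_poly //.
  rewrite (@horner_coef_wide _ (size p)); last exact: size_poly.
  rewrite mulr_suml (klin_sum lphi); apply: eq_bigr => i _.
  rewrite !coef_map_id0 ?rmorph0 //=.
  by rewrite -mulrA mulr_algl (klinZ lphi).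
elim: rs phi Sphi nphi Tphi => [|x rs IH] phi Sphi nphi Tphi rs0.
  case: nphi; exists 0 => b; have := rs0 b.
  by rewrite big_nil /polyfun size_poly1 big_ord1 coef1 mul1r expr0 mul1r mul0r.
pose psi b := phi (a * b) + (- x) * phi b.
have [[c psic]|npsi] := pselect (epsmul psi).
  exists phi; split=> // t; rewrite inE => /predU1P[->|/Tphi//].
  by exists x, c => b; rewrite -psic /psi mulNr addrC subrK.
apply: IH npsi _ _.
- exact: stabfun_lin (stabfun_mul _ Sphi) Sphi.
- move=> t /Tphi[r [c tE]]; exists r, (c * (eps a - x)) => b.
  by rewrite /psi mulrCA !tE epsM; ring.
move=> b; have := rs0 b; rewrite big_cons polyfun_XsubC => <-.
congr polyfun; apply/funext => i.
by rewrite /psi exprS mulrA mulNr.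
Qed.

Lemma triang_closed phi : klin iota phi ->
  (forall i j, triang phi (g i j)) -> forall a, triang phi a.
Proof.
move=> lphi tri_g a; pose S := [pred a | `[< triang phi a >]].
suff : a \in S by rewrite inE => /asboolP.
apply: (@univ_point_gen k n G S) => [|i j]; last by rewrite inE; apply/asboolP.
split=> [|c u v|u v]; rewrite !inE.
- by apply/asboolP; exists 1, 0 => b; rewrite !mul1r mul0r addr0.
- move=> /asboolP[r [d ru]] /asboolP[s [e sv]]; apply/asboolP.
  exists (iota c * r + s), (iota c * d + e) => b.
  by rewrite mulrDl -scalerAl lphi ru sv; ring.
- move=> /asboolP[r [d ru]] /asboolP[s [e sv]]; apply/asboolP.
  exists (r * s), (r * e + d * eps v) => b.
  by rewrite -[u * v * b]mulrA ru sv epsM; ring.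
Qed.

Hypothesis split_g : forall i j, exists (p : {poly k}) (rs : seq F),
  (map_poly (in_alg A) p).[g i j] = 0 /\
  map_poly iota p %= \prod_(x <- rs) ('X - x%:P).

Lemma stabfun_triang xi : ~ trivstab xi ->
  exists phi, [/\ stabfun xi phi, ~ epsmul phi & forall a, triang phi a].
Proof.
move=> ntriv.
have [phi [Sphi nphi]] : exists phi, stabfun xi phi /\ ~ epsmul phi.
  move: ntriv; rewrite /trivstab -existsNE => -[phi].
  move=> /not_implyP[Sphi nphi]; exists phi; split=> // -[c phiE].
  by apply: nphi => a; rewrite !phiE eps1 mulr1.
have [psi [Spsi npsi tri]] : exists psi, [/\ stabfun xi psi, ~ epsmul psi &
    forall t, t \in [seq g p.1 p.2 | p : 'I_n * 'I_n] -> triang psi t].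
  rewrite /image_mem; elim: (enum _) => [|p s [psi [Spsi npsi tri]]].
    by exists phi.
  have [q [rs [q0 qs]]] := split_g p.1 p.2.
  exact: triang_step q0 qs Spsi npsi tri.
exists psi; split=> //; apply: triang_closed => [|i j]; first by case: Spsi.
by apply: tri; apply: (image_f (fun p : 'I_n * 'I_n => g p.1 p.2) (x := (i, j))).
Qed.

(** The rule [phi (a b) = h a * phi b + c a * eps b] describes a plane stable under [k[G]], on which
    [h] is a character and [c] a cocycle. If [h] is the counit, [c] is the tangent vector. Otherwise
    the plane splits, and its second eigenline is spanned by [h], which therefore kills the ideal of
    the stabilizer. *)
Lemma nontrivial_stab xi : ~ trivstab xi ->
  (exists h, [/\ point h, map_mx h g *m xi = xi & map_mx h g != 1%:M]) \/
  (exists lam, [/\ epsder lam, map_mx lam g *m xi = 0 & map_mx lam g != 0]).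
Proof.
move=> /stabfun_triang[phi [Sphi nphi tri]].
have [lphi _] := Sphi.
have /choice[h /choice[c hc]] := tri.
have uniq r r' d d' : (forall b, r * phi b + d * eps b = r' * phi b + d' * eps b) ->
    r = r' /\ d = d'.
  move=> e; have er : r = r'.
    apply/eqP; rewrite -subr_eq0; apply/contraT => nz_r; case: nphi.
    exists ((d' - d) / (r - r')) => b; apply: (mulfI nz_r).
    rewrite mulrA mulrCA divff // mulr1 mulrBl mulrBl.
    apply/eqP; rewrite subr_eq addrAC eq_sym subr_eq eq_sym addrC e.
    by rewrite addrC.
  by split=> //; have := e 1; rewrite er eps1 !mulr1 => /addrI.
have hlin a u v : h (a *: u + v) = iota a * h u + h v /\
    c (a *: u + v) = iota a * c u + c v.
  by apply: uniq => b; rewrite -hc mulrDl -scalerAl lphi !hc; ring.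
have hmul u v : h (u * v) = h u * h v /\ c (u * v) = h u * c v + c u * eps v.
  by apply: uniq => b; rewrite -hc -mulrA !hc epsM; ring.
have h1 : h 1 = 1 /\ c 1 = 0.
  by apply: uniq => b; rewrite -hc !mul1r mul0r addr0.
have hpt : point h.
  by split=> [a u v|]; [case: (hlin a u v) | split=> [|a b]; [case: h1 | case: (hmul a b)]].
have [eqh|/existsNP[a0 /eqP neh]] := pselect (forall a, h a = eps a).
  right.
  have lam1 : c 1 = 0 by case: h1.
  have cphi a : c a = phi a + (- phi 1) * eps a.
    by have := hc a 1; rewrite mulr1 eps1 mulr1 eqh => ->; ring.
  have dc : epsder c.
    split=> [a u v|a b]; first by case: (hlin a u v).
    by case: (hmul a b) => _ ->; rewrite eqh.
  have [_ Sc] : stabfun xi c.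
    have -> : c = (fun a => phi a + (- phi 1) * eps a) by apply/funext.
    exact: stabfun_lin Sphi (stabfun_eps _).
  exists c; split=> //.
    apply/matrixP=> i j; rewrite ord1 !mxE -[RHS](Sc 1 i).
    apply: eq_bigr => l _; rewrite mxE mul1r.
    have [lc _] := dc; congr (_ * _).
    rewrite -scaleN1r addrC lc.
    by have := klinZ lc (i == l)%:R 1; rewrite lam1 mulr0 scaler_nat => ->; rewrite mulr0 add0r.
  apply/eqP => c0; case: nphi; exists (phi 1) => a.
  have : c a = 0; last by rewrite cphi mulNr => /eqP; rewrite subr_eq0 => /eqP.
  pose S := [pred a | c a == 0].
  suff : a \in S by rewrite inE => /eqP.
  apply: (@univ_point_gen k n G S) => [|i j]; last first.
    by rewrite inE; have /matrixP/(_ i j) := c0; rewrite !mxE => ->.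
  split=> [|r u v|u v]; rewrite !inE ?lam1 // => /eqP cu /eqP cv.
    by case: (hlin r u v) => _ ->; rewrite cu cv mulr0 addr0.
  by case: (hmul u v) => _ ->; rewrite cu cv mulr0 mul0r addr0.
left; exists h; have nz : h a0 - eps a0 != 0 by rewrite subr_eq0.
(* With this shift [psi] becomes an eigenvector of [a0]; commuting [a] past [a0] then shows that it
   is one for every [a]. *)
pose e := c a0 / (h a0 - eps a0).
pose psi a := phi a + e * eps a.
have psi0 b : psi (a0 * b) = h a0 * psi b.
  rewrite /psi hc epsM.
  have -> : c a0 = e * (h a0 - eps a0) by rewrite /e divfK.
  ring.
pose c' a := c a + e * (eps a - h a).
have psiE a b : psi (a * b) = h a * psi b + c' a * eps b.
  by rewrite /psi /c' hc epsM; ring.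
have c'0 a : c' a = 0.
  have : psi (a0 * (a * 1)) = psi (a * (a0 * 1)) by rewrite mulrCA.
  rewrite psi0 psiE psiE psi0 epsM eps1 => /eqP; rewrite -subr_eq0.
  have -> : h a0 * (h a * psi 1 + c' a * 1) - (h a * (h a0 * psi 1) + c' a * (eps a0 * 1))
     = (h a0 - eps a0) * c' a by ring.
  by rewrite mulf_eq0 (negPf nz) => /eqP.
have psih a : psi a = h a * psi 1.
  by have := psiE a 1; rewrite c'0 mul0r addr0 mulr1.
have nz1 : psi 1 != 0.
  apply/eqP => psi10; case: nphi; exists (- e) => a.
  by have := psih a; rewrite psi10 mulr0 /psi => /eqP; rewrite addr_eq0 mulNr => /eqP.
have [_ Spsi] : stabfun xi psi by apply: stabfun_lin Sphi (stabfun_eps _).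
split=> //.
  apply/matrixP=> i j; rewrite ord1.
  have [lh [h1' hM]] := hpt.
  have : psi 1 * \sum_j (h (g i j - (i == j)%:R)) * xi j 0 = 0.
    rewrite -[RHS](Spsi 1 i) mulr_sumr; apply: eq_bigr => l _.
    by rewrite mul1r [psi (_ - _)]psih mulrA; congr (_ * _); apply: mulrC.
  move/eqP; rewrite mulf_eq0 (negPf nz1) /= => /eqP s0.
  have -> : xi i 0 = (1%:M *m xi) i 0 by rewrite mul1mx.
  apply/eqP; rewrite -subr_eq0 -s0 [X in X - _]mxE [X in _ - X]mxE -sumrB.
  apply/eqP/eq_bigr => l _; rewrite !mxE -mulrBl; congr (_ * _).
  rewrite -scaleN1r [in RHS]addrC lh.
  have := klinZ lh (i == l)%:R 1; rewrite h1' mulr1 scaler_nat => ->.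
  by rewrite rmorphN1 mulN1r rmorph_nat addrC.
apply/eqP => hg; case/negP: neh.
have [lh [_ hM]] := hpt; pose S := [pred a | h a == eps a].
suff : a0 \in S by rewrite inE.
apply: (@univ_point_gen k n G S) => [|i j]; last first.
  by rewrite inE eps_g; have /matrixP/(_ i j) := hg; rewrite !mxE => ->.
split=> [|r u v|u v]; rewrite !inE.
- by rewrite eps1; case: h1 => ->.
- by move=> /eqP hu /eqP hv; rewrite lh hu hv klin_eps.
- by move=> /eqP hu /eqP hv; rewrite hM hu hv epsM.
Qed.

End Stabilizer.

(** * Characteristic polynomials and determinants *)

Lemma char_poly_horner (R : comNzRingType) d (N : 'M[R]_d) a :
  (char_poly N).[a] = \det (a%:M - N).
Proof.
rewrite /char_poly -[LHS]/(horner_eval a _) -det_map_mx; congr (\det _).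
by apply/matrixP=> i j; rewrite !mxE /= horner_evalE hornerD hornerN hornerC hornerMn hornerX.

Qed.

(** The determinant trick: multiply [(a - M) y = 0] by the adjugate. *)
Lemma char_poly_annihil (R S : comNzRingType) (f : {rmorphism R -> S}) d
    (M : 'M[R]_d) (y : 'cV[S]_d) a : map_mx f M *m y = a *: y ->
  forall l, (map_poly f (char_poly M)).[a] * y l 0 = 0.
Proof.
move=> My l; rewrite map_char_poly char_poly_horner.
have : (a%:M - map_mx f M) *m y = 0 by rewrite mulmxBl mul_scalar_mx My subrr.
move/(congr1 (mulmx (\adj (a%:M - map_mx f M)))).
by rewrite mulmxA mul_adj_mx mul_scalar_mx mulmx0 => /matrixP/(_ l 0); rewrite !mxE.
Qed.

Lemma annihilating_poly (k : fieldType) (A : comAlgType k) (b : kbasis A) (a : A) :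
  exists2 p : {poly k}, p \is monic & (map_poly (in_alg A) p).[a] = 0.
Proof.
pose M := \matrix_(l, l') bco b (a * bvec b l) l'.
exists (char_poly M); first exact: char_poly_monic.
pose y : 'cV[A]_(bdim b) := \col_l bvec b l.
have My : map_mx (in_alg A) M *m y = a *: y.
  apply/matrixP=> l j; rewrite !mxE [RHS](bcoP b); apply: eq_bigr => l' _.
  by rewrite !mxE mulr_algl.
rewrite -[LHS]mulr1 [1](bcoP b) mulr_sumr big1 // => l _.
by rewrite -scalerAr; have := char_poly_annihil My l; rewrite [y l 0]mxE => ->; rewrite scaler0.
Qed.

(** Two block triangular factorizations of the matrix with block rows [(1, - l)] and [(c, 1)],
    compared by determinants. *)
Lemma det_rank1 (R : comNzRingType) n (c : 'cV[R]_n) (l : 'rV[R]_n) :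
  \det (1%:M + c *m l) = 1 + (l *m c) 0 0.
Proof.
pose X : 'M[R]_1 := 1%:M + l *m c.
have e1 : block_mx 1%:M (- l) c 1%:M =
    block_mx 1%:M 0 c 1%:M *m block_mx 1%:M (- l) 0 (1%:M + c *m l).
  by rewrite mulmx_block !mul1mx !mulmx1 ?mul0mx ?mulmx0 !addr0 mulmxN addrC addrK.
have e2 : block_mx 1%:M (- l) c 1%:M =
    block_mx 1%:M (- l) 0 1%:M *m block_mx X 0 c (1%:M : 'M[R]_n).
  by rewrite mulmx_block !mul1mx !mulmx1 ?mul0mx ?mulmx0 !add0r mulNmx addrK.
have := congr1 determinant e1; rewrite {1}e2 !det_mulmx !det_ublock !det_lblock.
by rewrite !det1 !mul1r !mulr1 det_mx11 => <-; rewrite !mxE.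
Qed.

Lemma epsder_prod (k : fieldType) n (G : finSubgroupSL k n) (F : fieldType)
    (iota : {rmorphism k -> F}) lam m (f : 'I_m -> coord_ring G) :
  epsder iota lam ->
  lam (\prod_i f i) =
  \sum_i lam (f i) * \prod_(j | j != i) iota (counit G (f j)).
Proof.
move=> [llam lamM].
have lam1 : lam 1 = 0.
  have := lamM 1 1; rewrite !eps1 !mulr1 mul1r.
  by move/(congr1 (+%R^~ (- lam 1))); rewrite subrr addrK.
have epsprod m' (f' : 'I_m' -> coord_ring G) P :
    iota (counit G (\prod_(j | P j) f' j)) = \prod_(j | P j) iota (counit G (f' j)).
  elim/big_rec2: _ => [|i x y _ <-]; first exact: eps1.
  exact: epsM.
elim: m f => [|m IH] f; first by rewrite !big_ord0.
rewrite big_ord_recl lamM IH big_ord_recl epsprod addrC; congr (_ + _).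
  by congr (_ * _); rewrite [RHS]big_mkcond big_ord_recl /= mul1r.
rewrite mulr_sumr; apply: eq_bigr => i _; rewrite mulrCA; congr (_ * _).
rewrite [RHS]big_mkcond big_ord_recl /=; congr (_ * _).
rewrite big_mkcond; apply: eq_bigr => j _.
by rewrite (inj_eq lift_inj).
Qed.

(** Differentiate [\det g = 1] at the identity. A permutation other than 1 moves at least two
    indices, so each term of its derivative keeps an off-diagonal factor, on which the counit
    vanishes. *)
Lemma epsder_trace (k : fieldType) n (G : finSubgroupSL k n) (F : fieldType)
    (iota : {rmorphism k -> F}) lam :
  epsder iota lam -> \tr (map_mx lam (univ_point G)) = 0.
Proof.
move=> der; have [llam lamM] := der; set g := univ_point G.
have lam1 : lam 1 = 0.
  have := lamM 1 1; rewrite !eps1 !mulr1 mul1r.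
  by move/(congr1 (+%R^~ (- lam 1))); rewrite subrr addrK.
have := congr1 lam (univ_point_det G); rewrite lam1 /determinant (klin_sum llam).
rewrite (bigD1 (1%g : {perm 'I_n})) //=.
rewrite [X in _ + X]big1 ?addr0 => [|s ns1]; last first.
  have [i nsi] : exists i, s i != i.
    apply: contra_notP (negP ns1) => /forallNP h; apply/eqP/permP => i.
    by rewrite perm1; apply/eqP/negPn/negP/h.
  have lz (e : nat) a : lam a = 0 -> lam ((-1) ^+ e * a) = 0.
    move=> a0; rewrite -signr_odd; case: odd; rewrite ?mul1r // expr1 mulN1r.
    by rewrite -scaleN1r (klinZ llam) a0 mulr0.
  apply: lz; rewrite (epsder_prod _ der) big1 // => r _.
  have [j nrj nsj] : exists2 j, j != r & s j != j.
    have [eri|nri] := eqVneq i r; last by exists i.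
    exists (s i); first by rewrite -eri.
    by rewrite (inj_eq perm_inj).
  by rewrite (bigD1 j) //= eps_g eq_sym (negPf nsj) mul0r mulr0.
rewrite odd_perm1 expr0 mul1r (epsder_prod _ der) => <-.
apply: eq_bigr => i _; rewrite mxE perm1 big1 ?mulr1 // => j _.
by rewrite perm1 eps_g eqxx.
Qed.

Lemma trivstab_map (k : fieldType) n (G : finSubgroupSL k n) (F F' : fieldType)
    (iota : {rmorphism k -> F}) (j : {rmorphism F -> F'}) (xi : 'cV[F]_n) :
  trivstab G (j \o iota) (map_mx j xi) -> trivstab G iota xi.
Proof.
move=> triv phi [lphi phi0] a; apply: (fmorph_inj j); rewrite rmorphM.
apply: (triv (fun a => j (phi a))); split=> [c u v|c i].
  by rewrite lphi rmorphD rmorphM.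
rewrite -[RHS](rmorph0 j) -(phi0 c i) rmorph_sum.
by apply: eq_bigr => l _; rewrite mxE rmorphM.
Qed.

(* No two independent linear forms with coefficients algebraic over k vanish
   at xi. *)
Definition generic (k : fieldType) n (F : fieldType) (iota : {rmorphism k -> F})
    (xi : 'cV[F]_n) : Prop :=
  forall (K : fieldExtType k) (F' : fieldType) (j : {rmorphism F -> F'})
    (jK : {rmorphism K -> F'}) (l1 l2 : 'rV[K]_n),
  (forall c : k, jK c%:A = j (iota c)) -> l1 != 0 ->
  map_mx jK l1 *m map_mx j xi = 0 -> map_mx jK l2 *m map_mx j xi = 0 ->
  (l2 <= l1)%MS.

Lemma generic_map (k : fieldType) n (F F' : fieldType)
    (iota : {rmorphism k -> F}) (j : {rmorphism F -> F'}) (xi : 'cV[F]_n) :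
  generic iota xi -> generic (j \o iota) (map_mx j xi).
Proof.
move=> gen K F2 j2 jK l1 l2 jE nz_l1 xi1 xi2.
have e : map_mx (j2 \o j) xi = map_mx j2 (map_mx j xi) by apply: map_mx_comp.
by apply: (gen K F2 (j2 \o j) jK) => //; rewrite e.
Qed.

Lemma roots_in_subfield (K F : fieldType) (j : {rmorphism K -> F}) (rs : seq K) z :
  root (\prod_(x <- rs) ('X - (j x)%:P)) z -> exists x, z = j x.
Proof.
elim: rs => [|x rs IH]; first by rewrite big_nil (negPf (root1 _)).
by rewrite big_cons rootM root_XsubC => /orP[/eqP ->|/IH //]; exists x.
Qed.

(** The annihilating polynomials of the entries of [g] all divide [q]. Splitting [q] in a finite
    extension [K] puts the entries of every point of [G] over [F1] in the image of [K]; this is how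
    the rows of [H - 1] acquire algebraic coefficients. *)
Lemma trivstab_generic (k : fieldType) n (G : finSubgroupSL k n.+1)
    (F : fieldType) (iota : {rmorphism k -> F}) (xi : 'cV[F]_n.+1) :
  linearly_reductive G -> generic iota xi -> trivstab G iota xi.
Proof.
move=> redG gen_xi.
have [int int1 [hint hinv]] := haar_exists redG.
have [b] : inhabited (kbasis (coord_ring G)).
  by have [s sP] := coord_ring_finite G; apply: (kbasis_exists sP).
set g := univ_point G.
have /choice[p pP] : forall ij : 'I_n.+1 * 'I_n.+1, exists p : {poly k},
    p \is monic /\ (map_poly (in_alg (coord_ring G)) p).[g ij.1 ij.2] = 0.
  by move=> ij; have [p] := annihilating_poly b (g ij.1 ij.2); exists p.
pose q := \prod_ij p ij.
have nz_q : q != 0.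
  by apply/prodf_neq0 => ij _; rewrite monic_neq0 //; case: (pP ij).
have [K [F1 [j [jK [rs [jKA eq_rs]]]]]] := split_ext iota nz_q.
apply: (@trivstab_map _ _ _ _ F1 _ j).
have {}gen_xi := generic_map (j := j) gen_xi.
set iota1 := j \o iota in gen_xi *; set xi1 := map_mx j xi in gen_xi *.
apply: contrapT => ntriv.
have split_p ij : exists2 ss : seq K,
    map_poly (in_alg K) (p ij) %= \prod_(x <- ss) ('X - x%:P) &
    map_poly iota1 (p ij) %= \prod_(x <- ss) ('X - (jK x)%:P).
  have : map_poly (in_alg K) (p ij) %| \prod_(x <- rs) ('X - x%:P).
    by rewrite -(eqp_dvdr _ eq_rs) dvdp_map /q (bigD1 ij) //= dvdp_mulr.
  case/dvdp_prod_XsubC=> m eq_m; exists (mask m rs) => //.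
  have -> : map_poly iota1 (p ij) = map_poly jK (map_poly (in_alg K) (p ij)).
    by rewrite -map_poly_comp; apply: eq_map_poly => c /=; rewrite jKA.
  move: eq_m; rewrite -(eqp_map jK) rmorph_prod.
  by under [X in _ %= X -> _]eq_bigr => x _ do rewrite rmorphB /= map_polyX map_polyC.
have split_g r s : exists (p : {poly k}) (rs : seq F1),
    (map_poly (in_alg (coord_ring G)) p).[g r s] = 0 /\
    map_poly iota1 p %= \prod_(x <- rs) ('X - x%:P).
  have [ss _ ssP] := split_p (r, s).
  exists (p (r, s)), [seq jK x | x <- ss]; rewrite big_map.
  by split=> //; case: (pP (r, s)).
have [[h [hpt hxi nz_h]]|[lam [der Dxi nz_D]]] := nontrivial_stab split_g ntriv.
  have [lh [h1 hM]] := hpt.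
  have hZ c : h c%:A = iota1 c by rewrite (klinZ lh) h1 mulr1.
  pose hz := GRing.isZmodMorphism.Build _ _ h (klin_fun_zmod lh).
  pose hm := GRing.isMonoidMorphism.Build _ _ h (conj h1 hM).
  pose hR : {rmorphism coord_ring G -> F1} := HB.pack h hz hm.
  have /choice[HK HKE] : forall rs' : 'I_n.+1 * 'I_n.+1,
      exists x : K, h (g rs'.1 rs'.2) = jK x.
    move=> [r s]; have [ss _ ssP] := split_p (r, s).
    apply: (roots_in_subfield (rs := ss)); rewrite -(eqp_root ssP) rootE.
    have -> : map_poly iota1 (p (r, s)) =
        map_poly hR (map_poly (in_alg (coord_ring G)) (p (r, s))).
      by rewrite -map_poly_comp; apply: eq_map_poly => c; rewrite /= hZ.
    by rewrite (horner_map hR); have [_ ->] := pP (r, s); rewrite rmorph0.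
  pose H : 'M[K]_n.+1 := \matrix_(r, s) HK (r, s).
  have HE : map_mx jK H = map_mx h g.
    by apply/matrixP=> r s; rewrite !mxE (HKE (r, s)).
  pose N := H - 1%:M.
  have NE : map_mx jK N = map_mx h g - 1%:M by rewrite map_mxB map_mx1 HE.
  have nz_N : N != 0.
    by rewrite -(map_mx_eq0 jK) NE subr_eq0.
  have [r0 nz_r0] : exists r, row r N != 0.
    apply: contra_notP (negP nz_N) => /forallNP hr; apply/eqP/row_matrixP => r.
    by rewrite row0; apply/eqP/negPn/negP/hr.
  have rowN r : map_mx jK (row r N) *m xi1 = 0.
    by rewrite map_row -row_mul NE mulmxBl mul1mx hxi subrr row0.
  have /choice[c cE] : forall r, exists c, row r N = c *: row r0 N.
    move=> r; apply/sub_rVP.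
    apply: (gen_xi K F1 idfun jK _ _ jKA nz_r0); rewrite map_mx_id //; exact: rowN.
  pose cc : 'cV[K]_n.+1 := \col_r c r; set l := row r0 N in nz_r0 cE.
  have Ncl : N = cc *m l.
    apply/row_matrixP=> r; rewrite cE row_mul.
    by apply/matrixP=> i s; rewrite !mxE big_ord1 !mxE.
  have detH : \det H = 1.
    apply: (fmorph_inj jK); rewrite -det_map_mx HE rmorph1.
    by rewrite [LHS](det_map_mx hR) univ_point_det rmorph1.
  have lc0 : l *m cc = 0.
    have := det_rank1 cc l; rewrite -Ncl addrC subrK detH.
    move=> /(congr1 (+%R (-1))); rewrite addNr addKr => lc.
    by apply/matrixP=> i s; rewrite !ord1 -lc mxE.
  (* With [l e = 1] and [l cc = 0], the matrix [H = 1 + cc l] satisfies [H e = e + cc] and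
     [H cc = cc], a forbidden Jordan block unless [cc = 0]. *)
  have [e le1] : exists e : 'cV[K]_n.+1, l *m e = 1%:M.
    have [s nz_ls] : exists s, l 0 s != 0.
      apply: contra_notP (negP nz_r0) => /forallNP l0; apply/eqP/matrixP=> i s.
      by rewrite ord1 [RHS]mxE; apply/eqP/negPn/negP/l0.
    exists ((l 0 s)^-1 *: delta_mx s 0); rewrite -scalemxAr -colE.
    by apply/matrixP=> i t; rewrite !ord1 mxE [col s l 0 0]mxE mulVf // mxE eqxx.
  have Hinv : ptinv int iota1 (map_mx jK H).
    by rewrite HE; apply: (@ptinv_point k n.+1 G int hint hinv F1 iota1 hR hZ).
  have cc0 : map_mx jK cc = 0.
    apply: (ptinv_no_jordan hint int1 b Hinv (e := map_mx jK e)).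
      rewrite -map_mxM -map_mxD -[H](subrK 1%:M) -/N mulmxDl mul1mx Ncl.
      by rewrite -mulmxA le1 mulmx1 addrC.
    rewrite -map_mxM -[H](subrK 1%:M) -/N mulmxDl mul1mx Ncl -mulmxA lc0.
    by rewrite mulmx0 add0r.
  move/eqP: cc0; rewrite map_mx_eq0 => /eqP cc0.
  by rewrite Ncl cc0 mul0mx eqxx in nz_N.
have [llam lamM] := der.
have lieD := lie_derivation hinv llam lamM.
have [K' [F2 [j2 [jK' [l1 [l2 [d1 [d2]]]]]]]] :=
  lie_eigenforms hint int1 b lieD (epsder_trace der) nz_D.
move=> [jE /andP[nz_l1 nl12] /andP[nz_d1 nz_d2] l1D l2D].
case/negP: nl12; apply: (gen_xi K' F2 j2 jK') => //.
  apply: (scalerI nz_d1); rewrite scaler0 scalemxAl -l1D -mulmxA.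
  by rewrite -map_mxM Dxi map_mx0 mulmx0.
apply: (scalerI nz_d2); rewrite scaler0 scalemxAl -l2D -mulmxA.
by rewrite -map_mxM Dxi map_mx0 mulmx0.
Qed.

(** * Conjugate stabilizers *)

Section Conjugation.
Variables (k : fieldType) (n : nat) (G : finSubgroupSL k n).
Local Notation A := (coord_ring G).
Local Notation g := (univ_point G).
Local Notation TA := (tensalg A (counit1 G)).
Local Notation inl := (@tens_inl k A A (counit G) (counit1 G)).
Local Notation inr := (@tens_inr k A A (counit G) (counit1 G)).
Local Notation g1 := (map_mx inl g).
Local Notation g2 := (map_mx inr g).

Fact det_g1 : \det g1 = 1.
Proof. by rewrite det_map_mx univ_point_det rmorph1. Qed.

Fact conj_exists : exists2 gam : {lrmorphism A -> TA},
  map_mx gam g = \adj g1 *m g2 *m g1 &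
  exists gam' : {lrmorphism A -> TA}, map_mx gam' g = g1 *m g2 *m \adj g1.
Proof.
have G1 : gpoint G g1 := gpoint_map inl (gpoint_univ G).
have G2 : gpoint G g2 := gpoint_map inr (gpoint_univ G).
have [gam gamE] := gpoint_M (gpoint_M (gpoint_V G1) G2) G1.
have [gam' gamE'] := gpoint_M (gpoint_M G1 G2) (gpoint_V G1).
by exists gam => //; exists gam'.
Qed.

(** Conjugation by [h] exchanges the two stabilizers. On functionals, [phi' = (h (x) phi) gam] kills
    the stabilizer ideal of [xi] because [gam] sends [g - 1] to [g1^-1 (g2 - 1) g1]. So [phi'] is
    [phi 1] times the counit, and the inverse conjugation [gam'] recovers [phi]. *)
Lemma trivstab_conj (F : fieldType) (iota : {rmorphism k -> F})
    (h : {rmorphism A -> F}) (xi : 'cV[F]_n) : (forall c, h c%:A = iota c) ->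
  trivstab G iota xi -> trivstab G iota (map_mx h g *m xi).
Proof.
move=> hZ triv phi [lphi phi0] b.
have [gam gamE [gam' gamE']] := conj_exists.
pose hphi : TA -> F := tens_pair (klin_rmorph hZ) lphi.
have hphiD x y : hphi (x + y) = hphi x + hphi y by apply: raddfD.
have hphi0 : hphi 0 = 0 by apply: raddf0.
have hphi_sum := big_morph hphi hphiD hphi0.
have hphi_pure s a : hphi (tens_pure s a) = h s * phi a by apply: tens_pair_pure.
have hphi_inl t s : hphi (t * inl s) = hphi t * h s.
  elim/tens_pureP: t => [|x y IHx IHy|u v].
  - by rewrite mul0r hphi0 mul0r.
  - by rewrite mulrDl !hphiD IHx IHy mulrDl.
  - by rewrite tensalgM mulr1 !hphi_pure rmorphM mulrAC.
have hxiE m : (map_mx h g *m xi) m 0 = \sum_j h (g m j) * xi j 0.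
  by rewrite mxE; apply: eq_bigr => j _; rewrite mxE.
have hphi_inr t l : \sum_m hphi (t * inr (g l m - (l == m)%:R)) *
    (map_mx h g *m xi) m 0 = 0.
  elim/tens_pureP: t => [|x y IHx IHy|u v].
  - by apply: big1 => m _; rewrite mul0r hphi0 mul0r.
  - under eq_bigr => m _ do rewrite mulrDl hphiD mulrDl.
    by rewrite big_split /= IHx IHy addr0.
  - under eq_bigr => m _ do rewrite tensalgM mulr1 hphi_pure -mulrA.
    by rewrite -mulr_sumr phi0 mulr0.
have gamM u v : gam (u * v) = gam u * gam v by apply: rmorphM.
pose phi' a := hphi (gam a).
have Sphi' : stabfun iota xi phi'.
  split=> [c u v|a i].
    rewrite /phi' linearP hphiD -mulr_algl mulrC.
    have -> : c%:A = inl c%:A by rewrite linearZ /= rmorph1.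
    by rewrite hphi_inl hZ mulrC.
  have gM : map_mx gam g - 1%:M = \adj g1 *m (g2 - 1%:M) *m g1.
    by rewrite gamE mulmxBr mulmxBl mulmx1 mul_adj_mx det_g1.
  have entry j : gam (g i j - (i == j)%:R) =
      \sum_m (\sum_l (\adj g1) i l * inr (g l m - (l == m)%:R)) * inl (g m j).
    have e2 l m : (g2 - 1%:M) l m = inr (g l m - (l == m)%:R).
      by rewrite !mxE rmorphB rmorph_nat.
    have <- : (map_mx gam g - 1%:M) i j = gam (g i j - (i == j)%:R).
      by rewrite !mxE rmorphB rmorph_nat.
    rewrite gM mxE; apply: eq_bigr => m _; rewrite [g1 m j]mxE mxE; congr (_ * _).
    by apply: eq_bigr => l _; rewrite e2.
  rewrite (eq_bigr (fun j => \sum_m \sum_l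
      hphi (gam a * (\adj g1) i l * inr (g l m - (l == m)%:R)) * h (g m j) * xi j 0)).
    transitivity (\sum_l \sum_m hphi (gam a * (\adj g1) i l *
        inr (g l m - (l == m)%:R)) * (map_mx h g *m xi) m 0); last first.
      by apply: big1 => l _; apply: hphi_inr.
    rewrite exchange_big [RHS]exchange_big; apply: eq_bigr => m _ /=.
    rewrite exchange_big; apply: eq_bigr => l _ /=; rewrite hxiE mulr_sumr.
    by apply: eq_bigr => j _; rewrite mulrA.
  move=> j _; rewrite /phi' gamM entry mulr_sumr hphi_sum mulr_suml.
  apply: eq_bigr => m _; rewrite mulrA hphi_inl mulr_sumr hphi_sum !mulr_suml.
  by apply: eq_bigr => l _; rewrite mulrA.
have phi'E a : phi' a = phi 1 * iota (counit G a).
  by rewrite (triv _ Sphi' a) /phi' rmorph1 hphi_pure rmorph1 mul1r.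
pose epsR : {rmorphism A -> F} := iota \o (counit G : {rmorphism A -> k^o}).
have epsZ c : epsR c%:A = iota c by rewrite /= counitZ.
have gamZ c : gam c%:A = in_alg TA c by rewrite linearZ /= rmorph1.
have inlZ c : inl c%:A = in_alg TA c by rewrite linearZ /= rmorph1.
(* The comorphism of [(g1, g2) |-> (g1, g1^-1 g2 g1)]. Composed with [gam'] it is the inclusion of
   the second factor. *)
pose Gam : TA -> TA := tens_hom inlZ gamZ.
pose heps : TA -> F := tens_hom hZ epsZ.
have GamE t : hphi (Gam t) = phi 1 * heps t.
  elim/tens_pureP: t => [|x y IHx IHy|u v].
  - by rewrite /Gam /heps !raddf0 hphi0 mulr0.
  - by rewrite /Gam /heps !raddfD /= hphiD [hphi _]IHx [hphi _]IHy mulrDr.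
  - rewrite /Gam /heps !tens_hom_pure mulrC hphi_inl -/(phi' v) phi'E.
    by rewrite -mulrA; congr (_ * _); rewrite mulrC.
have gam'E : map_mx gam' g = g1 *m g2 *m \adj g1 by [].
have Gam_gam' : Gam (gam' b) = inr b.
  pose GamR : {rmorphism TA -> TA} := tens_hom inlZ gamZ.
  have E : GamR \o gam' =1 inr; last exact: E.
  have GamRl a : GamR (inl a) = inl a by rewrite [LHS]tens_hom_pure rmorph1 mulr1.
  have GamRr a : GamR (inr a) = gam a by rewrite [LHS]tens_hom_pure rmorph1 mul1r.
  apply: coord_hom_eq => [c|].
    rewrite /= [gam' _](_ : _ = inl c%:A); last by rewrite inlZ linearZ /= rmorph1.
    by rewrite GamRl inlZ linearZ /= rmorph1.
  rewrite [LHS]map_mx_comp gam'E !map_mxM map_mx_adj.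
  have -> : map_mx GamR g1 = g1 by apply/matrixP=> i j; rewrite !mxE GamRl.
  have -> : map_mx GamR g2 = \adj g1 *m g2 *m g1.
    by rewrite -gamE; apply/matrixP=> i j; rewrite !mxE GamRr.
  rewrite !mulmxA mul_mx_adj det_g1 mul1mx -!mulmxA mul_mx_adj det_g1.
  by rewrite mulmx1.
have heps_gam' : heps (gam' b) = iota (counit G b).
  pose hepsR : {rmorphism TA -> F} := tens_hom hZ epsZ.
  have E : hepsR \o gam' =1 epsR; last exact: E.
  have hepsl a : hepsR (inl a) = h a by rewrite [LHS]tens_hom_pure rmorph1 mulr1.
  have hepsr a : hepsR (inr a) = epsR a by rewrite [LHS]tens_hom_pure rmorph1 mul1r.
  apply: coord_hom_eq => [c|].
    rewrite /= [gam' _](_ : _ = inl c%:A); last by rewrite inlZ linearZ /= rmorph1.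
    by rewrite hepsl hZ -epsZ.
  rewrite [LHS]map_mx_comp gam'E !map_mxM map_mx_adj.
  have -> : map_mx hepsR g1 = map_mx h g by apply/matrixP=> i j; rewrite !mxE hepsl.
  have eg : map_mx epsR g = 1%:M by apply/matrixP=> i j; rewrite !mxE; apply: eps_g.
  have -> : map_mx hepsR g2 = 1%:M.
    by rewrite -eg; apply/matrixP=> i j; rewrite !mxE hepsr.
  by rewrite eg mulmx1 mul_mx_adj det_map_mx univ_point_det rmorph1.
by rewrite -heps_gam' -GamE Gam_gam' hphi_pure rmorph1 mul1r.
Qed.

End Conjugation.

(** * The locus of trivial stabilizer *)

Local Open Scope quotient_scope.

Definition nozerodiv (R : comNzRingType) : Prop :=
  forall x y : R, x * y = 0 -> (x == 0) || (y == 0).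

(** Excluded middle supplies units and inverses, hence the integral domain structure that the
    fraction field construction takes as input. *)
Definition classical_idom (R : comNzRingType) of nozerodiv R : Type := R.

Section ClassicalIdom.
Variables (R : comNzRingType) (domR : nozerodiv R).
Local Notation D := (classical_idom domR).
HB.instance Definition _ := GRing.ComNzRing.on D.
Definition cunit (x : D) : bool := `[< exists y, y * x = 1 >].
Definition cinv (x : D) : D :=
  if pselect (exists y, y * x = 1) is left h then projT1 (cid h) else x.
Fact cmulVx : {in cunit, left_inverse 1 cinv *%R}.
Proof.
move=> x /asboolP h; rewrite /cinv; case: pselect => // h'.
exact: (projT2 (cid h')).
Qed.
Fact cunitPl (x y : D) : y * x = 1 -> cunit x.
Proof. by move=> e; apply/asboolP; exists y. Qed.
Fact cinv_out : {in [predC cunit], cinv =1 id}.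
Proof.
move=> x; rewrite inE => /asboolPn h; rewrite /cinv.
by case: pselect.
Qed.
HB.instance Definition _ := GRing.ComNzRing_hasMulInverse.Build D
  cmulVx cunitPl cinv_out.
HB.instance Definition _ := GRing.ComUnitRing_isIntegral.Build D domR.
End ClassicalIdom.

(** The residue field of [P], as fraction field of the quotient; stabilizers are examined at the
    point [pi] over it. *)
Lemma prime_residue (B : comNzRingType) (P : {pred B}) : is_prime P ->
  exists (F : fieldType) (pi : {rmorphism B -> F}), forall b, (b \in P) = (pi b == 0).
Proof.
move=> [Pideal Pprime].
pose PI : prime_idealr B := HB.pack (P : B -> bool)
  (isIdealr.Build B P Pideal) (isPrimeIdealrClosed.Build B P Pprime).
have dom : nozerodiv {ideal_quot PI} by apply: Quotient.rquot_IdomainAxiom.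
pose D := classical_idom dom.
pose q : {rmorphism B -> {ideal_quot PI}} := \pi_({ideal_quot PI}).
pose t : {rmorphism D -> {fraction D}} := @tofrac D.
exists {fraction D}, (t \o (q : {rmorphism B -> D})) => b.
have e1 : (tofrac (q b : D) == 0) = ((q b : D) == 0) by apply: tofrac_eq0.
apply: etrans (esym e1).
have -> : ((q b : D) == 0) = (q b == q 0) by rewrite rmorph0.
by rewrite [RHS](esym (Quotient.idealrBE PI b 0)) subr0.
Qed.

(* Axiomatizes C = A (x) B, with act the substitution x |-> g x. *)
Record linear_action (k : fieldType) (n : nat) (A : comAlgType k) (g : 'M[A]_n)
    (B C : comNzRingType) (beta : {rmorphism k -> B}) (x : 'I_n -> B)
    (act pr : {rmorphism B -> C}) := LinearAction {
  la_in : {rmorphism A -> C};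
  la_basis : kbasis A;
  la_co : C -> 'I_(bdim la_basis) -> B;
  la_inZ : forall c, la_in c%:A = pr (beta c);
  la_act_beta : forall c, act (beta c) = pr (beta c);
  la_coP : forall c, c = \sum_l la_in (bvec la_basis l) * pr (la_co c l);
  la_coK : forall d, la_co (\sum_l la_in (bvec la_basis l) * pr (d l)) =1 d;
  la_act_x : forall i, act (x i) = \sum_j la_in (g i j) * pr (x j);
  la_div : forall b, exists q : 'I_n -> C,
    act b - pr b = \sum_i q i * (act (x i) - pr (x i)) }.

Section LinearAction.
Variables (k : fieldType) (n : nat) (A : comAlgType k) (g : 'M[A]_n).
Variables (B C : comNzRingType) (beta : {rmorphism k -> B}) (x : 'I_n -> B).
Variables (act pr : {rmorphism B -> C}) (L : linear_action g beta x act pr).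
Local Notation y := (la_basis L).
Local Notation jA := (la_in L).
Local Notation co := (@la_co _ _ _ _ _ _ _ _ _ _ L).

Lemma la_jAE a : jA a = \sum_l jA (bvec y l) * pr (beta (bco y a l)).
Proof.
rewrite {1}(bcoP y a) rmorph_sum; apply: eq_bigr => l _.
by rewrite -mulr_algl rmorphM (la_inZ L) mulrC.
Qed.

Lemma la_co_uniq c d : c = \sum_l jA (bvec y l) * pr (d l) -> co c =1 d.
Proof. by move=> ->; apply: (la_coK (l := L)). Qed.

Lemma la_co_pure a b l : co (jA a * pr b) l = beta (bco y a l) * b.
Proof.
apply: (la_co_uniq (d := fun l => beta (bco y a l) * b)).
rewrite la_jAE mulr_suml; apply: eq_bigr => i _.
by rewrite rmorphM mulrA.
Qed.

Lemma la_coD c d l : co (c + d) l = co c l + co d l.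
Proof.
apply: (la_co_uniq (d := fun l => co c l + co d l)).
rewrite {1}(la_coP L c) {1}(la_coP L d) -big_split /=.
by apply: eq_bigr => i _; rewrite rmorphD mulrDr.
Qed.

Section Theta.
Variables (S : comNzRingType) (pi : {rmorphism B -> S}) (iota : {rmorphism k -> S}).
Hypothesis piE : forall c, pi (beta c) = iota c.
Implicit Types phi : A -> S.

(** The map [phi (x) pi] on [C = A (x) B], in coordinates. *)
Definition theta phi (c : C) : S := \sum_l phi (bvec y l) * pi (co c l).

Lemma thetaD phi c d : theta phi (c + d) = theta phi c + theta phi d.
Proof.
by rewrite -big_split; apply: eq_bigr => l _; rewrite la_coD rmorphD mulrDr.
Qed.

Lemma theta0 phi : theta phi 0 = 0.
Proof. by apply: (addIr (theta phi 0)); rewrite -thetaD !add0r. Qed.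

Lemma thetaN phi c : theta phi (- c) = - theta phi c.
Proof. by apply: (addIr (theta phi c)); rewrite -thetaD !addNr theta0. Qed.

Lemma theta_sum phi I (r : seq I) (P : pred I) (E : I -> C) :
  theta phi (\sum_(i <- r | P i) E i) = \sum_(i <- r | P i) theta phi (E i).
Proof. exact: (big_morph (theta phi) (@thetaD phi) (theta0 phi)). Qed.

Lemma theta_pure phi a b : klin iota phi -> theta phi (jA a * pr b) = phi a * pi b.
Proof.
move=> lphi; rewrite {2}(bcoP y a) (klin_sum lphi) mulr_suml.
apply: eq_bigr => l _; rewrite la_co_pure rmorphM piE (klinZ lphi).
by rewrite mulrA [phi _ * _]mulrC.
Qed.

Lemma theta_pr phi b : klin iota phi -> theta phi (pr b) = phi 1 * pi b.
Proof. by move=> lphi; rewrite -(theta_pure 1 b lphi) rmorph1 mul1r. Qed.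

Lemma theta_prM phi b c : klin iota phi -> theta phi (pr b * c) = pi b * theta phi c.
Proof.
move=> lphi; rewrite {1}(la_coP L c) mulr_sumr theta_sum mulr_sumr.
apply: eq_bigr => l _; rewrite mulrCA -rmorphM theta_pure // rmorphM.
exact: mulrCA.
Qed.

Definition stabker phi : Prop :=
  forall a i, \sum_j phi (a * (g i j - (i == j)%:R)) * pi (x j) = 0.

Lemma la_act_sub i :
  act (x i) - pr (x i) = \sum_j jA (g i j - (i == j)%:R) * pr (x j).
Proof.
rewrite (la_act_x L); under [RHS]eq_bigr do rewrite rmorphB mulrBl.
rewrite sumrB; congr (_ - _); rewrite (bigD1 i) //= eqxx rmorph1 mul1r big1 ?addr0 //.
by move=> j /negPf ne; rewrite eq_sym ne rmorph0 mul0r.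
Qed.

Lemma theta_act_sub phi a i : klin iota phi ->
  theta phi (jA a * (act (x i) - pr (x i))) =
  \sum_j phi (a * (g i j - (i == j)%:R)) * pi (x j).
Proof.
move=> lphi; rewrite la_act_sub mulr_sumr theta_sum; apply: eq_bigr => j _.
by rewrite mulrA -rmorphM theta_pure.
Qed.

(** By [la_div] the stabilizer ideal is generated by the differences of the variables alone, on
    which [stabker] decides. *)
Lemma theta_stab phi c : klin iota phi -> stabker phi ->
  stab_ideal act pr c -> theta phi c = 0.
Proof.
move=> lphi phi0 [s ->]; rewrite theta_sum; apply: big1 => t _.
have [q ->] := la_div L t.2; rewrite mulr_sumr theta_sum; apply: big1 => i _.
rewrite mulrA {1}(la_coP L (t.1 * q i)) mulr_suml theta_sum; apply: big1 => l _.
by rewrite -mulrA mulrCA theta_prM // theta_act_sub // phi0 mulr0.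
Qed.

End Theta.

Section StabIdeal.
Local Notation sid := (stab_ideal act pr).

Lemma stab_ideal0 : sid 0.
Proof. by exists [::]; rewrite big_nil. Qed.

Lemma stab_idealD c d : sid c -> sid d -> sid (c + d).
Proof. by move=> [s ->] [t ->]; exists (s ++ t); rewrite big_cat. Qed.

Lemma stab_idealMl c d : sid d -> sid (c * d).
Proof.
move=> [s ->]; exists [seq (c * t.1, t.2) | t <- s].
by rewrite big_map mulr_sumr; apply: eq_bigr => t _ /=; rewrite mulrA.
Qed.

Definition stab_scalar c : Prop := exists b, sid (c - pr b).

Lemma stab_scalar_sum I (r : seq I) (E : I -> C) :
  (forall i, stab_scalar (E i)) -> stab_scalar (\sum_(i <- r) E i).
Proof.
move=> hE; elim: r => [|i r [b hb]].
  by exists 0; rewrite big_nil rmorph0 subr0; apply: stab_ideal0.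
have [a ha] := hE i; exists (a + b).
by rewrite big_cons rmorphD opprD addrACA; apply: stab_idealD.
Qed.

Lemma stab_scalarM b c : stab_scalar c -> stab_scalar (pr b * c).
Proof.
move=> [a ha]; exists (b * a); rewrite rmorphM -mulrBr; exact: stab_idealMl.
Qed.

(** In this form openness is immediate: [B_f] maps onto [C_f] modulo the stabilizer ideal.
    Injectivity comes from the identity section, in [triv_locus_free]. *)
Definition triv_locus (P : {pred B}) : Prop :=
  exists2 f, f \notin P & forall c, stab_scalar (pr f * c).

End StabIdeal.

End LinearAction.

Section SmallAction.
Variables (k : fieldType) (n : nat) (G : finSubgroupSL k n).
Local Notation A := (coord_ring G).
Local Notation g := (univ_point G).
Variables (B C : comNzRingType) (beta : {rmorphism k -> B}) (x : 'I_n -> B).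
Variables (act pr : {rmorphism B -> C}) (L : linear_action g beta x act pr).
Local Notation y := (la_basis L).
Local Notation jA := (la_in L).
Local Notation co := (@la_co _ _ _ _ _ _ _ _ _ _ L).
Local Notation sid := (stab_ideal act pr).
Local Notation U := (triv_locus act pr).

Section Residue.
Variables (P : {pred B}) (F : fieldType) (pi : {rmorphism B -> F}).
Hypothesis kerP : forall b, (b \in P) = (pi b == 0).
Variable iota : {rmorphism k -> F}.
Hypothesis piE : forall c, pi (beta c) = iota c.
Local Notation xi := (\col_i pi (x i)).

Lemma stabker_stabfun phi : klin iota phi -> @stabfun k n G F iota xi phi <-> stabker g x pi phi.
Proof.
move=> lphi; split=> [[_ h] a i|h]; [|split=> // a i]; rewrite -[RHS](h a i).
  by apply: eq_bigr => j _; rewrite mxE.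
by apply: eq_bigr => j _; rewrite mxE.
Qed.

(** One relation [f a = b] modulo the stabilizer ideal is evaluated by both [phi] and the counit;
    [key] compares the results, and [pi f] is nonzero. *)
Lemma triv_locus_trivstab : U P -> trivstab G iota xi.
Proof.
move=> [f nPf hf] phi Sphi a; have [lphi _] := Sphi.
have leps := @klin_eps k n G F iota; have Seps := @stabfun_eps k n G F iota xi.
have [b hb] := hf (jA a).
have key psi : klin iota psi -> stabfun iota xi psi -> pi f * psi a = psi 1 * pi b.
  move=> lpsi /(stabker_stabfun lpsi) kpsi; apply/eqP.
  rewrite -subr_eq0; have := theta_stab L piE lpsi kpsi hb.
  rewrite thetaD thetaN (theta_pr L piE _ lpsi) (theta_prM L piE _ _ lpsi).
  by rewrite -[jA a]mulr1 -(rmorph1 pr) (theta_pure L piE _ _ lpsi) rmorph1 mulr1 => ->.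
have nz_f : pi f != 0 by rewrite -kerP.
apply: (mulfI nz_f); rewrite (key _ lphi Sphi) mulrCA (key _ leps Seps).
by rewrite rmorph1 rmorph1 mul1r.
Qed.

(** The generators of the stabilizer ideal as a [B]-module, together with 1 at [None]. All are
    scalar modulo the ideal. *)
Let r (s : option ('I_(bdim y) * 'I_n)) : C :=
  if s is Some li then jA (bvec y li.1) * (act (x li.2) - pr (x li.2)) else 1.

Fact r_scalar s : stab_scalar act pr (r s).
Proof.
case: s => [[l i]|] /=; last by exists 1; rewrite rmorph1 subrr; apply: stab_ideal0.
exists 0; rewrite rmorph0 subr0; apply: stab_idealMl.
by exists [:: (1, x i)]; rewrite big_seq1 mul1r.
Qed.

(* Nakayama: some minor of the relation matrix is invertible at P, and
   Cramer's rule then makes every coordinate scalar modulo the ideal. *)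
Lemma trivstab_triv_locus : trivstab G iota xi -> U P.
Proof.
move=> triv; pose M : 'M[B]_(_, bdim y) := \matrix_(s < #|{: option ('I_(bdim y) * 'I_n)}|, l < bdim y)
  co (r (enum_val s)) l.
(* A vector orthogonal to the rows over [F] is a functional killing both the stabilizer ideal and 1;
   triviality of the stabilizer makes it 0. *)
have full : row_full (map_mx pi M).
  rewrite /row_full -mxrank_tr; apply: inj_row_free => v v0.
  pose phi a := \sum_l iota (bco y a l) * v 0 l.
  have lphi : klin iota phi.
    move=> c a b; rewrite /phi mulr_sumr -big_split; apply: eq_bigr => l _ /=.
    by rewrite bcoD bcoZ rmorphD rmorphM mulrDl mulrA.
  have phi_y l : phi (bvec y l) = v 0 l.
    rewrite /phi (bigD1 l) //= big1 => [|j /negPf ne].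
      rewrite addr0 (bco_uniq (c := fun j => (j == l)%:R)) ?eqxx ?rmorph1 ?mul1r //.
      rewrite (bigD1 l) //= eqxx scale1r big1 ?addr0 // => j /negPf ->.
      by rewrite scale0r.
    rewrite (bco_uniq (c := fun j => (j == l)%:R)) ?ne ?rmorph0 ?mul0r //.
    rewrite (bigD1 l) //= eqxx scale1r big1 ?addr0 // => i /negPf ->.
    by rewrite scale0r.
  have th0 s : theta L pi phi (r s) = 0.
    have /matrixP/(_ 0 (enum_rank s)) := v0; rewrite [X in _ = X]mxE => <-.
    rewrite mxE; apply: eq_bigr => l _; rewrite phi_y !mxE enum_rankK.
    by [].
  have Sphi : stabfun iota xi phi.
    apply/stabker_stabfun => // a i; rewrite -(theta_act_sub L piE _ _ lphi).
    rewrite la_jAE mulr_suml theta_sum; apply: big1 => l _.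
    rewrite -mulrA mulrCA (theta_prM L piE _ _ lphi).
    by rewrite (th0 (Some (l, i))) mulr0.
  have phi1 : phi 1 = 0.
    have := theta_pr L piE 1 lphi; rewrite !rmorph1 mulr1 => <-.
    exact: (th0 None).
  apply/matrixP=> i l; rewrite ord1 mxE -phi_y.
  by rewrite (triv _ Sphi) phi1 mul0r.
pose N := rowsub (fullrankfun full) M.
exists (\det N).
  rewrite kerP -det_map_mx; have := fullrowsub_unit full.
  by rewrite -map_mxsub unitmxE unitfE.
move=> c; rewrite {1}(la_coP L c) mulr_sumr.
apply: stab_scalar_sum => l; rewrite mulrA mulrC; apply: stab_scalarM.
have -> : pr (\det N) * jA (bvec y l) =
    \sum_s pr (\adj N l s) * r (enum_val (fullrankfun full s)).
  have : \adj N *m N = (\det N)%:M := mul_adj_mx N.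
  move=> /matrixP NE.
  transitivity (\sum_l' jA (bvec y l') * pr ((\adj N *m N) l l')).
    rewrite (bigD1 l) //= NE mxE eqxx mulr1n mulrC big1 ?addr0 // => j ne.
    by rewrite NE mxE eq_sym (negPf ne) mulr0n rmorph0 mulr0.
  under eq_bigr => j _ do rewrite mxE rmorph_sum mulr_sumr.
  rewrite exchange_big; apply: eq_bigr => s _ /=.
  rewrite {1}(la_coP L (r _)) mulr_sumr; apply: eq_bigr => j _.
  by rewrite !mxE rmorphM mulrCA.
by apply: stab_scalar_sum => s; apply/stab_scalarM/r_scalar.
Qed.

End Residue.

(** Pairing with the counit is a retraction of [pr] that kills the stabilizer ideal, so injectivity
    holds globally and [s = 1] serves. *)
Lemma triv_locus_free : free_on act pr U.
Proof.
move=> P Pprime [f nPf hf]; split=> [c|b hb].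
  by have [b hb] := hf c; exists b, f.
exists 1; first by have [[]] := Pprime.
have piE c : (idfun : {rmorphism B -> B}) (beta c) = beta c by [].
pose eps a := beta (counit G a).
have leps : klin beta eps.
  by move=> c a d; rewrite /eps linearP rmorphD rmorphM.
have keps : stabker g x (idfun : {rmorphism B -> B}) eps.
  move=> a i; apply: big1 => j _; rewrite /eps.
  have -> : counit G (a * (g i j - (i == j)%:R)) = 0.
    have eg : (counit G (g i j) : k) = (i == j)%:R.
      exact: (@eps_g k n G k (idfun : {rmorphism k -> k}) i j).
    apply: etrans (rmorphM (counit G) _ _) _.
    suff e0 : counit G (g i j - (i == j)%:R) = 0.
      exact: etrans (congr1 (GRing.mul _) e0) (mulr0 _).
    apply: etrans (rmorphB (counit G) _ _) _; apply/eqP; rewrite subr_eq0; apply/eqP.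
    exact: etrans eg (esym (rmorph_nat (counit G) _)).
  by rewrite rmorph0 mul0r.
have := theta_stab L piE leps keps hb; rewrite (theta_pr L piE _ leps) /eps.
by rewrite counit1 rmorph1.
Qed.

Lemma triv_locus_open : spec_open U.
Proof.
exists (fun f => `[< forall c, stab_scalar act pr (pr f * c) >]) => P _.
split=> [[f nPf hf]|[f]]; first by exists f => //; apply/asboolP.
by exists f => //; apply/asboolP.
Qed.

(** Over its residue field, a prime of [C] is a pair of a point [h] of [G], through [la_in], and a
    point [xi] of [X], through [pr]. Through [act] it gives [h xi], so [trivstab_conj] applies. *)
Lemma triv_locus_gstable : gstable act pr U.
Proof.
move=> Q Qprime; have [F [pi kerQ]] := prime_residue Qprime => UQ.
pose pi1 : {rmorphism B -> F} := pi \o pr; pose pi2 : {rmorphism B -> F} := pi \o act.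
pose iota : {rmorphism k -> F} := pi1 \o beta.
have pi1E c : pi1 (beta c) = iota c by [].
have pi2E c : pi2 (beta c) = iota c by rewrite /pi2 /= (la_act_beta L).
have ker1 (b : B) : (b \in [pred b | pr b \in Q]) = (pi1 b == 0) by exact: kerQ.
have triv := triv_locus_trivstab ker1 pi1E UQ.
apply: (trivstab_triv_locus (pi := pi2) _ pi2E) => [b|]; first exact: kerQ.
pose h : {rmorphism A -> F} := pi \o jA.
have -> : \col_i pi2 (x i) = map_mx h g *m \col_i pi1 (x i).
  apply/matrixP=> i j; rewrite !mxE /pi2 /= (la_act_x L) rmorph_sum.
  by apply: eq_bigr => l _; rewrite !mxE rmorphM.
apply: trivstab_conj triv => c; rewrite /h /=.
by rewrite (la_inZ L).
Qed.

(** Isolates the commutative algebra that is to be supplied for each of the two rings. *)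
Definition height_ge2_of_forms : Prop :=
  forall (P : {pred B}) (F : fieldType) (pi : {rmorphism B -> F})
    (K : fieldExtType k) (l1 l2 : 'rV[K]_n) (jK : {rmorphism K -> F}),
  (forall b, (b \in P) = (pi b == 0)) -> (forall c, jK c%:A = pi (beta c)) ->
  l1 != 0 -> map_mx jK l1 *m (\col_i pi (x i)) = 0 ->
  map_mx jK l2 *m (\col_i pi (x i)) = 0 -> ~~ (l2 <= l1)%MS ->
  height_ge 2 P.

End SmallAction.

(** A prime without height at least 2 has a generic residue point, by contraposition of the height
    hypothesis, and so lies in the trivial locus. *)
Lemma small_linear_action (k : fieldType) (n : nat) (G : finSubgroupSL k n)
    (B C : comNzRingType) (beta : {rmorphism k -> B}) (x : 'I_n -> B)
    (act pr : {rmorphism B -> C}) :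
  (0 < n)%N -> linearly_reductive G -> linear_action (univ_point G) beta x act pr ->
  height_ge2_of_forms beta x -> small act pr.
Proof.
case: n G x => // n G x _ redG L hgt; exists (triv_locus act pr).
split; [exact: triv_locus_open | exact: (triv_locus_gstable L)
       | exact: (triv_locus_free L) | move=> P Pprime nU].
have [F [pi kerP]] := prime_residue Pprime.
apply: contrapT => nh; apply: nU.
pose iota : {rmorphism k -> F} := pi \o beta.
apply: (trivstab_triv_locus L kerP (fun c => erefl (iota c))).
apply: trivstab_generic => // K F' j jK l1 l2 jKA nz1 k1 k2.
apply/contraT => nle; case: nh.
have E l : map_mx jK l *m \col_i (j \o pi) (x i) =
  map_mx jK l *m map_mx j (\col_i pi (x i)).
  by congr (_ *m _); apply/matrixP=> i s; rewrite !mxE.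
apply: (hgt P F' (j \o pi) K l1 l2 jK) => //; rewrite ?E //.
by move=> b; rewrite kerP /= fmorph_eq0.
Qed.

(** * Substitutions in polynomials and power series *)

Definition bcof (k : fieldType) (V : lmodType k) (y : kbasis V) l (v : V) : k :=
  bco y v l.
Arguments bcof {k V} y l v.
Fact bcof_zmod_morphism (k : fieldType) (V : lmodType k) (y : kbasis V) l :
  zmod_morphism (bcof y l).
Proof. by move=> u v; rewrite /bcof bcoD -scaleN1r bcoZ mulN1r. Qed.
HB.instance Definition _ (k : fieldType) (V : lmodType k) (y : kbasis V) l :=
  GRing.isZmodMorphism.Build V k (bcof y l) (@bcof_zmod_morphism k V y l).

Section LinSubst.
Variables (R : comNzRingType) (n : nat) (g : 'M[R]_n).

Lemma lin_substC c : lin_subst g c%:MP = c%:MP.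
Proof. exact: comp_mpolyC. Qed.

Lemma lin_substX i : lin_subst g 'X_i = \sum_j (g i j)%:MP * 'X_j.
Proof.
rewrite /lin_subst comp_mpolyXU -tnth_nth tnth_mktuple.
by apply: eq_bigr => j _; rewrite mul_mpolyC.
Qed.

Lemma lin_subst_div p : exists q : 'I_n -> {mpoly R[n]},
  lin_subst g p - p = \sum_i q i * (lin_subst g 'X_i - 'X_i).
Proof.
elim/mpoly_alg_ind: p => [c|i|p q [u pE] [v qE]|p q [u pE] [v qE]].
- by exists (fun _ => 0); rewrite lin_substC subrr big1 // => i _; rewrite mul0r.
- exists (fun j => (j == i)%:R); rewrite (bigD1 i) //= eqxx mul1r big1 ?addr0 //.
  by move=> j /negPf ->; rewrite mul0r.
- exists (fun i => u i + v i); rewrite rmorphD opprD addrACA pE qE -big_split.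
  by apply: eq_bigr => i _; rewrite mulrDl.
exists (fun i => lin_subst g p * v i + q * u i).
transitivity (lin_subst g p * (lin_subst g q - q) + q * (lin_subst g p - p)).
  by rewrite rmorphM; ring.
rewrite pE qE !mulr_sumr -big_split; apply: eq_bigr => i _ /=.
by rewrite mulrDl !mulrA.
Qed.

(** The quotients are homogeneous of degree one less than the monomial, so that for a power series
    the sum over all monomials is finite in each degree. *)
Lemma lin_substX_div m : exists q : 'I_n -> {mpoly R[n]},
  (forall i m', mdeg m != (mdeg m').+1 -> (q i)@_m' = 0) /\
  lin_subst g 'X_[m] - 'X_[m] = \sum_i q i * (lin_subst g 'X_i - 'X_i).
Proof.
pose Q (m : 'X_{1..n}) (q : 'I_n -> {mpoly R[n]}) :=
  (mdeg m = 0%N -> forall i, q i = 0) /\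
  (forall d, mdeg m = d.+1 -> forall i, q i \is d.-homog).
suff [q [[q0 qS] qE]] : exists q, Q m q /\
    lin_subst g 'X_[m] - 'X_[m] = \sum_i q i * (lin_subst g 'X_i - 'X_i).
  exists q; split=> // i m'; case dm: (mdeg m) => [|d] ne.
    by rewrite q0 ?mcoeff0.
  by apply: (dhomog_nemf_coeff (qS _ dm i)); rewrite eq_sym -eqSS.
elim/mnm_ind: m => [|i m [q [[q0 qS] qE]]].
  exists (fun _ => 0); split; first by split=> // d; rewrite mdeg0.
  rewrite mpolyX0 rmorph1 subrr big1 // => i _; exact: mul0r.
exists (fun j => lin_subst g 'X_i * q j + (j == i)%:R * 'X_[m]); split.
  split=> [|d]; rewrite mdegD mdeg1 add1n // => -[dm] j.
  apply: rpredD; last first.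
    by case: eqP => _; rewrite ?mul1r ?mul0r ?rpred0 // dhomogX /= dm.
  case: d dm => [|d] dm; first by rewrite q0 ?mulr0 ?rpred0.
  rewrite -[d.+1]add1n; apply: dhomogM; last exact: qS.
  by have := lin_subst_dhomog g U_(i); rewrite mdeg1.
rewrite mpolyXD rmorphM.
transitivity (lin_subst g 'X_i * (lin_subst g 'X_[m] - 'X_[m]) +
    'X_[m] * (lin_subst g 'X_i - 'X_i)); first by ring.
rewrite qE mulr_sumr; under [RHS]eq_bigr do rewrite mulrDl -mulrA.
rewrite big_split /=; congr (_ + _); rewrite (bigD1 i) //= eqxx mul1r big1 ?addr0 //.
by move=> j /negPf ->; rewrite !mul0r.
Qed.

End LinSubst.

Section PolyAction.
Variables (k : fieldType) (n : nat) (A : comAlgType k) (g : 'M[A]_n) (y : kbasis A).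

Definition mpoly_pr : {rmorphism {mpoly k[n]} -> {mpoly A[n]}} :=
  map_mpoly (in_alg A).
Definition mpoly_act : {rmorphism {mpoly k[n]} -> {mpoly A[n]}} :=
  lin_subst g \o map_mpoly (in_alg A).
Definition mpoly_co (c : {mpoly A[n]}) l : {mpoly k[n]} := map_mpoly (bcof y l) c.

Lemma mpoly_prX i : mpoly_pr 'X_i = 'X_i.
Proof. exact: (map_mpolyX (in_alg A)). Qed.

Lemma mpoly_inZ c : (c%:A : A)%:MP = mpoly_pr c%:MP.
Proof. by rewrite /mpoly_pr /= (map_mpolyC _ (in_alg A)). Qed.

Lemma mpoly_act_beta c : mpoly_act c%:MP = mpoly_pr c%:MP.
Proof. by rewrite /= -/(mpoly_pr _) -mpoly_inZ lin_substC. Qed.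

Lemma mcoeff_coord (d : 'I_(bdim y) -> {mpoly k[n]}) m :
  (\sum_l (bvec y l)%:MP * mpoly_pr (d l))@_m = \sum_l (d l)@_m *: bvec y l.
Proof.
rewrite raddf_sum; apply: eq_bigr => l _ /=.
by rewrite mcoeffCM (mcoeff_map_mpoly (in_alg A)) /= mulrC mulr_algl.
Qed.

Lemma mpoly_coP c : c = \sum_l (bvec y l)%:MP * mpoly_pr (mpoly_co c l).
Proof.
apply/mpolyP=> m; rewrite mcoeff_coord {1}(bcoP y c@_m).
by apply: eq_bigr => l _; rewrite (mcoeff_map_mpoly (bcof y l)).
Qed.

Lemma mpoly_coK d :
  mpoly_co (\sum_l (bvec y l)%:MP * mpoly_pr (d l)) =1 d.
Proof.
move=> l; apply/mpolyP=> m; rewrite (mcoeff_map_mpoly (bcof y l)) mcoeff_coord.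
exact: bcoK.
Qed.

Lemma mpoly_act_x i : mpoly_act 'X_i = \sum_j (g i j)%:MP * mpoly_pr 'X_j.
Proof.
rewrite /= -/(mpoly_pr _) mpoly_prX lin_substX.
by apply: eq_bigr => j _; rewrite mpoly_prX.
Qed.

Lemma mpoly_div b : exists q : 'I_n -> {mpoly A[n]},
  mpoly_act b - mpoly_pr b = \sum_i q i * (mpoly_act 'X_i - mpoly_pr 'X_i).
Proof.
have [q qE] := lin_subst_div g (mpoly_pr b); exists q; rewrite [LHS]qE.
by apply: eq_bigr => i _; rewrite /= -/(mpoly_pr _) mpoly_prX.
Qed.

Definition mpoly_linear_action : linear_action g (@mpolyC n k) (fun i => 'X_i)
    mpoly_act mpoly_pr :=
  @LinearAction k n A g {mpoly k[n]} {mpoly A[n]} (@mpolyC n k) (fun i => 'X_i)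
    mpoly_act mpoly_pr (@mpolyC n A) y mpoly_co mpoly_inZ mpoly_act_beta mpoly_coP
    mpoly_coK mpoly_act_x mpoly_div.

End PolyAction.

Section SeriesPoly.
Variables (R : comNzRingType) (n : nat).

Definition spoly (p : {mpoly R[n]}) : mseries R n := MSeries (fun m => p@_m).

Lemma strunc_spoly d p : eqtrunc d (strunc d (spoly p)) p.
Proof. by move=> m lt_md; rewrite mcoeff_strunc lt_md. Qed.

Lemma scoefM (u v : mseries R n) d m : (mdeg m < d)%N ->
  scoef (u * v) m = (strunc d u * strunc d v)@_m.
Proof. exact: scoef_smul. Qed.

Fact spoly_zmod_morphism : zmod_morphism spoly.
Proof. by move=> p q; apply: mseriesP => m /=; rewrite mcoeffB. Qed.
Fact spoly_monoid_morphism : monoid_morphism spoly.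
Proof.
split=> [|p q]; apply: mseriesP => m; first by rewrite /= mcoeff1.
have lt_m := ltnSn (mdeg m); rewrite (scoefM _ _ lt_m).
by rewrite (eqtruncM (strunc_spoly p) (strunc_spoly q) lt_m).
Qed.
HB.instance Definition _ := GRing.isZmodMorphism.Build
  {mpoly R[n]} (mseries R n) spoly spoly_zmod_morphism.
HB.instance Definition _ := GRing.isMonoidMorphism.Build
  {mpoly R[n]} (mseries R n) spoly spoly_monoid_morphism.

Lemma spoly_inj : injective spoly.
Proof. by move=> p q /(congr1 (@scoef R n)) e; apply/mpolyP=> m; have := congr1 (@^~ m) e. Qed.

Lemma scoef_spolyM p u d m : (mdeg m < d)%N ->
  scoef (spoly p * u) m = (p * strunc d u)@_m.
Proof.
move=> lt_m; rewrite (scoefM _ _ lt_m).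
exact: (eqtruncM (@strunc_spoly d p) (fun _ _ => erefl) lt_m).
Qed.

Lemma scoef_sconstM c u m : scoef (spoly c%:MP * u) m = c * scoef u m.
Proof.
by rewrite (scoef_spolyM _ _ (ltnSn _)) mcoeffCM mcoeff_strunc ltnSn.
Qed.

Lemma scoef_sum I (r : seq I) (P : pred I) (E : I -> mseries R n) m :
  scoef (\sum_(i <- r | P i) E i) m = \sum_(i <- r | P i) scoef (E i) m.
Proof. exact: (big_morph (fun u : mseries R n => scoef u m)). Qed.

Lemma slin_subst_spoly g p : slin_subst g (spoly p) = spoly (lin_subst g p).
Proof.
apply: mseriesP => m /=; apply: (@eqtrunc_lin_subst _ _ g (mdeg m).+1) => //.
exact: strunc_spoly.
Qed.

End SeriesPoly.

Lemma smap_spoly (R S : comNzRingType) n (f : {rmorphism R -> S}) (p : {mpoly R[n]}) :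
  smap f (spoly p) = spoly (map_mpoly f p).
Proof. by apply: mseriesP => m /=; rewrite mcoeff_map_mpoly. Qed.

(** The lowest homogeneous part of a product is the product of the lowest parts, which are nonzero
    polynomials over a domain. *)
Lemma mseries_nozerodiv (K : idomainType) n : nozerodiv (mseries K n).
Proof.
have low (u : mseries K n) : u != 0 -> exists d, strunc d.+1 u != 0 /\
    forall m, (mdeg m < d)%N -> scoef u m = 0.
  move=> nz_u; have ex_d : exists d, `[< exists m, mdeg m = d /\ scoef u m != 0 >].
    apply: contra_notP (negP nz_u) => /forallNP u0; apply/eqP/mseriesP => m.
    by apply: contrapT => /eqP nz; apply: (u0 (mdeg m)); apply/asboolP; exists m.
  case: (ex_minnP ex_d) => d /asboolP[m [dm nz_m]] min_d; exists d; split.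
    apply: contraNneq nz_m => u0.
    by move/(congr1 (mcoeff m)): u0; rewrite mcoeff_strunc dm ltnSn mcoeff0 => ->.
  move=> m' lt_m'; apply/eqP/contraT => nz; have := lt_m'.
  by rewrite ltnNge min_d //; apply/asboolP; exists m'.
move=> u v uv0; apply/contraT; rewrite negb_or => /andP[/low[d [nzu lowu]] /low[e [nzv lowv]]].
have trunc_homog (w : mseries K n) c : (forall m, (mdeg m < c)%N -> scoef w m = 0) ->
    strunc c.+1 w \is c.-homog.
  move=> low_w; apply/dhomogP => m; rewrite mcoeff_msupp mcoeff_strunc ltnS /=.
  by case: ltngtP => //; [move=> lt_m; rewrite low_w ?eqxx | rewrite eqxx].
have: strunc d.+1 u * strunc e.+1 v != 0 by rewrite mulf_neq0.
case/negP; apply/eqP/mpolyP=> m; rewrite mcoeff0.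
have [dm|ne] := eqVneq (mdeg m) (d + e)%N; last first.
  apply: dhomog_nemf_coeff (dhomogM (trunc_homog _ _ lowu) (trunc_homog _ _ lowv)) _.
  exact: ne.
have <- : scoef (u * v) m = 0 by rewrite uv0.
rewrite mcoeffM; apply: eq_bigr => -[p q] /= /eqP mE.
have {}dm : (mdeg p + mdeg q)%N = (d + e)%N by rewrite -mdegD -dm; congr mdeg.
rewrite !mcoeff_strunc !ltnS.
case: (ltngtP (mdeg p) d) => [lt_p|gt_p|eq_p].
- by rewrite (lowu _ lt_p) !mul0r.
- rewrite mul0r lowv ?mulr0 // -(ltn_add2l d) -dm ltn_add2r; exact: gt_p.
by move: dm; rewrite eq_p => /addnI ->; rewrite leqnn.
Qed.

Lemma bmnm_sum_stable (R : comNzRingType) n (s : 'X_{1..n} -> R) D0 D :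
  (D0 <= D)%N -> (forall m : 'X_{1..n}, (D0 <= mdeg m)%N -> s m = 0) ->
  \sum_(m : 'X_{1..n < D}) s m = \sum_(m : 'X_{1..n < D0}) s m.
Proof.
move=> le_D s0.
have E d : \sum_(m : 'X_{1..n < d}) s m = (strunc d (MSeries s)).@[fun _ => 1].
  rewrite /strunc raddf_sum; apply: eq_bigr => m _ /=.
  by rewrite mevalZ mevalX big1 ?mulr1 // => i _; rewrite expr1n.
rewrite !E; congr (_.@[_]); apply/mpolyP=> m; rewrite !mcoeff_strunc /=.
have [lt0|ge0] := ltnP (mdeg m) D0; first by rewrite (leq_trans lt0 le_D).
by case: ifP => // _; rewrite s0.
Qed.

Section SeriesDiv.
Variables (R : comNzRingType) (n : nat) (g : 'M[R]_n).

(* Divides monomial by monomial; the quotients being homogeneous, only finitely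
   many monomials contribute to a given coefficient of the result. *)
Lemma slin_subst_div u : exists q : 'I_n -> mseries R n,
  slin_subst g u - u =
    \sum_i q i * (slin_subst g (spoly 'X_i) - spoly 'X_i).
Proof.
have /choice[p /all_and2[p0 pE]] := lin_substX_div g.
pose Q D i : {mpoly R[n]} := \sum_(m : 'X_{1..n < D}) scoef u m *: p m i.
(* Only monomials of degree [(mdeg m).+1] contribute at [m], hence the truncation below
   [(mdeg m).+2]. *)
pose q i := MSeries (fun m => (Q (mdeg m).+2 i)@_m).
have Qstab D i m : ((mdeg m).+1 < D)%N -> (Q D i)@_m = scoef (q i) m.
  move=> lt_D; rewrite /q /= /Q !raddf_sum /=.
  under eq_bigr do rewrite mcoeffZ; under [RHS]eq_bigr do rewrite mcoeffZ.
  apply: (bmnm_sum_stable (s := fun m' => scoef u m' * (p m' i)@_m)) => // m' le_m'.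
  by rewrite p0 ?mulr0 // neq_ltn le_m' orbT.
exists q; apply: mseriesP => m.
pose d := (mdeg m).+1; have lt_m : (mdeg m < d)%N := ltnSn _.
transitivity ((lin_subst g (strunc d.+1 u) - strunc d.+1 u)@_m).
  rewrite mcoeffB mcoeff_strunc ltnS (ltnW lt_m).
  have := @strunc_slin_subst _ _ g d.+1 u m; rewrite mcoeff_strunc ltnS (ltnW lt_m).
  by move=> <-.
have -> : lin_subst g (strunc d.+1 u) - strunc d.+1 u =
    \sum_i Q d.+1 i * (lin_subst g 'X_i - 'X_i).
  rewrite /strunc rmorph_sum -sumrB.
  under [RHS]eq_bigr do rewrite mulr_suml.
  rewrite exchange_big; apply: eq_bigr => m' _ /=.
  under eq_bigr do rewrite -scalerAl.
  by rewrite -scaler_sumr -pE scalerBr /lin_subst comp_mpolyZ.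
rewrite raddf_sum scoef_sum; apply: eq_bigr => i _.
rewrite slin_subst_spoly -rmorphB [q i * _]mulrC (scoef_spolyM _ (q i) lt_m).
rewrite [Q d.+1 i * _]mulrC.
apply: (eqtruncM (fun _ _ => erefl) _ lt_m) => m' lt_m'.
by rewrite mcoeff_strunc lt_m' Qstab.
Qed.

End SeriesDiv.

Section SeriesAction.
Variables (k : fieldType) (n : nat) (A : comAlgType k) (g : 'M[A]_n) (y : kbasis A).

Definition mseries_pr : {rmorphism mseries k n -> mseries A n} := smap (in_alg A).
Definition mseries_act : {rmorphism mseries k n -> mseries A n} :=
  slin_subst g \o smap (in_alg A).
Definition mseries_co (c : mseries A n) l : mseries k n :=
  MSeries (fun m => bco y (scoef c m) l).
Definition mseries_const (R : comNzRingType) : {rmorphism R -> mseries R n} :=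
  @spoly R n \o @mpolyC n R.

Lemma mseries_pr_spoly p : mseries_pr (spoly p) = spoly (mpoly_pr n A p).
Proof. exact: smap_spoly. Qed.

Lemma mseries_act_spoly p : mseries_act (spoly p) = spoly (mpoly_act g p).
Proof. by rewrite /= smap_spoly slin_subst_spoly. Qed.

Lemma mseries_inZ c : mseries_const A c%:A = mseries_pr (mseries_const k c).
Proof. by rewrite [RHS]mseries_pr_spoly /= mpoly_inZ. Qed.

Lemma mseries_act_beta c :
  mseries_act (mseries_const k c) = mseries_pr (mseries_const k c).
Proof. by rewrite [RHS]mseries_pr_spoly -(mpoly_act_beta g) -mseries_act_spoly. Qed.

Lemma scoef_coord (d : 'I_(bdim y) -> mseries k n) m :
  scoef (\sum_l mseries_const A (bvec y l) * mseries_pr (d l)) m =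
  \sum_l scoef (d l) m *: bvec y l.
Proof.
rewrite scoef_sum; apply: eq_bigr => l _.
by rewrite scoef_sconstM /= mulrC mulr_algl.
Qed.

Lemma mseries_coP c :
  c = \sum_l mseries_const A (bvec y l) * mseries_pr (mseries_co c l).
Proof. by apply: mseriesP => m; rewrite scoef_coord {1}(bcoP y (scoef c m)). Qed.

Lemma mseries_coK d :
  mseries_co (\sum_l mseries_const A (bvec y l) * mseries_pr (d l)) =1 d.
Proof.
by move=> l; apply: mseriesP => m; rewrite [LHS]/= scoef_coord bcoK.
Qed.

Lemma mseries_act_x i : mseries_act (spoly 'X_i) =
  \sum_j mseries_const A (g i j) * mseries_pr (spoly 'X_j).
Proof.
rewrite mseries_act_spoly mpoly_act_x rmorph_sum; apply: eq_bigr => j _.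
by rewrite rmorphM mseries_pr_spoly.
Qed.

Lemma mseries_div b : exists q : 'I_n -> mseries A n,
  mseries_act b - mseries_pr b =
  \sum_i q i * (mseries_act (spoly 'X_i) - mseries_pr (spoly 'X_i)).
Proof.
have [q qE] := slin_subst_div g (mseries_pr b); exists q; rewrite [LHS]qE.
by apply: eq_bigr => i _; rewrite /= !smap_spoly (map_mpolyX (in_alg A)).
Qed.

Definition mseries_linear_action : linear_action g (mseries_const k)
    (fun i => spoly 'X_i) mseries_act mseries_pr :=
  @LinearAction k n A g (mseries k n) (mseries A n) (mseries_const k)
    (fun i => spoly 'X_i) mseries_act mseries_pr (mseries_const A) y mseries_co
    mseries_inZ mseries_act_beta mseries_coP mseries_coK mseries_act_x mseries_div.

End SeriesAction.

(** * The codimension of the stabilized locus *)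

Lemma fieldExt_kbasis (k : fieldType) (K : fieldExtType k) : inhabited (kbasis K).
Proof.
pose s : seq K := vbasis {:K}%VS; apply: (kbasis_exists (s := s)) => v.
exists (fun i => coord (in_tuple s) i v); apply: (coord_span (X := in_tuple s)).
by rewrite /= (span_basis (vbasisP _)) memvf.
Qed.

Lemma mpoly_act_form (k : fieldType) n (A : comAlgType k) (T : 'M[A]_n) (l : 'rV[A]_n) :
  \sum_s (l 0 s)%:MP * mpoly_act T 'X_s = \sum_j ((l *m T) 0 j)%:MP * 'X_j.
Proof.
under eq_bigr do rewrite mpoly_act_x mulr_sumr.
rewrite exchange_big; apply: eq_bigr => j _ /=.
rewrite mxE rmorph_sum mulr_suml; apply: eq_bigr => s _.
by rewrite mpoly_prX mulrA rmorphM.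
Qed.

Lemma form_eq0 (R : comNzRingType) n (c : 'I_n -> R) :
  \sum_j (c j)%:MP * 'X_j = 0 :> {mpoly R[n]} -> forall j, c j = 0.
Proof.
move=> c0 j; have := congr1 (mcoeff U_(j)) c0; rewrite mcoeff0 raddf_sum /=.
rewrite (bigD1 j) //= mcoeffCM mcoeffX eqxx mulr1 big1 ?addr0 // => i ne.
rewrite mcoeffCM mcoeffX; case: eqP => [/mnmP/(_ i)|_]; last by rewrite mulr0.
by rewrite !mnm1E eqxx eq_sym (negPf ne).
Qed.

Section FormNorm.
Variables (k : fieldType) (n : nat) (K : fieldExtType k) (y : kbasis K).
Variables (T : 'M[K]_n) (l : 'rV[K]_n).

(* A substitute for the norm of the form l: the lowest coefficient, among
   those of the characteristic polynomial of multiplication by l on K[x] over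
   k[x], that does not vanish on the image of T. *)
Lemma form_norm_exists : l *m T != 0 ->
  exists2 b : {mpoly k[n]}, mpoly_act T b != 0 &
  forall (S : comNzRingType) (j : {rmorphism K -> S})
    (ev : {rmorphism {mpoly k[n]} -> S}),
  (forall c, ev c%:MP = j c%:A) ->
  (forall i, \sum_s j (T i s) * ev 'X_s = ev 'X_i) ->
  \sum_s j (l 0 s) * ev 'X_s = 0 -> ev b = 0.
Proof.
move=> nz_lT; pose d := bdim y.
pose f : {rmorphism {mpoly k[n]} -> {mpoly K[n]}} := mpoly_pr n K.
pose sg : {rmorphism {mpoly k[n]} -> {mpoly K[n]}} := mpoly_act T.
pose a : {mpoly K[n]} := \sum_s (l 0 s)%:MP * 'X_s.
pose M : 'M[{mpoly k[n]}]_d :=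
  \matrix_(p, q) \sum_s (bco y (l 0 s * bvec y p) q)%:MP * 'X_s.
pose chi := char_poly M.
have chi0 : (map_poly f chi).[a] = 0.
  pose yv : 'cV[{mpoly K[n]}]_d := \col_q (bvec y q)%:MP.
  have eigM : map_mx f M *m yv = a *: yv.
    apply/matrixP=> p i; rewrite mxE [RHS]mxE mxE /a mulr_suml.
    under eq_bigr do rewrite !mxE rmorph_sum mulr_suml.
    rewrite exchange_big; apply: eq_bigr => s _ /=.
    rewrite mulrAC -rmorphM {2}(bcoP y (l 0 s * bvec y p)) rmorph_sum mulr_suml.
    apply: eq_bigr => q _; rewrite rmorphM -mpoly_inZ mpoly_prX mulrAC -rmorphM.
    by rewrite mulr_algl.
  have yv0 q : (map_poly f chi).[a] * (bvec y q)%:MP = 0.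
    by have := char_poly_annihil eigM q; rewrite mxE.
  have e1 : 1 = \sum_q (bco y 1 q *: bvec y q)%:MP :> {mpoly K[n]}.
    by rewrite -(rmorph1 (@mpolyC n K)) {1}(bcoP y 1) rmorph_sum.
  rewrite -[LHS]mulr1 [X in _ * X]e1 mulr_sumr.
  by apply: big1 => q _; rewrite -mulr_algl rmorphM mulrCA yv0 mulr0.
pose a' := lin_subst T a.
have a'E : a' = \sum_s (l 0 s)%:MP * mpoly_act T 'X_s.
  rewrite /a' rmorph_sum; apply: eq_bigr => s _.
  apply: etrans (rmorphM (lin_subst T) _ _) _; congr (_ * _).
    exact: lin_substC.
  by rewrite /= -/(mpoly_pr _ _ _) mpoly_prX.
have nz_a' : a' != 0.
  apply: contraNneq nz_lT; rewrite a'E mpoly_act_form => /form_eq0 lT0.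
  by apply/eqP/matrixP=> i s; rewrite ord1 lT0 mxE.
pose psi := map_poly sg chi.
have psi0 : psi.[a'] = 0.
  have -> : psi = map_poly (lin_subst T) (map_poly f chi) by rewrite -map_poly_comp.
  by rewrite horner_map chi0 rmorph0.
have ex_s : exists s, psi`_s != 0.
  exists (size psi).-1; rewrite -/(lead_coef psi) lead_coef_eq0 monic_neq0 //.
  by rewrite monic_map // char_poly_monic.
case: (ex_minnP ex_s) => s nz_s min_s.
(* Since [psi(a') = 0] with [a'] nonzero in a domain, the power [X^s] cancels and [W(a') = 0]. Where
   [T] fixes the point and [l] vanishes, [a'] evaluates to 0, and what remains is the constant term
   of [W], the image of [chi] at degree [s]. *)
pose W := drop_poly s psi.
have W0 : W.[a'] = 0.
  have psiE : psi = W * 'X^s.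
    rewrite -[LHS](poly_take_drop s) [take_poly _ _](_ : _ = 0) ?add0r //.
    apply/polyP=> i; rewrite coef_take_poly coef0; case: ifP => // lt_is.
    by apply/eqP/contraT => /min_s; rewrite leqNgt lt_is.
  have /eqP := psi0; rewrite psiE hornerM hornerXn mulf_eq0 => /orP[/eqP //|].
  by rewrite expf_eq0 (negPf nz_a') andbF.
exists chi`_s; first by rewrite -[mpoly_act T _]coef_map.
move=> S j ev evC evX evl.
pose evK : {rmorphism {mpoly K[n]} -> S} := mmap j (fun s => ev 'X_s).
have evKC c : evK c%:MP = j c by exact: mmapC.
have evKX i : evK 'X_i = ev 'X_i by rewrite /evK /= mmapX mmap1U.
have evKs : evK \o sg =1 ev.
  apply: mpoly_hom_eq => [c|i]; rewrite /= -[lin_subst _ _]/(mpoly_act T _).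
    by rewrite mpoly_act_beta -mpoly_inZ evKC evC.
  rewrite mpoly_act_x rmorph_sum -evX; apply: eq_bigr => r _.
  by rewrite mpoly_prX rmorphM evKC evKX.
have := congr1 evK W0; rewrite rmorph0 -horner_map.
have -> : evK a' = 0.
  rewrite a'E rmorph_sum -[RHS]evl; apply: eq_bigr => r _.
  by rewrite rmorphM evKC; congr (_ * _); apply: evKs.
rewrite horner_coef0 coef_map coef_drop_poly add0n coef_map => <-.
by rewrite -[RHS]/((evK \o sg) _) evKs.
Qed.

End FormNorm.

Lemma ker_prime (B D : comNzRingType) (h : {rmorphism B -> D}) (P : {pred B}) :
  nozerodiv D -> (forall b, (b \in P) = (h b == 0)) -> is_prime P.
Proof.
move=> domD kerP; split.
  split; rewrite ?kerP ?rmorph0 ?eqxx // ?rmorph1 ?oner_eq0 // => a u v.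
  by rewrite !kerP => /eqP hu /eqP hv; rewrite rmorphD rmorphM hu hv mulr0 addr0.
by move=> u v; rewrite !kerP rmorphM => /eqP /domD.
Qed.

Lemma height_ge2_forms (k : fieldType) n (B : comNzRingType) (beta : {rmorphism k -> B})
    (x : 'I_n -> B) (e : {rmorphism {mpoly k[n]} -> B}) :
  nozerodiv B -> injective e -> (forall c, e c%:MP = beta c) ->
  (forall i, e 'X_i = x i) ->
  (forall (K : fieldExtType k) (T : 'M[K]_n), exists (C : comNzRingType)
    (act pr : {rmorphism B -> C}) (L : linear_action T beta x act pr),
    nozerodiv C /\ forall b, act (e b) = 0 <-> mpoly_act T b = 0) ->
  height_ge2_of_forms beta x.
Proof.
move=> domB e_inj eC eX actT P F pi K l1 l2 jK kerP jKA nz1 k1 k2 nle.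
set xi := \col_i pi (x i) in k1 k2.
have [y] := fieldExt_kbasis K.
have [v lv1] : exists v : 'cV[K]_n, l1 *m v = 1%:M.
  have [s nz_ls] : exists s, l1 0 s != 0.
    apply: contra_notP (negP nz1) => /forallNP l0; apply/eqP/matrixP=> i s.
    by rewrite ord1 [RHS]mxE; apply/eqP/negPn/negP/l0.
  exists ((l1 0 s)^-1 *: delta_mx s 0); rewrite -scalemxAr -colE.
  by apply/matrixP=> i t; rewrite !ord1 mxE [col s l1 0 0]mxE mulVf // mxE eqxx.
(* The projection along [v] onto the hyperplane [l1 = 0]: it fixes [xi] and does not kill the form
   [l2]. It is singular, but [linear_action] accepts any matrix. *)
pose T := 1%:M - v *m l1.
have l1T : l1 *m T = 0 by rewrite mulmxBr mulmx1 mulmxA lv1 mul1mx subrr.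
have l2T : l2 *m T != 0.
  apply: contraNneq nle; rewrite mulmxBr mulmx1 mulmxA => /eqP.
  by rewrite subr_eq0 => /eqP ->; apply: submxMl.
have Txi : map_mx jK T *m xi = xi.
  by rewrite map_mxB map_mxM map_mx1 mulmxBl mul1mx -mulmxA k1 mulmx0 subr0.
have [C [act [pr [L [domC actE]]]]] := actT K T.
pose c i : {pred B} := if i is i'.+1 then
  (if i' is _.+1 then P else [pred b | act b == 0]) else pred1 0.
have domF : nozerodiv F by move=> u w /eqP; rewrite mulf_eq0.
exists c; split=> [[|[|i]] _|[|[|i]] // _|//].
- exact: (ker_prime (h := idfun)).
- exact: (ker_prime (h := act)).
- exact: (ker_prime (h := pi)).
- split=> [b|]; first by rewrite !inE => /eqP ->; rewrite rmorph0.
  (* The norm of [l1], taken with the identity as matrix and then evaluated through [T], where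
     [l1 T = 0]: a nonzero element of the kernel of [act]. *)
  have [b nz_b b0] := @form_norm_exists k n K y 1%:M l1 ltac:(by rewrite mulmx1).
  exists (e b); rewrite !inE; last first.
    by apply: contraNneq nz_b; rewrite -(rmorph0 e) => /e_inj ->; rewrite rmorph0.
  apply/eqP/actE/(b0 _ (@mpolyC n K)) => [a|i|].
  + by rewrite mpoly_act_beta -mpoly_inZ.
  + rewrite (bigD1 i) //= mxE eqxx rmorph1 mul1r big1 ?addr0 // => s ne.
    by rewrite mxE eq_sym (negPf ne) rmorph0 mul0r.
  by rewrite mpoly_act_form l1T big1 // => s _; rewrite mxE rmorph0 mul0r.
split=> [b|].
  rewrite inE kerP => /eqP act0.
  pose iota : {rmorphism k -> F} := pi \o beta.
  have piE a : pi (beta a) = iota a by [].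
  have lphi : klin iota jK by apply: klin_rmorph => a; rewrite jKA.
  (* Since [T] fixes [xi], the functional [jK] kills all differences [act b - pr b]. Thus
     [act b = 0] forces [pi b = 0], so the kernel of [act] lies in [P]. *)
  have kphi : stabker T x pi jK.
    move=> a i; transitivity (jK a * ((map_mx jK T *m xi) i 0 - xi i 0)).
      rewrite [X in X - _]mxE.
      have -> : xi i 0 = \sum_s jK (i == s)%:R * xi s 0.
        rewrite (bigD1 i) //= eqxx rmorph1 mul1r big1 ?addr0 // => s /negPf ne.
        by rewrite eq_sym ne rmorph0 mul0r.
      rewrite -sumrB mulr_sumr; apply: eq_bigr => s _.
      by rewrite rmorphM rmorphB -mulrA mulrBl !mxE.
    by rewrite Txi subrr mulr0.
  have := @theta_stab _ _ _ _ _ _ _ _ _ _ L _ _ _ piE jK (act b - pr b) lphi kphi.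
  rewrite act0 sub0r thetaN (theta_pr L piE _ lphi) rmorph1 mul1r => h.
  rewrite -oppr_eq0; apply/eqP/h; exists [:: (1, b)].
  by rewrite big_seq1 mul1r act0 sub0r.
(* The norm of [l2], which is nonzero after [T] but vanishes at [xi], separates [P] from the kernel
   of [act]. *)
have [b nz_b b0] := form_norm_exists y l2T.
exists (e b); last by rewrite inE; apply: contra nz_b => /eqP/actE ->.
rewrite kerP; apply/eqP/(b0 _ jK (pi \o e)) => [a|i|] /=.
- by rewrite eC jKA.
- have /matrixP/(_ i 0) := Txi; rewrite mxE [RHS]mxE eX => <-.
  by apply: eq_bigr => s _; rewrite !mxE eX.
transitivity ((map_mx jK l2 *m xi) 0 0); last by rewrite k2 mxE.
by rewrite mxE; apply: eq_bigr => s _; rewrite !mxE eX.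
Qed.

Theorem proposition17p14 (k : fieldType) (n : nat) (hn : (1 <= n)%N)
    (G : finSubgroupSL k n) (hG : linearly_reductive G) :
  small_on_polynomials G /\ small_on_series G.
Proof.
have [y] : inhabited (kbasis (coord_ring G)).
  by have [s sP] := coord_ring_finite G; apply: (kbasis_exists sP).
have domP (R : idomainType) : nozerodiv {mpoly R[n]}.
  by move=> u v /eqP; rewrite mulf_eq0.
split.
  apply: small_linear_action hn hG (mpoly_linear_action (univ_point G) y) _.
  apply: (height_ge2_forms (e := idfun) (domP k)) => // K T; have [z] := fieldExt_kbasis K.
  exists {mpoly K[n]}, (mpoly_act T), (mpoly_pr n K), (mpoly_linear_action T z).
  by split; first exact: domP.
apply: small_linear_action hn hG (mseries_linear_action (univ_point G) y) _.
apply: (height_ge2_forms (e := @spoly k n)) => //.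
- exact: mseries_nozerodiv.
- exact: spoly_inj.
move=> K T; have [z] := fieldExt_kbasis K.
exists (mseries K n), (mseries_act T), (mseries_pr n K), (mseries_linear_action T z).
split=> [|b]; first exact: mseries_nozerodiv.
rewrite mseries_act_spoly; split=> [|->]; last exact: rmorph0.
by rewrite -[RHS](rmorph0 (@spoly K n)) => /spoly_inj.
Qed.
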